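(* Let $c\in P^\sigma(\mathcal{T}_\varphi)$ be a $\sigma$-Ptolemy assignment of the canonical triangulation $\mathcal{T}_\varphi$ of the once-punctured torus bundle $M_\varphi$ and let $\rho:\pi_1(M_\varphi)\to\mathrm{SL}_2(\mathbb{C})$ be the representation (up to conjugation) determined by $c$. If the twisted cohomology $H^*(M_\varphi;V)$, $V=\mathfrak{sl}_2(\mathbb{C})\otimes\mathbb{C}(t)$ twisted by $\mathrm{Ad}\rho\otimes\alpha$, is trivial and the restriction of $\rho$ to the punctured torus $F$ is irreducible, then the adjoint twisted Alexander polynomial $\tau(\rho,t)$ associated to $\rho$ is given (up to multiplication by $\pm t^k$, $k\in\mathbb{Z}$) by $$\tau(\rho,t)=\det\left(tI-\frac{\partial\big(c(e_{N-1}),c(e_{N-t_n}),c(e_N)\big)}{\partial\big(c(e_{N+1}),c(e_{N+2}),c(e_{N+3})\big)}\right),$$ where $c(e_{N-1}),c(e_{N-t_n}),c(e_N)$ are viewed as rational functions in $c(e_{N+1}),c(e_{N+2}),c(e_{N+3})$ and the Jacobian matrix is evaluated at the given assignment $c$.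
   Context: **Bundle and canonical triangulation.** $F=(\mathbb{R}^2\setminus\mathbb{Z}^2)/\mathbb{Z}^2$ is the once-punctured torus and $M_\varphi$ is the $F$-bundle over $S^1$ with monodromy $\varphi=R^{s_1}L^{t_1}\cdots R^{s_n}L^{t_n}\in\mathrm{SL}_2(\mathbb{Z})$, $s_i,t_i\ge1$, $R=\begin{pmatrix}1&1\\0&1\end{pmatrix}$, $L=\begin{pmatrix}1&0\\1&1\end{pmatrix}$; it is assumed that $t_n\ge2$. $\alpha:\pi_1(M_\varphi)\twoheadrightarrow\mathbb{Z}$ is induced by $M_\varphi\to S^1$. $N=\sum(s_i+t_i)$, $\varphi_i\in\{R,L\}$ is the $i$-th letter, $\varphi_0=\varphi_N$. Define $(h_0,v_0)$ = standard basis of $\mathbb{Z}^2$, $(h_i,v_i)=(h_{i-1},h_{i-1}+v_{i-1})$ if $\varphi_{i-1}=R$, $(h_i,v_i)=(h_{i-1}+v_{i-1},v_{i-1})$ if $\varphi_{i-1}=L$, and $d_i=h_i+v_i$. Let $\tau_i$ ($0\le i\le N$) be the ideal triangulation of $F$ by two triangles with straight edges of directions $h_i$ (''horizontal''), $v_i$ (''vertical''), $d_i$ (''diagonal''), oriented by these vectors. $\Delta_i$ ($1\le i\le N$) is the ideal tetrahedron with bottom faces the triangles of $\tau_{i-1}$ and top faces those of $\tau_i$: if $\varphi_{i-1}=R$ (resp. $L$), it has the edge $v_{i-1}$ (resp. $h_{i-1}$) at the bottom, opposite to the new edge $d_i$ at the top, and its four other edges are two copies each of $h_{i-1},d_{i-1}$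 (resp. $v_{i-1},d_{i-1}$). Stacking $\Delta_1,\dots,\Delta_N$ gives $M_N$; $M_\varphi$ with the canonical triangulation $\mathcal{T}_\varphi$ is obtained by identifying the top surface $\tau_N$ with the bottom surface $\tau_0$ via the linear map $h_N\mapsto h_0$, $v_N\mapsto v_0$. $e_{N+1},e_{N+2},e_{N+3}$ denote the bottom edges $h_0,v_0,d_0$, and $e_i$ ($1\le i\le N$) the edge $d_i$; the top edges $h_N,v_N,d_N$ are $e_{N-1},e_{N-t_n},e_N$. **$\sigma$-Ptolemy assignments.** Truncate all tetrahedra: this decomposes the compact core $\overline M_\varphi$; short-edges are the edges of the triangulated boundary $\partial\overline M_\varphi$, each of which cuts a corner of a triangle of some $\tau_i$. The cocycle $\sigma$ with values in $\{\pm1\}$ on short-edges is: for each $i$, the short-edge at the corner $h_i$ of the triangle of $\tau_i$ with vertices $0,h_i,h_i+v_i$ (mod $\mathbb{Z}^2$) gets $-1$, the other five short-edges of $\tau_i$ get $+1$. A $\sigma$-Ptolemy assignment $c\in P^\sigma(\mathcal{T}_\varphi)$ assigns to oriented edges numbers in $\mathbb{C}^*$ with $c(-e)=-c(e)$ satisfying, for each tetrahedron $[v_0,v_1,v_2,v_3]$ with $l_{ij}$ the edge from $v_i$ to $v_j$ and $s_{ijk}$ the short-edge at $v_j$ from $l_{ij}$ to $l_{jk}$, $$c(l_{02})c(l_{13})-\tfrac{\sigma(s_{031})\sigma(s_{302})}{\sigma(s_{312})\sigma(s_{021})}c(l_{03})c(l_{12})-\tfrac{\sigma(s_{013})\sigma(s_{102})}{\sigma(s_{132})\sigma(s_{023})}c(l_{01})c(l_{23})=0.$$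 Explicitly, if $e_\alpha,e_\beta,e_\gamma$ are the horizontal, vertical and diagonal edges of $\tau_{i-1}$ (so that those of $\tau_i$ are $(e_\alpha,e_\gamma,e_i)$ if $\varphi_{i-1}=R$ and $(e_\gamma,e_\beta,e_i)$ if $\varphi_{i-1}=L$), then $c(e_i)=\frac{c(e_\alpha)^2+c(e_\gamma)^2}{c(e_\beta)}$ if $\varphi_{i-1}=R$ and $c(e_i)=\frac{c(e_\beta)^2+c(e_\gamma)^2}{c(e_\alpha)}$ if $\varphi_{i-1}=L$; this recursion defines each $c(e_i)$, $1\le i\le N$, as a rational function of $c(e_{N+1}),c(e_{N+2}),c(e_{N+3})$. In addition $c(e_{N+1})=c(e_{N-1})$, $c(e_{N+2})=c(e_{N-t_n})$, $c(e_{N+3})=c(e_N)$. The representation $\rho$ determined by $c$ is induced by the $\mathrm{SL}_2(\mathbb{C})$-valued cocycle on oriented edges of the truncated decomposition ($\rho(-e)=\rho(e)^{-1}$, product $1$ around every 2-cell) $\rho(l_{ij})=\begin{pmatrix}0&-c(l_{ij})^{-1}\\c(l_{ij})&0\end{pmatrix}$, $\rho(s_{ijk})=\begin{pmatrix}\sigma(s_{ijk})&-\frac{\sigma(s_{kij})}{\sigma(s_{jki})}\frac{c(l_{ki})}{c(l_{ij})c(l_{jk})}\\0&\sigma(s_{ijk})^{-1}\end{pmatrix}$. **Adjoint twisted Alexander polynomial.** $\gamma\in\pi_1(M_\varphi)$ acts on $V$ by $\mathrm{Ad}\rho(\gamma)\otimes t^{\alpha(\gamma)}$. When the (co)homology is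 trivial, $\tau(\rho,t)$ is the Reidemeister torsion of the twisted cellular chain complex of the compact core with coefficients in $V$, normalized as $\prod_i[\partial(b_{i+1})\,b_i/c_i]^{(-1)^{i+1}}$ ($c_i$ geometric bases, $b_i\subset C_i$ lifts of bases of the images of $\partial:C_i\to C_{i-1}$); it is well-defined up to $\pm t^k$. *)

(* Defs.v *)
From HB Require Import structures.
From mathcomp Require Import all_boot all_order all_algebra.
From mathcomp Require Import complex.
From mathcomp Require Import all_classical all_reals all_analysis.
Import Order.TTheory GRing.Theory Num.Theory.
Import numFieldNormedType.Exports.

Set Implicit Arguments.
Unset Strict Implicit.
Unset Printing Implicit Defensive.

Local Open Scope ring_scope.

(* Matrices act on column vectors. *)
Section BasedComplexes.
Variables (K : fieldType) (dim : nat -> nat).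

Definition mxlin m n (A : 'M[K]_(m, n)) : 'Hom('cV[K]_n, 'cV[K]_m) :=
  linfun (mulmx A).

Definition cohomology_trivial (d : forall k, 'M[K]_(dim k.+1, dim k)) : Prop :=
  lker (mxlin (d 0%N)) = 0%VS /\
  forall k, lker (mxlin (d k.+1)) = limg (mxlin (d k)).

Variable bd : forall k, 'M[K]_(dim k, dim k.+1).

(* [b k] is a lift to [C_k] of a basis of the image of [C_k -> C_(k-1)]. *)
Definition lifted_bases (b : forall k, seq 'cV[K]_(dim k)) : Prop :=
  b 0%N = [::] /\
  forall k, basis_of (limg (mxlin (bd k))) (map (mulmx (bd k)) (b k.+1)).

Definition det_cols m (s : seq 'cV[K]_m) : K :=
  \det (\matrix_(i < m, j < m) (s`_j) i 0).

(* The torsion of a complex concentrated in degrees [0 .. 3]. *)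
Definition torsion (b : forall k, seq 'cV[K]_(dim k)) : K :=
  \prod_(k < 4)
    det_cols (map (mulmx (bd k)) (b k.+1) ++ b k) ^ ((-1) ^+ k.+1).

End BasedComplexes.

Local Open Scope nat_scope.

Inductive letter := letterR | letterL.

Definition word (n : nat) (s t : nat -> nat) : seq letter :=
  flatten [seq nseq (s i) letterR ++ nseq (t i) letterL | i <- iota 1 n].

(* Cells of the compact core, truncated along the ideal vertices.  Edges, levels
   and tetrahedra are numbered from 1 to N as e_i, tau_i and Delta_i.  A triangle
   of tau_i is a boolean: [false] is the one with vertices 0, h_i, h_i + v_i, and
   [true] the one with vertices 0, v_i, h_i + v_i.  The vertices of a triangle
   are numbered 0, 1, 2 in this order.
   - [Vert e b]: where the edge e is truncated, near its start ([b = false]) or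
     its end ([b = true]);
   - [Long e]: the edge e;
   - [Short i T y]: the short-edge of tau_i at the vertex y of T, oriented as
     s_{xyz} where x < z are the two other vertices of T;
   - [Hex i T]: the truncated triangle T of tau_i, with boundary in the direction
     0, 1, 2;
   - [Cap i k]: the triangle truncating the vertex k of Delta_i;
   - [Tet i]: the truncated Delta_i. *)
Inductive cell :=
  | Vert of nat & bool
  | Long of nat
  | Short of nat & bool & nat
  | Hex of nat & bool
  | Cap of nat & nat
  | Tet of nat.

Definition cell_eq_dec : comparable cell.
Proof. by rewrite /comparable /decidable; repeat decide equality. Defined.
HB.instance Definition _ := hasDecEq.Build cell (compareP cell_eq_dec).

(* [(true, x)] is x with the opposite orientation. *)
Definition ocell : Type := bool * cell.
Definition path_ : Type := seq ocell.
Definition rev_path (p : path_) : path_ := [seq (~~ x.1, x.2) | x <- rev p].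

Section Triangulation.
Variable w : seq letter.
Let N := size w.

(* The i-th letter for 1 <= i <= N, and phi_0 = phi_N. *)
Definition phi (i : nat) : letter :=
  if i is j.+1 then nth letterL w j else last letterL w.

(* The indices in 1 .. N+3 of the edges (h_i, v_i, d_i) of tau_i in the stack
   Delta_1, ..., Delta_N, before the top is glued to the bottom. *)
Fixpoint level_edges (i : nat) : nat * nat * nat :=
  if i is j.+1 then
    let: (a, b, g) := level_edges j in
    match phi j with
    | letterR => (a, g, j.+1)
    | letterL => (g, b, j.+1)
    end
  else (N.+1, N.+2, N.+3).

(* Gluing of tau_0 to tau_N. *)
Definition glue_edge (e : nat) : nat :=
  let: (a, b, g) := level_edges N in
  if e == N.+1 then a else if e == N.+2 then b else if e == N.+3 then g else e.

Definition glue_level (i : nat) : nat := if i == 0 then N else i.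

(* The edge joining the vertices x and y of the triangle T of tau_i. *)
Definition tri_edge (i : nat) (T : bool) (x y : nat) : nat :=
  let: (a, b, g) := level_edges i in
  match minn x y, maxn x y with
  | 0, 1 => if T then b else a
  | 1, 2 => if T then a else b
  | _, _ => g
  end.

Definition tri_long i T x y : ocell := (y < x, Long (glue_edge (tri_edge i T x y))).

(* The truncation point near x of the edge from x to y. *)
Definition tri_vert i T x y : cell := Vert (glue_edge (tri_edge i T x y)) (y < x).

(* s_{xyz} *)
Definition tri_short i T x y z : ocell := (z < x, Short (glue_level i) T y).

(* Delta_i has vertices 0, h, h+v, 2h+v if phi_{i-1} = R, and 0, v, h+v, h+2v if
   phi_{i-1} = L, where h = h_{i-1}, v = v_{i-1}; they are numbered 0, 1, 2, 3 in
   this order, so that all edges are oriented from the smaller to the larger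
   vertex. *)
Definition tet_edge (i x y : nat) : nat :=
  let: (a, b, g) := level_edges i.-1 in
  match minn x y, maxn x y with
  | 0, 3 => i
  | 1, 2 => match phi i.-1 with letterR => b | letterL => a end
  | 0, 1 | 2, 3 => match phi i.-1 with letterR => a | letterL => b end
  | _, _ => g
  end.

(* Level and shape of the face of Delta_i opposite to the vertex m. *)
Definition tet_face (i m : nat) : nat * bool :=
  match m, phi i.-1 with
  | 0, letterR => (i.-1, true)
  | 1, letterR => (i, true)
  | 2, letterR => (i, false)
  | _, letterR => (i.-1, false)
  | 0, letterL => (i.-1, false)
  | 1, letterL => (i, false)
  | 2, letterL => (i, true)
  | _, letterL => (i.-1, true)
  end.

Definition tet_long i x y : ocell := (y < x, Long (glue_edge (tet_edge i x y))).
Definition tet_vert i x y : cell := Vert (glue_edge (tet_edge i x y)) (y < x).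

(* s_{xyz} lies in the face opposite to m = 6 - x - y - z, in which the vertex x
   of Delta_i has the number [unbump m x]. *)
Definition tet_short i x y z : ocell :=
  let m := 6 - (x + y + z) in
  let: (j, T) := tet_face i m in
  tri_short j T (unbump m x) (unbump m y) (unbump m z).

Definition cells (k : nat) : seq cell :=
  let I := iota 1 N in
  let B := [:: false; true] in
  match k with
  | 0 => [seq Vert e b | e <- I, b <- B]
  | 1 => [seq Long e | e <- I] ++
         [seq Short x.1 x.2 y | x <- [seq (i, T) | i <- I, T <- B], y <- iota 0 3]
  | 2 => [seq Hex i T | i <- I, T <- B] ++ [seq Cap i k | i <- I, k <- iota 0 4]
  | 3 => [seq Tet i | i <- I]
  | _ => [::]
  end.

(* The smaller and the larger of the two vertices of a triangle other than y. *)
Definition short_ends (y : nat) : nat * nat := (bump y 0, bump y 1).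

Definition osrc (x : ocell) : cell :=
  match x with
  | (b, Long e) => Vert e b
  | (b, Short i T y) =>
      let: (x0, x1) := short_ends y in tri_vert i T y (if b then x1 else x0)
  | (_, c) => c
  end.

Definition otgt (x : ocell) : cell := osrc (~~ x.1, x.2).

Fixpoint is_path (x : cell) (p : path_) (y : cell) : bool :=
  if p is e :: q then
    [&& e.2 \in cells 1, osrc e == x & is_path (otgt e) q y]
  else x == y.

(* The cocycle representing alpha.  In the infinite cyclic cover, whose deck
   group is generated by the upward translation taking tau_0 to tau_N, lift e_i
   (1 <= i <= N) to the stack Delta_1, ..., Delta_N; the bottom edges e_{N+1},
   e_{N+2}, e_{N+3} are then translates by -1 of these lifts. *)
Definition sheet (e : nat) : int := if N < e then (-1)%R else 0%R.

Definition alpha_edge (x : ocell) : int :=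
  match x with
  | (b, Short i T y) =>
      let: (x0, x1) := short_ends y in
      ((-1) ^+ b * (sheet (tri_edge i T y x1) - sheet (tri_edge i T y x0)))%R
  | _ => 0%R
  end.

Definition alpha (p : path_) : int := (\sum_(x <- p) alpha_edge x)%R.

(* The vertex of a cell at which its lifts to the universal cover are based. *)
Definition base (c : cell) : cell :=
  match c with
  | Vert e b => Vert e b
  | Long _ | Short _ _ _ => osrc (false, c)
  | Hex i T => tri_vert i T 0 1
  | Cap i k => tet_vert i k (bump k 0)
  | Tet i => tet_vert i 0 1
  end.

(* The faces of a cell, with their signs ([true] for -1), and with a path inside
   the cell from its base vertex to the base vertex of the face. *)
Definition face : Type := (bool * path_ * cell)%type.

Fixpoint loop_faces (q p : path_) : seq face :=
  if p is x :: p' then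
    (x.1, if x.1 then rcons q x else q, x.2) :: loop_faces (rcons q x) p'
  else [::].

(* A path in Delta_i from the truncation point near 0 of the edge [0, 1] to the
   one near j of the edge [j, k]. *)
Definition tet_path (i j k : nat) : path_ :=
  let turn x y z := if x == z then [::] else [:: tet_short i x y z] in
  if j == 0 then turn 1 0 k
  else turn 1 0 j ++ tet_long i 0 j :: turn 0 j k.

Definition faces (c : cell) : seq face :=
  match c with
  | Vert _ _ => [::]
  | Long _ | Short _ _ _ =>
      [:: (false, [:: (false, c)], otgt (false, c));
          (true, [::], osrc (false, c))]
  | Hex i T =>
      loop_faces [::]
        [:: tri_long i T 0 1; tri_short i T 0 1 2;
            tri_long i T 1 2; tri_short i T 1 2 0;
            tri_long i T 2 0; tri_short i T 2 0 1]
  | Cap i k =>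
      let: (x, y, z) := (bump k 0, bump k 1, bump k 2) in
      loop_faces [::] [:: tet_short i x k y; tet_short i y k z; tet_short i z k x]
  | Tet i =>
      [seq (odd m, tet_path i (bump m 0) (bump m 1),
            Hex (glue_level (tet_face i m).1) (tet_face i m).2) | m <- iota 0 4] ++
      [seq (~~ odd k, tet_path i k (bump k 0), Cap i k) | k <- iota 0 4]
  end.

(* The base point, on the fiber tau_0 = tau_N. *)
Definition basepoint : cell := Vert N false.

Definition fiber_edges : seq cell :=
  let: (a, b, g) := level_edges N in
  [:: Long a; Long b; Long g] ++
  [seq Short N T y | T <- [:: false; true], y <- iota 0 3].

Definition fiber_loop (p : path_) : bool :=
  is_path basepoint p basepoint && all (fun x : ocell => x.2 \in fiber_edges) p.

(* A choice, for each cell, of a lift to the universal cover, i.e., of a path from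
   the base point to the base vertex of the cell. *)
Definition is_lifting (lift : cell -> path_) : Prop :=
  forall k c, c \in cells k -> is_path basepoint (lift c) (base c).

Local Open Scope ring_scope.

Section Ptolemy.
Variable C : fieldType.

Definition sigma (x : ocell) : C :=
  if x.2 is Short _ false 1%N then -1 else 1.

(* An assignment is given by its values c e on the edges oriented by h_i, v_i,
   d_i, and extended by c(-e) = - c(e). *)
Definition oval (c : nat -> C) (x : ocell) : C :=
  if x.2 is Long e then (-1) ^+ x.1 * c e else 0.

Definition tet_c (c : nat -> C) (i x y : nat) : C := oval c (tet_long i x y).
Definition tet_sigma (i x y z : nat) : C := sigma (tet_short i x y z).

(* [v_0, v_1, v_2, v_3] is Delta_i with its vertices in increasing order. *)
Definition ptolemy (c : nat -> C) : Prop :=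
  (forall e, (1 <= e <= N)%N -> c e != 0) /\
  (forall i, (1 <= i <= N)%N ->
    tet_c c i 0 2 * tet_c c i 1 3
    - (tet_sigma i 0 3 1 * tet_sigma i 3 0 2)
      / (tet_sigma i 3 1 2 * tet_sigma i 0 2 1) * (tet_c c i 0 3 * tet_c c i 1 2)
    - (tet_sigma i 0 1 3 * tet_sigma i 1 0 2)
      / (tet_sigma i 1 3 2 * tet_sigma i 0 2 3) * (tet_c c i 0 1 * tet_c c i 2 3)
    = 0).

Definition mx22 (p q r s : C) : 'M[C]_2 :=
  \matrix_(i, j) if i == 0 then (if j == 0 then p else q)
                 else (if j == 0 then r else s).

Definition rho_pos (c : nat -> C) (x : cell) : 'M[C]_2 :=
  match x with
  | Long e => mx22 0 (- (c e)^-1) (c e) 0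
  | Short n T j =>
      let: (i, k) := short_ends j in
      let l x y := oval c (tri_long n T x y) in
      let s x y z := sigma (tri_short n T x y z) in
      mx22 (s i j k) (- (s k i j / s j k i) * (l k i / (l i j * l j k)))
           0         (s i j k)^-1
  | _ => 1
  end.

Definition rho_edge (c : nat -> C) (x : ocell) : 'M[C]_2 :=
  if x.1 then invmx (rho_pos c x.2) else rho_pos c x.2.

Definition rho (c : nat -> C) (p : path_) : 'M[C]_2 :=
  \prod_(x <- p) rho_edge c x.

Definition fiber_irreducible (c : nat -> C) : Prop :=
  forall W : {vspace 'cV[C]_2},
    (forall p, fiber_loop p -> forall v, v \in W -> rho c p *m v \in W) ->
    W = 0%VS \/ W = fullv.

(* The basis E, H, F of sl_2, and the coordinates of a traceless matrix in it. *)
Definition sl2_basis (j : 'I_3) : 'M[C]_2 :=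
  [:: mx22 0 1 0 0; mx22 1 0 0 (-1); mx22 0 0 1 0]`_j.

Definition sl2_coord (i : 'I_3) (X : 'M[C]_2) : C :=
  [:: X 0 1; X 0 0; X 1 0]`_i.

Definition Ad (g : 'M[C]_2) : 'M[C]_3 :=
  \matrix_(i, j) sl2_coord i (g *m sl2_basis j *m invmx g).

Definition ratfun : Type := {fraction {poly C}}.

Definition ratconst (a : C) : ratfun := tofrac (a%:P).
Definition tvar : ratfun := tofrac 'X.

(* The action on V = sl_2 (x) C(t) of the class of a loop. *)
Definition twist (c : nat -> C) (p : path_) : 'M[ratfun]_3 :=
  tvar ^ (alpha p) *: map_mx ratconst (Ad (rho c p)).

Definition tdim (k : nat) : nat := (\sum_(a < size (cells k)) 3)%N.

Section Complexes.
Variables (c : nat -> C) (lift : cell -> path_).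

Definition nth_cell k (a : 'I_(size (cells k))) : cell := nth (Tet 0) (cells k) a.

(* For each face f' = f of s, the lift of f' lying in the boundary of the lift of
   s is g f~, with g the class of the loop [face_loop s q f]. *)
Definition face_loop (s : cell) (q : path_) (f : cell) : path_ :=
  lift s ++ q ++ rev_path (lift f).

(* Hom_{Z[pi]}(C_*(M~), V): (delta phi)(s~) is the sum of the +- g phi(f~). *)
Definition coboundary_block (s f : cell) : 'M[ratfun]_3 :=
  \sum_(x <- faces s | x.2 == f) (-1) ^+ x.1.1 *: twist c (face_loop s x.1.2 f).

Definition coboundary k : 'M[ratfun]_(tdim k.+1, tdim k) :=
  \mxblock_(a < size (cells k.+1), b < size (cells k))
    coboundary_block (nth_cell a) (nth_cell b).

(* C_*(M~) (x)_{Z[pi]} V, with pi acting on the right of C_*(M~) by inverses: the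
   boundary of s~ (x) v is the sum of the +- f~ (x) g^-1 v. *)
Definition boundary_block (f s : cell) : 'M[ratfun]_3 :=
  \sum_(x <- faces s | x.2 == f)
    (-1) ^+ x.1.1 *: twist c (rev_path (face_loop s x.1.2 f)).

Definition boundary k : 'M[ratfun]_(tdim k, tdim k.+1) :=
  \mxblock_(a < size (cells k), b < size (cells k.+1))
    boundary_block (nth_cell a) (nth_cell b).

End Complexes.

(* The values at (h_i, v_i, d_i), as functions of x = (c(e_{N+1}), c(e_{N+2}),
   c(e_{N+3})); the divisions are the library's total ones, so this agrees with
   the rational function wherever the successive denominators do not vanish. *)
Fixpoint level_fun (x : 'rV[C]_3) (i : nat) : C * C * C :=
  if i is j.+1 then
    let: (a, b, g) := level_fun x j in
    match phi j with
    | letterR => (a, g, (a ^+ 2 + g ^+ 2) / b)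
    | letterL => (g, b, (b ^+ 2 + g ^+ 2) / a)
    end
  else (x 0 0, x 0 1, x 0 2).

(* c(e_i), 1 <= i <= N *)
Definition edge_fun (i : nat) (x : 'rV[C]_3) : C := (level_fun x i).2.

End Ptolemy.

End Triangulation.

Definition row3 (C : Type) (x y z : C) : 'rV[C]_3 :=
  \row_(j < 3) match val j with 0%N => x | 1%N => y | _ => z end.

(* The matrix of partial derivatives d y_i / d x_j; the library's ['J f p] acts on
   row vectors, hence the transpose. *)
Definition jacobian_matrix (C : numFieldType) m n
    (f : 'rV[C]_m -> 'rV[C]_n) (p : 'rV[C]_m) : 'M[C]_(n, m) :=
  (jacobian f p)^T.

(* Main.v *)
(* Let C_k be the twisted chain groups, with the basis E, H, F of sl_2 over each
   cell.  Split the coordinates of C_k into two sets, those of the first set being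
   matched with those of the second set for C_(k+1); the torsion is then an
   alternating product of the minors of the boundary maps given by the matching,
   up to a power of t coming from the choice of the lifts.  The matching is chosen
   so that the three minors are block triangular:
   - the three coordinates over a tetrahedron are matched with the F-coordinates of
     three of its caps, those over a hexagon with the F-coordinates of its
     short-edges, and the E- and F-coordinates of a long edge with the
     F-coordinates of its ends; these blocks have monomials in the edge values as
     determinants;
   - the E- and H-coordinates of the caps, short-edges and vertices give cyclic
     blocks, whose determinants are powers of 1 - t, which cancel;
   - the F-coordinates of the fourth caps against the H-coordinates of the long
     edges give, after a row operation eliminating the hexagons, the N x N matrix
     of the Ptolemy relations linearized in the variables log c(e), where a bottom
     edge counts as t times the top edge glued to it.
   Solving the linearized recursion from the bottom shows that the determinant of
   the last block is a monomial times det(1 - t J), with J the Jacobian matrix.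
   Each tetrahedron divides the product of the three edge values of a level by the
   dropped value and multiplies it by the new one, so that det J = 1; moreover J
   fixes the vector of bottom values because the recursion is homogeneous of
   degree 1.  For a 3 x 3 matrix these two facts give det(1 - tJ) = - det(t - J).
   All the comparisons are made between squares, as the torsion is only defined
   up to sign. *)

From HB Require Import structures.
Require Import Defs.
From mathcomp Require Import all_boot all_order all_algebra perm ring zify.
From mathcomp Require Import complex.
From mathcomp Require Import all_classical all_reals all_analysis.
Import Order.TTheory GRing.Theory Num.Theory.
Import numFieldNormedType.Exports.

Set Implicit Arguments.
Unset Strict Implicit.
Unset Printing Implicit Defensive.

Local Open Scope ring_scope.
Local Notation rev_path := Defs.rev_path.

(** * Determinants over finite index types *)

Section FiniteDeterminants.
Variable K : comNzRingType.

(** Rows and columns undergo the same permutation, so its two signs cancel. *)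
Lemma det_mxsub_bij m n (A : 'M[K]_n) (g : 'I_m -> 'I_n) :
  bijective g -> \det (mxsub g g A) = \det A.
Proof.
move=> gb; have emn : m = n.
  by have := bij_eq_card gb; rewrite !card_ord.
subst m; have gi := bij_inj gb.
have -> : mxsub g g A = row_perm (perm gi) (col_perm (perm gi) A).
  by apply/matrixP => i j; rewrite !mxE !permE.
rewrite row_permE col_permE !det_mulmx !det_perm mulrCA -signr_addb.
by rewrite odd_permV addbb mulr1.
Qed.

(** Rows and columns are indexed by arbitrary finite types, so that block decompositions become sum
    and product types. *)
Definition fmx (S T : finType) (A : S -> T -> K) : 'M[K]_(#|S|, #|T|) :=
  \matrix_(i, j) A (enum_val i) (enum_val j).

Definition fdet (S : finType) (A : S -> S -> K) : K := \det (fmx A).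

Lemma eq_fdet (S : finType) (A B : S -> S -> K) : A =2 B -> fdet A = fdet B.
Proof. by move=> AB; congr (\det _); apply/matrixP => i j; rewrite !mxE AB. Qed.

Lemma fdetE (S : finType) n (g : 'I_n -> S) (A : S -> S -> K) :
  bijective g -> fdet A = \det (\matrix_(i, j) A (g i) (g j)).
Proof.
move=> gb; pose h i := enum_rank (g i).
have hb : bijective h by apply: bij_comp gb; exact: enum_rank_bij.
rewrite /fdet -(det_mxsub_bij _ hb); congr (\det _).
by apply/matrixP => i j; rewrite !mxE /h !enum_rankK.
Qed.

Lemma fdet_ord n (A : 'I_n -> 'I_n -> K) : fdet A = \det (\matrix_(i, j) A i j).
Proof. by apply: fdetE; exists id. Qed.

Lemma fdet_bij (S T : finType) (h : S -> T) (A : T -> T -> K) :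
  bijective h -> fdet A = fdet (fun x y => A (h x) (h y)).
Proof.
move=> hb; have hb' : bijective (h \o (@enum_val S predT)).
  by apply: bij_comp => //; exact: enum_val_bij.
by rewrite (fdetE _ hb').
Qed.

Lemma fdet_mul (S : finType) (A B : S -> S -> K) :
  fdet (fun x y => \sum_z A x z * B z y) = fdet A * fdet B.
Proof.
rewrite /fdet -det_mulmx; congr (\det _); apply/matrixP => i j; rewrite !mxE.
rewrite (reindex (@enum_val S predT)) /=; last exact/onW_bij/enum_val_bij.
by apply: eq_bigr => k _; rewrite !mxE.
Qed.

Lemma fdet_tr (S : finType) (A : S -> S -> K) : fdet (fun x y => A y x) = fdet A.
Proof.
by rewrite /fdet -[RHS]det_tr; congr (\det _); apply/matrixP => i j; rewrite !mxE.
Qed.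

Lemma fdet_lsum (S T : finType) (A : S + T -> S + T -> K) :
  (forall x y, A (inl x) (inr y) = 0) ->
  fdet A = fdet (fun x y => A (inl x) (inl y)) * fdet (fun x y => A (inr x) (inr y)).
Proof.
move=> A0; pose g (k : 'I_(#|S| + #|T|)) : S + T :=
  match fintype.split k with inl i => inl (enum_val i) | inr j => inr (enum_val j) end.
have gb : bijective g.
  exists (fun x => unsplit (match x with inl s => inl (enum_rank s)
                                       | inr s => inr (enum_rank s) end)).
    move=> k; rewrite /g -[RHS]splitK; case: (fintype.split k) => i; by rewrite enum_valK.
  by case=> s; rewrite /g unsplitK enum_rankK.
have gl i : g (lshift _ i) = inl (enum_val i) by rewrite /g -/(unsplit (inl _)) unsplitK.
have gr i : g (rshift _ i) = inr (enum_val i) by rewrite /g -/(unsplit (inr _)) unsplitK.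
rewrite (fdetE _ gb) -[X in \det X]submxK.
rewrite (_ : ursubmx _ = 0).
  by rewrite det_lblock; congr (_ * _); congr (\det _); apply/matrixP => i j;
    rewrite !mxE ?gl ?gr.
by apply/matrixP => i j; rewrite !mxE gl gr.
Qed.

Lemma fdet_usum (S T : finType) (A : S + T -> S + T -> K) :
  (forall x y, A (inr x) (inl y) = 0) ->
  fdet A = fdet (fun x y => A (inl x) (inl y)) * fdet (fun x y => A (inr x) (inr y)).
Proof.
move=> A0; rewrite -fdet_tr fdet_lsum // (fdet_tr (fun x y => A (inl x) (inl y))).
by rewrite (fdet_tr (fun x y => A (inr x) (inr y))).
Qed.

Lemma fdet0 (S : finType) (A : S -> S -> K) : #|S| = 0%N -> fdet A = 1.
Proof. by rewrite /fdet; move: (fmx A); case: #|S| => // B _; rewrite det_mx00. Qed.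

Lemma fdet_fibers n (J : finType) (B : 'I_n -> J -> J -> K) :
  fdet (fun x y : 'I_n * J => (x.1 == y.1)%:R * B x.1 x.2 y.2) = \prod_i fdet (B i).
Proof.
elim: n => [|n IH] in B *; first by rewrite big_ord0 fdet0 // card_prod card_ord.
pose h (x : J + 'I_n * J) : 'I_n.+1 * J :=
  match x with inl j => (ord0, j) | inr x => (lift ord0 x.1, x.2) end.
have hb : bijective h.
  exists (fun x => match unlift ord0 x.1 with None => inl x.2 | Some i => inr (i, x.2) end).
    by case=> [j|[i j]] /=; rewrite ?unlift_none ?liftK.
  by case=> i j /=; case: unliftP => [k ->|->].
rewrite (fdet_bij _ hb) fdet_lsum /=; last by move=> j [i k] /=; rewrite mul0r.
by rewrite big_ord_recl -IH; congr (_ * _); apply: eq_fdet => x y /=; rewrite ?mul1r.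
Qed.

Lemma fdet_fiber (I J : finType) (B : I -> J -> J -> K) :
  fdet (fun x y : I * J => (x.1 == y.1)%:R * B x.1 x.2 y.2) = \prod_i fdet (B i).
Proof.
pose h (x : 'I_#|I| * J) := (enum_val x.1 : I, x.2).
have hb : bijective h.
  exists (fun x => (enum_rank x.1, x.2)) => [[i j]|[i j]]; by rewrite /h /= ?enum_valK ?enum_rankK.
rewrite (fdet_bij _ hb) [RHS](reindex (@enum_val I predT)) /=;
  last exact/onW_bij/enum_val_bij.
rewrite -(fdet_fibers (fun i => B (enum_val i))).
by apply: eq_fdet => x y /=; rewrite (inj_eq enum_val_inj).
Qed.

Lemma fdet_fiberr (I J : finType) (B : J -> I -> I -> K) :
  fdet (fun x y : I * J => (x.2 == y.2)%:R * B x.2 x.1 y.1) = \prod_j fdet (B j).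
Proof.
rewrite -fdet_fiber (@fdet_bij _ _ (fun x : J * I => (x.2, x.1))) //.
by exists (fun x => (x.2, x.1)) => -[].
Qed.

Lemma fdet_diag (I : finType) (a : I -> K) :
  fdet (fun x y => (x == y)%:R * a y) = \prod_i a i.
Proof.
rewrite /fdet (_ : fmx _ = diag_mx (\row_i a (enum_val i))).
  rewrite det_diag [RHS](reindex (@enum_val I predT)) /=; last exact/onW_bij/enum_val_bij.
  by apply: eq_bigr => i _; rewrite mxE.
by apply/matrixP => i j; rewrite !mxE (inj_eq enum_val_inj); case: eqP => [->|_];
  rewrite ?mul1r ?mul0r.
Qed.

Lemma fdetZ (I : finType) (a : K) (A : I -> I -> K) :
  fdet (fun x y => a * A x y) = a ^+ #|I| * fdet A.
Proof. by rewrite /fdet -detZ; congr (\det _); apply/matrixP => i j; rewrite !mxE. Qed.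

(** Sylvester's identity: the same two block matrices, multiplied in either order, give block
    triangular matrices whose determinants are the two sides. *)
Lemma det_1_mulC m n (A : 'M[K]_(m, n)) (B : 'M[K]_(n, m)) :
  \det (1%:M + A *m B) = \det (1%:M + B *m A).
Proof.
have e1 : block_mx 1%:M (- A) B 1%:M *m block_mx 1%:M A 0 1%:M
        = block_mx 1%:M 0 B (1%:M + B *m A).
  by rewrite mulmx_block !mulmx1 !mul1mx !mulmx0 !addr0 subrr addrC.
have e2 : block_mx 1%:M A 0 1%:M *m block_mx 1%:M (- A) B 1%:M
        = block_mx (1%:M + A *m B) 0 B 1%:M.
  by rewrite mulmx_block !mulmx1 !mul1mx !mul0mx !add0r addNr.
have := congr1 determinant e1; have := congr1 determinant e2.
by rewrite !det_mulmx !det_lblock !det_ublock !det1 !mulr1 !mul1r => <- <-.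
Qed.

(** Used to cut a cyclic matrix open: [T] is a triangular part, [G *m U] the part that wraps around,
    and a solution of [Z *m T = U] reduces the correction to a determinant of the small size [m]. *)
Lemma det_cut m n (T : 'M[K]_n) (G : 'M[K]_(n, m)) (U Z : 'M[K]_(m, n)) :
  Z *m T = U -> \det (T + G *m U) = \det T * \det (1%:M + Z *m G).
Proof.
by move=> <-; rewrite mulmxA -{1}[T]mul1mx -mulmxDl det_mulmx mulrC det_1_mulC.
Qed.

Lemma det_cycle n (s : K) (b : 'I_n -> K) : (0 < n)%N ->
  fdet (fun i j : 'I_n => s * ((i == j)%:R - b j * (i == (if j == 0 :> nat then n.-1 else j.-1) :> nat)%:R))
  = s ^+ n * (1 - \prod_i b i).
Proof.
case: n b => // n b _; rewrite fdetZ card_ord fdet_ord; congr (_ * _).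
(* [T] is upper unitriangular and [G *m U] has a single entry, in the lower left corner. [Z] holds
   minus the partial products of [b], which solve [Z *m T = U] by telescoping. *)
pose T : 'M[K]_n.+1 := \matrix_(i, j) ((i == j)%:R - b j * ((0 < j)%N && (i == j.-1 :> nat))%:R).
pose G : 'M[K]_(n.+1, 1) := \matrix_(i, j) (i == ord_max)%:R.
pose U : 'M[K]_(1, n.+1) := \matrix_(i, j) (- b j * (j == 0)%:R).
pose Z : 'M[K]_(1, n.+1) := \matrix_(i, j) (- \prod_(k < n.+1 | (k <= j)%N) b k).
have ZT : Z *m T = U.
  apply/matrixP => i j; rewrite !mxE.
  under eq_bigr do rewrite !mxE mulrBr.
  rewrite sumrB [X in X - _](bigD1 j) //= eqxx mulr1 [X in _ + X - _]big1 ?addr0 => [|k kj];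
    last by rewrite (negPf kj) mulr0.
  case: (posnP j) => [j0|j_gt0].
    rewrite [X in _ - X]big1 => [|k _]; last by rewrite j0 mulr0 mulr0.
    rewrite subr0 (_ : j = 0) ?eqxx ?mulr1; last exact: val_inj.
    by rewrite (big_pred1 0) // => k; rewrite leqn0.
  have j'n : (j.-1 < n.+1)%N by apply: leq_ltn_trans (leq_pred _) (ltn_ord j).
  rewrite (_ : (j == 0) = false) ?mulr0; last by apply/eqP => j0; rewrite j0 in j_gt0.
  rewrite [X in _ - X](bigD1 (Ordinal j'n)) //= eqxx mulr1 [X in _ - (_ + X)]big1 ?addr0; last first.
    move=> k kj; case: eqP => [kj'|_]; last by rewrite !mulr0.
    by case/eqP: kj; exact: val_inj.
  rewrite (bigD1 j) //= mulNr opprK mulrC addrC.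
  rewrite [X in _ - X * _](eq_bigl (fun k : 'I_n.+1 => (k <= j.-1)%N)) ?subrr // => k.
  by rewrite -(inj_eq val_inj) /=; lia.
have -> : \matrix_(i, j) ((i == j)%:R - b j * (i == (if j == 0 :> nat then n else j.-1) :> nat)%:R)
        = T + G *m U.
  apply/matrixP => i j; rewrite !mxE big_ord1 !mxE.
  have -> : (j == 0) = (j == 0%N :> nat) by [].
  have -> : (i == ord_max) = (i == n :> nat) by [].
  by case: (posnP j) => [->|j_gt0] /=; rewrite ?(gtn_eqF j_gt0) /=; ring.
rewrite (det_cut _ ZT) -[\det T]det_tr det_trig; last first.
  apply/is_trig_mxP => i j ij; rewrite !mxE -(inj_eq val_inj) /=.
  rewrite (_ : (j == i :> nat) = false); last by lia.
  rewrite (_ : (0 < i)%N && _ = false); last by lia.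
  by rewrite mulr0 subr0.
rewrite big1 ?mul1r => [|i _]; last first.
  rewrite !mxE eqxx (_ : (0 < i)%N && _ = false); last by lia.
  by rewrite mulr0 subr0.
rewrite det_mx11 !mxE (bigD1 ord_max) //= !mxE eqxx mulr1 [X in _ + (_ + X)]big1 ?addr0 => [|i ni].
  by congr (1 - _); apply: eq_bigl => i; rewrite -ltnS ltn_ord.
by rewrite !mxE (negPf ni) mulr0.
Qed.

End FiniteDeterminants.

(** * The torsion from coordinate minors *)

Section Torsion.
Variable K : fieldType.

Lemma mxlinE m n (A : 'M[K]_(m, n)) v : mxlin A v = A *m v.
Proof. by rewrite lfunE. Qed.

(** The width [r] is independent of the length of [s], so that lengths can be compared without
    casts; columns past the end of [s] are zero. *)
Definition cols m r (s : seq 'cV[K]_m) : 'M[K]_(m, r) := \matrix_(i, j) (s`_j) i 0.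

Lemma mul_cols m r (s : seq 'cV[K]_m) (x : 'cV_r) :
  cols r s *m x = \sum_(j < r) x j 0 *: s`_j.
Proof.
apply/matrixP => i j; rewrite !mxE summxE ord1; apply: eq_bigr => k _.
by rewrite !mxE mulrC.
Qed.

Lemma cols_map m n r (A : 'M[K]_(m, n)) (s : seq 'cV[K]_n) :
  cols r (map (mulmx A) s) = A *m cols r s.
Proof.
apply/matrixP => i j; rewrite !mxE.
have [js|sj] := ltnP j (size s).
  by rewrite (nth_map 0) // mxE; apply: eq_bigr => k _; rewrite mxE.
rewrite nth_default ?size_map // mxE big1 // => k _.
by rewrite mxE nth_default // mxE mulr0.
Qed.

Lemma basis_cols m (W : {vspace 'cV[K]_m}) s : basis_of W s ->
  (forall x : 'cV_(size s), cols (size s) s *m x = 0 -> x = 0) /\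
  (forall v, v \in W -> exists x : 'cV_(size s), v = cols (size s) s *m x).
Proof.
move=> bW; split=> [x|v vW].
  rewrite mul_cols => x0; apply/matrixP => i j; rewrite ord1 mxE.
  have /(@freeP _ _ _ (in_tuple s)) F := basis_free bW.
  exact: F (x^~ 0) x0 i.
rewrite -(span_basis bW) in vW; have := coord_span (X := in_tuple s) vW.
move=> ->; exists (\col_j coord (in_tuple s) j v).
by rewrite mul_cols; apply: eq_bigr => j _; rewrite mxE.
Qed.

Lemma det_cols_cat m p q (e : (p + q)%N = m) (s1 s2 : seq 'cV[K]_m) :
  size s1 = p ->
  det_cols (s1 ++ s2) = \det (castmx (erefl m, e) (row_mx (cols p s1) (cols q s2))).
Proof.
move=> sp; subst m; rewrite castmx_id; congr (\det _); apply/matrixP => i j; rewrite !mxE.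
rewrite nth_cat sp; case: splitP => k ->; rewrite !mxE ?ltn_ord //.
by rewrite addKn.
Qed.

(** * Comparison of lifted bases with a reference family *)

Section Reference.
Variables (dim r : nat -> nat) (bd : forall k, 'M[K]_(dim k, dim k.+1)).
Variable B : forall k, 'M[K]_(dim k, r k).
Hypothesis e : forall k, (r k.+1 + r k)%N = dim k.
Hypotheses (r0 : r 0 = 0%N) (r4 : r 4 = 0%N).
Hypothesis bd2 : forall k, bd k *m bd k.+1 = 0.

(** The matrix that enters the torsion when the columns of [B] serve as lifted bases. *)
Definition ref_mx k : 'M[K]_(dim k) :=
  castmx (erefl, e k) (row_mx (bd k *m B k.+1) (B k)).

Hypothesis ref_unit : forall k, ref_mx k \in unitmx.

Lemma ref_decomp k m (x : 'M[K]_(dim k, m)) :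
  exists y z, x = bd k *m B k.+1 *m y + B k *m z.
Proof.
(* The dimension is made a variable [n], so that the cast disappears by substitution. *)
suff H n p q (E : (p + q)%N = n) (A1 : 'M[K]_(n, p)) (A2 : 'M[_]_(n, q)) (X : 'M[_]_(n, m)) :
    castmx (erefl n, E) (row_mx A1 A2) \in unitmx -> exists y z, X = A1 *m y + A2 *m z.
  exact: H (ref_unit k).
subst n; rewrite castmx_id => U; pose Y := invmx (row_mx A1 A2) *m X.
exists (usubmx Y), (dsubmx Y).
by rewrite -mul_row_col vsubmxK mulKVmx.
Qed.

Lemma ref_inj k m (y : 'M[K]_(r k.+1, m)) : bd k *m B k.+1 *m y = 0 -> y = 0.
Proof.
suff H n p q (E : (p + q)%N = n) (A1 : 'M[K]_(n, p)) (A2 : 'M[_]_(n, q)) (X : 'M[_]_(p, m)) :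
    castmx (erefl n, E) (row_mx A1 A2) \in unitmx -> A1 *m X = 0 -> X = 0.
  exact: H (ref_unit k).
subst n; rewrite castmx_id => U X0.
have : row_mx A1 A2 *m col_mx X 0 = 0 by rewrite mul_row_col X0 mulmx0 addr0.
move/(congr1 (mulmx (invmx (row_mx A1 A2)))); rewrite mulKmx // mulmx0.
by move/(congr1 usubmx); rewrite col_mxKu => ->; apply/matrixP => i j; rewrite !mxE.
Qed.

Variable b : forall k, seq 'cV[K]_(dim k).
Hypothesis lb : lifted_bases bd b.

(** The component along the image of [bd k.+1] is killed by [bd k], so only the coordinates [z]
    along [B k.+1] survive. *)
Lemma lifted_decomp k m (s := cols m (b k.+1)) : exists y z,
  s = bd k.+1 *m B k.+2 *m y + B k.+1 *m z /\ bd k *m s = bd k *m B k.+1 *m z.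
Proof.
have [y [z E]] := ref_decomp s; exists y, z; split => //.
by rewrite E mulmxDr !mulmxA bd2 !mul0mx add0r.
Qed.

(** The images under [bd k] of the lifted family and of the reference family are expressed in each
    other by [z] and [q]; both are free, so [z] and [q] are inverse. The width [s] stays a variable
    because equality of the two lengths is deduced from this lemma. *)
Lemma lifted_inv k s (z : 'M[K]_(r k.+1, s)) : s = size (b k.+1) ->
  bd k *m cols s (b k.+1) = bd k *m B k.+1 *m z ->
  exists q, z *m q = 1%:M /\ q *m z = 1%:M.
Proof.
move=> es Ez; have [linj lsur] := basis_cols (lb.2 k).
rewrite size_map -es in linj lsur; rewrite cols_map in linj lsur.
have [q Eq] : exists q, bd k *m B k.+1 = bd k *m cols s (b k.+1) *m q.
  have H j : exists x : 'cV_s, col j (bd k *m B k.+1) = bd k *m cols s (b k.+1) *m x.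
    by apply: lsur; rewrite colE -mulmxA -mxlinE memv_img // memvf.
  have [f Ef] := fin_all_exists H; exists (\matrix_(i, j) (f j) i 0).
  apply/matrixP => i j; have /matrixP/(_ i 0) := Ef j; rewrite !mxE => ->.
  by apply: eq_bigr => l _; rewrite !mxE.
have zq : z *m q = 1%:M.
  apply/eqP; rewrite -subr_eq0; apply/eqP/(@ref_inj k).
  by rewrite mulmxBr mulmx1 mulmxA -Ez -Eq subrr.
exists q; split=> //; apply/eqP; rewrite -subr_eq0; apply/eqP/matrixP => i j.
have /matrixP/(_ i 0) : col j (q *m z - 1%:M) = 0.
  apply: linj; rewrite colE mulmxA.
  by rewrite mulmxBr mulmx1 mulmxA -Eq -Ez subrr mul0mx.
by rewrite !mxE.
Qed.

Lemma lifted_size k : size (b k) = r k.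
Proof.
case: k => [|k]; first by rewrite lb.1 r0.
have [y [z [_ Ez]]] := @lifted_decomp k (size (b k.+1)).
have [q [zq qz]] := lifted_inv erefl Ez.
by apply/eqP; rewrite eqn_leq (mulmx1_min zq) (mulmx1_min qz).
Qed.

Lemma lifted_trans k : exists y (z : 'M[K]_(r k)),
  cols (r k) (b k) = bd k *m B k.+1 *m y + B k *m z /\ \det z != 0.
Proof.
case: k => [|k].
  have [y [z E]] := ref_decomp (cols (r 0) (b 0)); exists y, z; split => //.
  by move: z {E}; rewrite r0 => z; rewrite det_mx00 oner_neq0.
have [y [z [E Ez]]] := @lifted_decomp k (r k.+1); exists y, z; split => //.
have [q [/(congr1 determinant) + _]] := lifted_inv (esym (lifted_size k.+1)) Ez.
rewrite det_mulmx det1 => dz; apply/eqP => z0; move: dz.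
by rewrite z0 mul0r => /eqP; rewrite eq_sym oner_eq0.
Qed.

(** The change from the reference basis to the lifted one is block triangular, with diagonal blocks
    [z1] and [z0]. *)
Lemma det_lifted k (z1 : 'M[K]_(r k.+1)) (z0 : 'M[K]_(r k)) y1 y0 :
  cols (r k.+1) (b k.+1) = bd k.+1 *m B k.+2 *m y1 + B k.+1 *m z1 ->
  cols (r k) (b k) = bd k *m B k.+1 *m y0 + B k *m z0 ->
  det_cols (map (mulmx (bd k)) (b k.+1) ++ b k) = \det (ref_mx k) * (\det z1 * \det z0).
Proof.
move=> E1 E0; rewrite (det_cols_cat (e k)); last by rewrite size_map lifted_size.
rewrite cols_map E1 E0 mulmxDr !mulmxA bd2 !mul0mx add0r.
rewrite /ref_mx; move: (bd k *m B k.+1) (B k) => C D.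
suff H n p q (E : (p + q)%N = n) (A1 : 'M[K]_(n, p)) (A2 : 'M[_]_(n, q)) Y Z1 Z0 :
    \det (castmx (erefl n, E) (row_mx (A1 *m Z1) (A1 *m Y + A2 *m Z0)))
    = \det (castmx (erefl n, E) (row_mx A1 A2)) * (\det Z1 * \det Z0).
  exact: H.
subst n; rewrite !castmx_id -(det_ublock Z1 Y Z0) -det_mulmx mul_row_block mulmx0 addr0.
by congr (\det (row_mx _ _)).
Qed.

(** The determinant of each transition matrix [z] occurs in two consecutive degrees, with opposite
    exponents, and cancels; those in degrees 0 and 4 have size 0. *)
Lemma torsion_ref :
  torsion bd b = \det (ref_mx 1) * \det (ref_mx 3) / (\det (ref_mx 0) * \det (ref_mx 2)).
Proof.
have H k : exists d : K, d != 0 /\ exists y (z : 'M[K]_(r k)), \det z = d /\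
   cols (r k) (b k) = bd k *m B k.+1 *m y + B k *m z.
  have [y [z [E z0]]] := lifted_trans k; exists (\det z); split=> //; by exists y, z.
have [d0 [n0 [y0 [z0 [D0 E0]]]]] := H 0%N; have [d1 [n1 [y1 [z1 [D1 E1]]]]] := H 1%N.
have [d2 [n2 [y2 [z2 [D2 E2]]]]] := H 2%N; have [d3 [n3 [y3 [z3 [D3 E3]]]]] := H 3%N.
have [d4 [n4 [y4 [z4 [D4 E4]]]]] := H 4%N.
have d01 : d0 = 1 by rewrite -D0; move: z0 {E0 D0}; rewrite r0 => z0; rewrite det_mx00.
have d41 : d4 = 1 by rewrite -D4; move: z4 {E4 D4}; rewrite r4 => z4; rewrite det_mx00.
rewrite /torsion !big_ord_recl !big_ord0 /= (det_lifted E1 E0) (det_lifted E2 E1).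
rewrite (det_lifted E3 E2) (det_lifted E4 E3) D0 D1 D2 D3 D4 d01 d41 !mulr1 !mul1r.
rewrite !exprN1 !sqrrN !expr1n ?exprS !expr1z.
have ref0 k : \det (ref_mx k) != 0 by rewrite -unitfE -unitmxE.
rewrite /bump /=; field.
by rewrite !ref0 n1 n2 n3.
Qed.

End Reference.

Definition selmx n (A : finType) (a : A -> 'I_n) : 'M[K]_(n, #|A|) :=
  \matrix_(i, j) (i == a (enum_val j))%:R.

Lemma mul_selmx m n (A : finType) (a : A -> 'I_n) (X : 'M[K]_(m, n)) i j :
  (X *m selmx a) i j = X i (a (enum_val j)).
Proof.
rewrite mxE (bigD1 (a (enum_val j))) //= mxE eqxx mulr1 big1 ?addr0 // => k ka.
by rewrite mxE (negPf ka) mulr0.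
Qed.

Definition sum_fun (A B C : Type) (f : A -> C) (g : B -> C) (x : A + B) : C :=
  match x with inl a => f a | inr b => g b end.

(** Once the rows [m] are moved to the top, the selected columns consist of a zero block above an
    identity block. The sign of this permutation is not tracked, whence the squares. *)
Lemma det_selmx n (A1 A0 : finType) (m : A1 -> 'I_n) (a : A0 -> 'I_n)
    (X : 'M[K]_(n, #|A1|)) (E : (#|A1| + #|A0|)%N = n) :
  bijective (sum_fun m a) ->
  \det (castmx (erefl n, E) (row_mx X (selmx a))) ^+ 2 =
  \det (\matrix_(i, j) X (m (enum_val i)) j) ^+ 2.
Proof.
move=> bij; subst n; rewrite castmx_id.
pose g (k : 'I_(#|A1| + #|A0|)) : 'I_(#|A1| + #|A0|) :=
  match fintype.split k with inl i => m (enum_val i) | inr j => a (enum_val j) end.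
have gb : injective g.
  move=> k l kl; apply: (can_inj (@splitK _ _)); move: kl; rewrite /g.
  have inj := bij_inj bij.
  case: (fintype.split k) => i; case: (fintype.split l) => j H.
  - by have [/enum_val_inj->] := inj (inl _) (inl _) H.
  - by have := inj (inl _) (inr _) H.
  - by have := inj (inr _) (inl _) H.
  - by have [/enum_val_inj->] := inj (inr _) (inr _) H.
have gl i : g (lshift _ i) = m (enum_val i) by rewrite /g -/(unsplit (inl _)) unsplitK.
have gr i : g (rshift _ i) = a (enum_val i) by rewrite /g -/(unsplit (inr _)) unsplitK.
have <- : \det (row_perm (perm gb) (row_mx X (selmx a))) ^+ 2 =
    \det (row_mx X (selmx a)) ^+ 2.
  by rewrite row_permE det_mulmx det_perm exprMn sqrr_sign mul1r.
rewrite -[X in \det X ^+ 2]submxK (_ : ursubmx _ = 0); last first.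
  apply/matrixP => i j; rewrite !mxE permE gl -/(unsplit (inr _)) unsplitK mxE.
  case: eqP => // H; by have := @bij_inj _ _ _ bij (inl _) (inr _) H.
have aI : injective a by move=> x y H; have [] := @bij_inj _ _ _ bij (inr x) (inr y) H.
rewrite det_lblock [X in _ * \det X](_ : _ = 1%:M); last first.
  apply/matrixP => i j; rewrite !mxE permE gr -/(unsplit (inr _)) unsplitK mxE.
  by rewrite (inj_eq aI) (inj_eq enum_val_inj).
by rewrite det1 mulr1; congr (\det _ ^+ 2); apply/matrixP => i j;
  rewrite !mxE permE gl -/(unsplit (inl _)) unsplitK.
Qed.

(** * Reference families of coordinate vectors *)

Section Minors.
Variables (dim : nat -> nat) (bd : forall k, 'M[K]_(dim k, dim k.+1)).
Variables (D : forall k, 'M[K]_(dim k, dim k.+1)) (G : forall k, 'M[K]_(dim k)).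
Hypothesis G_unit : forall k, G k \in unitmx.
Hypothesis bdE : forall k, bd k = G k *m D k *m invmx (G k.+1).
Hypothesis bd2 : forall k, bd k *m bd k.+1 = 0.
Variable A : nat -> finType.
Variables (a : forall k, A k -> 'I_(dim k)) (m : forall k, A k.+1 -> 'I_(dim k)).
Arguments a {k}.
Arguments m {k}.
Hypothesis ma_bij : forall k, bijective (sum_fun (@m k) (@a k)).
Hypotheses (A0 : #|A 0| = 0%N) (A4 : #|A 4| = 0%N).

Definition minor k : K := fdet (fun x y : A k.+1 => D k (m x) (a y)).

Hypothesis minor_neq0 : forall k, minor k != 0.

(** The coordinate vectors selected by [a], carried by the change of basis [G], serve as reference
    family. The determinant of each reference matrix is then that of [G] times a minor of [D], up to
    sign. *)
Lemma torsion_minors b : lifted_bases bd b ->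
  torsion bd b ^+ 2 =
  (\det (G 1) * \det (G 3) / (\det (G 0) * \det (G 2))) ^+ 2
  * (minor 1 / (minor 0 * minor 2)) ^+ 2.
Proof.
move=> lb; pose B k := G k *m selmx (@a k).
have e k : (#|A k.+1| + #|A k|)%N = dim k.
  by have := bij_eq_card (ma_bij k); rewrite card_sum card_ord.
have refE k : ref_mx bd B e k =
    G k *m castmx (erefl _, e k) (row_mx (D k *m selmx (@a k.+1)) (selmx (@a k))).
  rewrite /ref_mx /B bdE mulmxA mulmxKV // -mulmxA.
  suff H n p q (E : (p + q)%N = n) (X1 : 'M[K]_(n, p)) (Y1 : 'M[_]_(n, q)) (Z1 : 'M[_]_n) :
    castmx (erefl n, E) (row_mx (Z1 *m X1) (Z1 *m Y1)) =
    Z1 *m castmx (erefl n, E) (row_mx X1 Y1) by exact: H.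
  by subst n; rewrite !castmx_id mul_mx_row.
have det_ref k : \det (ref_mx bd B e k) ^+ 2 = \det (G k) ^+ 2 * minor k ^+ 2.
  rewrite refE det_mulmx exprMn (det_selmx _ _ (ma_bij k)); congr (_ * \det _ ^+ 2).
  by apply/matrixP => i j; rewrite [LHS]mxE mul_selmx [RHS]mxE.
have G0 k : \det (G k) != 0 by rewrite -unitfE -unitmxE.
have ref_unit k : ref_mx bd B e k \in unitmx.
  have : \det (ref_mx bd B e k) ^+ 2 != 0 by rewrite det_ref mulf_neq0 ?expf_neq0.
  by rewrite unitmxE unitfE expf_eq0.
rewrite (torsion_ref A0 A4 bd2 ref_unit lb).
have m3 : minor 3 = 1 by rewrite /minor fdet0.
rewrite !(exprMn, exprVn) !det_ref m3 expr1n mulr1.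
by field; rewrite !G0 !minor_neq0.
Qed.

End Minors.
End Torsion.

(** * The adjoint representation *)

Section SmallMatrices.
Variable K : comNzRingType.

Lemma det2E (A : 'M[K]_2) : \det A = A 0 0 * A 1 1 - A 0 1 * A 1 0.
Proof.
rewrite (expand_det_row _ 0) !big_ord_recl big_ord0 /cofactor !det_mx11 !mxE /=.
have -> : lift 0 0 = 1 :> 'I_2 by exact: val_inj.
have -> : lift 1 0 = 0 :> 'I_2 by exact: val_inj.
by rewrite expr0 expr1; ring.
Qed.

Lemma det3E (A : 'M[K]_3) : \det A =
  A 0 0 * (A 1 1 * A 2 2 - A 1 2 * A 2 1) - A 0 1 * (A 1 0 * A 2 2 - A 1 2 * A 2 0)
  + A 0 2 * (A 1 0 * A 2 1 - A 1 1 * A 2 0).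
Proof.
rewrite (expand_det_row _ 0) !big_ord_recl big_ord0 /cofactor !det2E !mxE /=.
have e01 : lift 0 0 = 1 :> 'I_3 by exact: val_inj.
have e02 : lift 0 1 = 2 :> 'I_3 by exact: val_inj.
have e00 : lift 0 0 = 1 :> 'I_2 by exact: val_inj.
rewrite !e00 !e01 !e02.
have -> : lift 1 0 = 0 :> 'I_3 by exact: val_inj.
have -> : lift 1 1 = 2 :> 'I_3 by exact: val_inj.
have -> : lift 2 0 = 0 :> 'I_3 by exact: val_inj.
have -> : lift 2 1 = 1 :> 'I_3 by exact: val_inj.
by rewrite /=; ring.
Qed.

Lemma matrix2P (A B : 'M[K]_2) :
  A 0 0 = B 0 0 -> A 0 1 = B 0 1 -> A 1 0 = B 1 0 -> A 1 1 = B 1 1 -> A = B.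
Proof.
move=> e1 e2 e3 e4; apply/matrixP => i j.
have H (k : 'I_2) : k = 0 \/ k = 1.
  by case: k => [[|[|//]] p]; [left|right]; apply: val_inj.
by case: (H i) => ->; case: (H j) => ->.
Qed.

Lemma ord3P (k : 'I_3) : [\/ k = 0, k = 1 | k = 2].
Proof.
by case: k => [[|[|[|//]]] p]; [constructor 1|constructor 2|constructor 3]; exact: val_inj.
Qed.

Lemma big_ord2 (F : 'I_2 -> K) : \sum_i F i = F 0 + F 1.
Proof.
rewrite !big_ord_recl big_ord0 addr0; congr (_ + F _); exact: val_inj.
Qed.

Lemma big_ord3 (F : 'I_3 -> K) : \sum_i F i = F 0 + F 1 + F 2.
Proof.
rewrite !big_ord_recl big_ord0 addr0 addrA; congr (_ + F _ + F _); exact: val_inj.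
Qed.

Definition mx33 (s : seq (seq K)) : 'M[K]_3 := \matrix_(i, j) (nth [::] s i)`_j.

(* The matrix of X |-> g X adj(g), multiplicative in g without any condition on
   the determinant. *)
Definition ad2 (g : 'M[K]_2) : 'M[K]_3 :=
  let: (p, q, r, s) := (g 0 0, g 0 1, g 1 0, g 1 1) in
  mx33 [:: [:: p ^+ 2; - 2 * p * q; - q ^+ 2];
           [:: - (p * r); p * s + q * r; q * s];
           [:: - r ^+ 2; 2 * r * s; s ^+ 2]].

Lemma ad2M g h : ad2 (g *m h) = ad2 g *m ad2 h.
Proof.
apply/matrixP => i j; rewrite /ad2 ![in LHS]mxE !big_ord2 ![in RHS]mxE big_ord3 !mxE.
by case: (ord3P i) => ->; case: (ord3P j) => -> /=; ring.
Qed.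

Lemma ad2_1 : ad2 1%:M = 1%:M.
Proof.
apply/matrixP => i j; rewrite /ad2 !mxE.
by case: (ord3P i) => ->; case: (ord3P j) => -> /=; rewrite ?mulr1n ?mulr0n; ring.
Qed.

Lemma det_ad2 g : \det (ad2 g) = \det g ^+ 3.
Proof. by rewrite det3E det2E !mxE /=; ring. Qed.

(** The Gram matrix of the trace form tr(XY) in the basis E, H, F, which is proportional to the
    Killing form. *)
Definition killing : 'M[K]_3 :=
  mx33 [:: [:: 0; 0; 1]; [:: 0; 2; 0]; [:: 1; 0; 0]].

Lemma adj2E (g : 'M[K]_2) : [/\ (\adj g) 0 0 = g 1 1, (\adj g) 0 1 = - g 0 1,
  (\adj g) 1 0 = - g 1 0 & (\adj g) 1 1 = g 0 0].
Proof.
have e10 : lift 1 0 = 0 :> 'I_2 by exact: val_inj.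
have e01 : lift 0 0 = 1 :> 'I_2 by exact: val_inj.
split; rewrite mxE /cofactor det_mx11 mxE mxE ?e10 ?e01.
- by rewrite [_ ^+ _]expr0 mul1r.
- by rewrite [_ ^+ _]expr1 mulN1r.
- by rewrite [_ ^+ _]expr1 mulN1r.
- by rewrite [_ ^+ _]expr2 mulrNN !mul1r.
Qed.

(** For the trace form, the adjoint of X -> g X adj(g) is X -> adj(g) X g. *)
Lemma ad2_killing g : (ad2 g)^T *m killing = killing *m ad2 (\adj g).
Proof.
have [a b c d] := adj2E g.
apply/matrixP => i j; rewrite [ad2 (\adj g)]/ad2 a b c d !mxE !big_ord3 !mxE.
by case: (ord3P i) => ->; case: (ord3P j) => -> /=; ring.
Qed.

End SmallMatrices.

Lemma invmx_adj (K : fieldType) n (g : 'M[K]_n) : \det g = 1 -> invmx g = \adj g.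
Proof. by move=> d; rewrite /invmx unitmxE d unitr1 invr1 scale1r. Qed.

Lemma AdE (K : fieldType) (g : 'M[K]_2) : \det g = 1 -> Ad g = ad2 g.
Proof.
move=> d; have [a b c e] := adj2E g; rewrite -invmx_adj // in a b c e.
apply/matrixP => i j; rewrite !mxE /sl2_coord.
by case: (ord3P i) => ->; case: (ord3P j) => -> /=;
  rewrite !(mxE, big_ord2) /= ?a ?b ?c ?e; ring.
Qed.

Lemma fracE (R : idomainType) (x : {fraction R}) :
  x = tofrac (frac (repr x)).1 / tofrac (frac (repr x)).2.
Proof.
rewrite -{1}[x]reprK; move: (repr x) => {}x.
unlock tofrac; rewrite -[_^-1]FracField.pi_inv -[X in _ = X]FracField.pi_mul.
rewrite /FracField.mulf /FracField.invf !numden_Ratio ?oner_neq0 ?mulr1 ?mul1r //.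
by rewrite Ratio_numden.
all: exact: denom_ratioP.
Qed.

(** * The automorphism of C(t) that inverts t *)

Section Reciprocal.
Variable C : fieldType.
Local Notation K := (ratfun C).
Local Notation t := (tvar C).

HB.instance Definition _ :=
  GRing.RMorphism.copy (@ratconst C) (@tofrac {poly C} \o polyC).

Lemma tvar_neq0 : t != 0. Proof. by rewrite tofrac_eq0 polyX_eq0. Qed.

Definition eval_inv : {poly C} -> K := horner_eval t^-1 \o map_poly (@ratconst C).
HB.instance Definition _ := GRing.RMorphism.on eval_inv.

(** Multiplying p(1/t) by t to the degree of p gives the reversed polynomial, whose constant term is
    the leading coefficient of p. *)
Lemma eval_inv_eq0 p : (eval_inv p == 0) = (p == 0).
Proof.
apply/idP/eqP => [/eqP p0|->]; last by rewrite rmorph0.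
apply/eqP; case: (boolP (p == 0)) => // pn0; exfalso.
pose m := (size p).-1; have sp : size p = m.+1 by rewrite prednK // size_poly_gt0.
have : t ^+ m * eval_inv p = tofrac (\sum_(i < m.+1) p`_i *: 'X^(m - i)).
  rewrite rmorph_sum /eval_inv /= /horner_eval.
  rewrite (@horner_coef_wide _ m.+1) ?mulr_sumr; last by rewrite -sp size_poly.
  apply: eq_bigr => i _; rewrite coef_map /= exprVn mulrCA -mul_polyC tofracM; congr (_ * _).
  rewrite tofracXn -/t -[X in t ^+ X](@subnK i); last by rewrite -ltnS ltn_ord.
  by rewrite exprD mulfK // expf_neq0 // tvar_neq0.
rewrite p0 mulr0 => /eqP; rewrite eq_sym tofrac_eq0.
move=> /eqP /(congr1 (fun q : {poly C} => q`_0)).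
rewrite coef_sum coef0 big_ord_recr /= big1 => [|i _].
  rewrite add0r coefZ subnn coefXn mulr1 => /eqP; rewrite -/(lead_coef p).
  by rewrite lead_coef_eq0 (negPf pn0).
by rewrite coefZ coefXn eq_sym subn_eq0 leqNgt ltn_ord mulr0.
Qed.

(** Defined on a chosen representative fraction; [theta_frac] gives the independence of this choice.
    It serves to compare the boundary maps, where t^alpha is inverted, with the coboundary maps. *)
Definition theta (x : K) : K := eval_inv (frac (repr x)).1 / eval_inv (frac (repr x)).2.

Lemma theta_frac a b : b != 0 -> theta (tofrac a / tofrac b) = eval_inv a / eval_inv b.
Proof.
move=> b0; rewrite /theta; set x := tofrac a / tofrac b.
have d0 : (frac (repr x)).2 != 0 by exact: denom_ratioP.
apply/eqP; rewrite eqr_div ?eval_inv_eq0 // -!rmorphM /=; apply/eqP; congr (eval_inv _).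
apply/eqP; rewrite -tofrac_eq !tofracM -eqr_div ?tofrac_eq0 //; apply/eqP.
by rewrite -fracE.
Qed.

Lemma theta_tofrac a : theta (tofrac a) = eval_inv a.
Proof. by rewrite -[tofrac a]divr1 -(tofrac1 _) theta_frac ?oner_eq0 // rmorph1 divr1. Qed.

Lemma theta_zmod_morphism : zmod_morphism theta.
Proof.
move=> x y; rewrite (fracE x) (fracE y); move: (repr x) (repr y) => [[a b] /= b0] [[c d] /= d0].
rewrite -mulNr -tofracN addf_div ?tofrac_eq0 // -!tofracM -tofracD.
rewrite !theta_frac ?mulf_neq0 // -mulNr addf_div ?eval_inv_eq0 //.
by rewrite !rmorphD !rmorphM !rmorphN.
Qed.

Lemma theta_monoid_morphism : monoid_morphism theta.
Proof.
split; first by rewrite -(tofrac1 _) theta_tofrac rmorph1.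
move=> x y; rewrite (fracE x) (fracE y); move: (repr x) (repr y) => [[a b] /= b0] [[c d] /= d0].
by rewrite mulf_div -!tofracM !theta_frac ?mulf_neq0 // !rmorphM mulf_div.
Qed.

HB.instance Definition _ := GRing.isZmodMorphism.Build K K theta theta_zmod_morphism.
HB.instance Definition _ := GRing.isMonoidMorphism.Build K K theta theta_monoid_morphism.

Lemma theta_ratconst a : theta (ratconst a) = ratconst a.
Proof. by rewrite [LHS](theta_tofrac a%:P) /eval_inv /= map_polyC /= /horner_eval hornerC. Qed.

Lemma theta_tvar (k : int) : theta (t ^ k) = t ^ (- k).
Proof.
have -> : theta (t ^ k) = theta t ^ k by exact: fmorphXz.
have -> : theta t = t^-1.
  by rewrite [LHS](theta_tofrac (polyX C)) /eval_inv /= map_polyX /horner_eval hornerX.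
by rewrite exprz_inv.
Qed.

End Reciprocal.

(** * The twisted adjoint action along paths *)

Section Twist.
Variables (w : seq letter) (C : numFieldType) (c : nat -> C).
Local Notation N := (size w).
Local Notation K := (ratfun C).
Local Notation t := (tvar C).

(** The condition under which [rho] has determinant 1 along the path. Only long edges are tested,
    since [sigma] never vanishes on a short-edge. *)
Definition good (p : path_) : bool :=
  all (fun x : ocell => if x.2 is Long e then c e != 0 else true) p.

Lemma good_cat p q : good (p ++ q) = good p && good q.
Proof. exact: all_cat. Qed.

Lemma good_rev p : good (rev_path p) = good p.
Proof. by rewrite /good /rev_path all_map all_rev; apply: eq_all => x. Qed.

Lemma det_mx22 (x y z u : C) : \det (mx22 x y z u) = x * u - y * z.
Proof. by rewrite det2E !mxE. Qed.

Lemma sigma_neq0 x : sigma C x != 0.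
Proof.
by rewrite /sigma; case: x.2 => [e b|e|i [] [|[|y]]|i T|i k|i]; rewrite ?oppr_eq0 oner_eq0.
Qed.

Lemma det_rho_pos x : good [:: (false, x)] -> \det (rho_pos w c x) = 1.
Proof.
case: x => [e b|e|i T y|i T|i k|i] /=; rewrite ?det1 // ?andbT => H.
  by rewrite det_mx22 mul0r sub0r mulNr opprK mulVf.
by rewrite det_mx22 mulr0 subr0 divff // sigma_neq0.
Qed.

Lemma det_rho_edge x : good [:: x] -> \det (rho_edge w c x) = 1.
Proof.
case: x => [[] x] H; rewrite /rho_edge /= ?det_inv det_rho_pos ?invr1 //.
Qed.

Lemma rho_cat p q : rho w c (p ++ q) = rho w c p *m rho w c q.
Proof. by rewrite /rho big_cat. Qed.

Lemma rho1 x : rho w c [:: x] = rho_edge w c x.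
Proof. by rewrite /rho big_seq1. Qed.

Lemma rho0 : rho w c [::] = 1%:M.
Proof. by rewrite /rho big_nil. Qed.

Lemma rho_cons x p : rho w c (x :: p) = rho_edge w c x *m rho w c p.
Proof. by rewrite -cat1s rho_cat rho1. Qed.

Lemma det_rho p : good p -> \det (rho w c p) = 1.
Proof.
elim: p => [|x p IH]; first by rewrite rho0 det1.
rewrite -cat1s good_cat => /andP[gx gp].
by rewrite rho_cat det_mulmx rho1 det_rho_edge // IH // mul1r.
Qed.

Lemma rev_path_cat p q : rev_path (p ++ q) = rev_path q ++ rev_path p.
Proof. by rewrite /rev_path rev_cat map_cat. Qed.

Lemma rev_pathK : involutive rev_path.
Proof.
move=> p; rewrite /rev_path -map_rev revK -map_comp -[RHS]map_id.
by apply: eq_map => -[b x] /=; rewrite negbK.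
Qed.

Lemma rho_rev p : good p -> rho w c (rev_path p) = \adj (rho w c p).
Proof.
move=> gp; rewrite -invmx_adj ?det_rho //.
elim: p gp => [|x p IH]; first by rewrite rho0 invmx1.
rewrite -cat1s good_cat => /andP[gx gp]; rewrite rev_path_cat !rho_cat IH //.
rewrite rho1 (_ : rev_path _ = [:: (~~ x.1, x.2)]) // rho1.
have -> : rho_edge w c (~~ x.1, x.2) = invmx (rho_edge w c x).
  by rewrite /rho_edge; case: x {gx} => [[] x] //=; rewrite invmxK.
have ux : rho_edge w c x \in unitmx by rewrite unitmxE det_rho_edge // unitr1.
have up : rho w c p \in unitmx by rewrite unitmxE det_rho // unitr1.
have u : rho_edge w c x *m rho w c p \in unitmx by rewrite unitmx_mul ux up.
by rewrite -[LHS](mulmxK u) [X in X *m _]mulmxA mulmxKV // mulVmx // mul1mx.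
Qed.

Lemma alpha_cat p q : alpha w (p ++ q) = alpha w p + alpha w q.
Proof. by rewrite /alpha big_cat. Qed.

Lemma alpha_rev p : alpha w (rev_path p) = - alpha w p.
Proof.
rewrite /alpha /rev_path big_map (perm_big p) ?perm_rev //= -sumrN.
apply: eq_bigr => -[b x] _ /=; case: x => [e b'|e|i T y|i T|i k|i] //=.
by case: b => /=; rewrite ?expr0 ?expr1 ?mulN1r ?mul1r ?opprK.
Qed.

Lemma twistE p : good p ->
  twist w c p = t ^ alpha w p *: map_mx (@ratconst C) (ad2 (rho w c p)).
Proof. by move=> gp; rewrite /twist AdE // det_rho. Qed.

Lemma twist_cat p q : good p -> good q ->
  twist w c (p ++ q) = twist w c p *m twist w c q.
Proof.
move=> gp gq; rewrite !twistE ?good_cat ?gp // alpha_cat rho_cat ad2M map_mxM.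
by rewrite -scalemxAl -scalemxAr scalerA -expfzDr ?tvar_neq0.
Qed.

Lemma twist_rev p : good p -> twist w c (rev_path p) *m twist w c p = 1%:M.
Proof.
move=> gp; rewrite !twistE ?good_rev // rho_rev // alpha_rev.
rewrite -scalemxAl -scalemxAr scalerA -expfzDr ?tvar_neq0 // addNr expr0z scale1r.
by rewrite -map_mxM -ad2M mul_adj_mx det_rho // ad2_1 map_mx1.
Qed.

Lemma twist_unit p : good p -> twist w c p \in unitmx.
Proof. by move=> /twist_rev /mulmx1_unit[]. Qed.

Lemma twist_revV p : good p -> twist w c (rev_path p) = invmx (twist w c p).
Proof.
move=> gp; have := twist_rev gp => /(congr1 (mulmx^~ (invmx (twist w c p)))).
by rewrite mulmxK ?twist_unit // mul1mx.
Qed.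

Lemma det_twist p : good p -> \det (twist w c p) = t ^ (alpha w p * 3).
Proof.
move=> gp; rewrite twistE // detZ det_map_mx det_ad2 det_rho // expr1n rmorph1 mulr1.
by rewrite -exprz_exp.
Qed.

(** The trace form turns the transpose of the adjoint action into its inverse, and [theta] inverts
    the power of t, so transposition amounts to reversing the path. *)
Lemma theta_twist p : good p ->
  (map_mx (@theta C) (twist w c p))^T *m killing K = killing K *m twist w c (rev_path p).
Proof.
move=> gp; rewrite !twistE ?good_rev // rho_rev // alpha_rev map_mxZ /= theta_tvar.
rewrite linearZ /= -scalemxAl -scalemxAr; congr (_ *: _).
have -> : map_mx (@theta C) (map_mx (@ratconst C) (ad2 (rho w c p)))
        = map_mx (@ratconst C) (ad2 (rho w c p)).
  by apply/matrixP => i j; rewrite !mxE theta_ratconst.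
have -> : killing K = map_mx (@ratconst C) (killing C).
  apply/matrixP => i j; rewrite !mxE.
  by case: (ord3P i) => ->; case: (ord3P j) => -> /=; rewrite ?rmorph0 ?rmorph1 ?rmorph_nat.
have -> (M : 'M[C]_3) : (map_mx (@ratconst C) M)^T = map_mx (@ratconst C) M^T.
  by apply/matrixP => i j; rewrite !mxE.
by rewrite -!map_mxM ad2_killing.
Qed.

Lemma killing_unit : killing K \in unitmx.
Proof.
rewrite unitmxE det3E !mxE /= unitfE.
have -> : (0 : K) * (2 * 0 - 0 * 0) - 0 * (0 * 0 - 0 * 1) + 1 * (0 * 0 - 2 * 1) = - 2.
  by ring.
by rewrite oppr_eq0 -(rmorph_nat (@ratconst C)) fmorph_eq0 pnatr_eq0.
Qed.

End Twist.

(** * Cells and lifts *)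

Section Cells.
Variable w : seq letter.
Local Notation N := (size w).

(** Structured index types for the cells, from which the blocks of the boundary maps can be
    described; levels and edges are shifted to start at 0. *)
Definition cell_ix (k : nat) : finType :=
  match k with
  | 0 => ('I_N * bool)%type
  | 1 => ('I_N + 'I_N * bool * 'I_3)%type
  | 2 => ('I_N * bool + 'I_N * 'I_4)%type
  | 3 => 'I_N
  | _ => void
  end.

Definition cell_of (k : nat) : cell_ix k -> cell :=
  match k with
  | 0 => fun x => Vert x.1.+1 x.2
  | 1 => fun x => match x with inl i => Long i.+1 | inr (i, T, y) => Short i.+1 T y end
  | 2 => fun x => match x with inl (i, T) => Hex i.+1 T | inr (i, k) => Cap i.+1 k end
  | 3 => fun i => Tet i.+1
  | _ => fun x => match x with end
  end.

Lemma cell_of_in k (x : cell_ix k) : cell_of x \in cells w k.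
Proof.
have I1 (i : 'I_N) : i.+1 \in iota 1 N by rewrite mem_iota /= add1n ltnS ltn_ord.
have B1 (b : bool) : b \in [:: false; true] by case: b.
case: k x => [|[|[|[|k]]]] x; rewrite /cells.
- by apply: (@allpairs_f nat bool) .
- rewrite mem_cat; case: x => [i|[[i T] y]]; first by apply/orP; left; apply: (map_f Long).
  apply/orP; right; apply: (@allpairs_f (nat * bool)%type nat cell (fun x y => Short x.1 x.2 y) _ _ (i.+1, T)).
    exact: (@allpairs_f nat bool).
  by rewrite mem_iota /= add0n.
- rewrite mem_cat; case: x => [[i T]|[i k]]; apply/orP; [left|right].
    exact: (@allpairs_f nat bool).
  by apply: (@allpairs_f nat nat) => //; rewrite mem_iota /= add0n.
- exact: (map_f Tet).
- by case: x.
Qed.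

Lemma cell_of_inj k : injective (@cell_of k).
Proof.
case: k => [|[|[|[|k]]]].
- by move=> [i b] [j b'] /= [/val_inj-> ->].
- move=> [i|[[i T] y]] [j|[[j T'] y']] //= []; first by move=> /val_inj->.
  by move=> /val_inj-> -> /val_inj->.
- move=> [[i T]|[i k]] [[j T']|[j k']] //= [] /val_inj->; first by move->.
  by move=> /val_inj->.
- by move=> i j /= [/val_inj->].
- by case.
Qed.

Lemma card_cell_ix k : #|cell_ix k| = size (cells w k).
Proof.
case: k => [|[|[|[|k]]]]; rewrite /cells /cell_ix.
- by rewrite size_allpairs size_iota card_prod card_ord card_bool.
- rewrite size_cat !size_allpairs size_map !size_iota /=.
  by rewrite card_sum !card_prod !card_ord card_bool.
- rewrite size_cat !size_allpairs !size_iota /=.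
  by rewrite card_sum !card_prod !card_ord card_bool.
- by rewrite size_map size_iota card_ord.
- by rewrite card_void.
Qed.

Lemma index_cell_lt k (x : cell_ix k) : (index (cell_of x) (cells w k) < size (cells w k))%N.
Proof. by rewrite index_mem cell_of_in. Qed.

Definition cell_pos k (x : cell_ix k) : 'I_(size (cells w k)) := Ordinal (index_cell_lt x).

Lemma nth_cell_pos k (x : cell_ix k) : nth_cell (cell_pos x) = cell_of x.
Proof. by rewrite /nth_cell /= nth_index ?cell_of_in. Qed.

Lemma cell_pos_inj k : injective (@cell_pos k).
Proof. by move=> x y /(congr1 (@nth_cell w k)); rewrite !nth_cell_pos => /cell_of_inj. Qed.

Lemma cell_pos_bij k : bijective (@cell_pos k).
Proof. by apply: inj_card_bij (@cell_pos_inj k) _; rewrite card_ord card_cell_ix. Qed.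

Lemma cellsP k s : s \in cells w k -> exists x : cell_ix k, s = cell_of x.
Proof.
rewrite -index_mem => lt_s; have [g _ gK] := cell_pos_bij k; exists (g (Ordinal lt_s)).
by rewrite -nth_cell_pos gK /nth_cell /= nth_index // -index_mem.
Qed.

Definition enc k (x : cell_ix k * 'I_3) : 'I_(tdim w k) :=
  tagnat.Rank (cell_pos x.1) x.2.

Lemma enc_bij k : bijective (@enc k).
Proof.
apply: inj_card_bij.
  move=> [x i] [y j] /(congr1 val) /eqP; rewrite /= tagnat.eq_Rank => /andP[/eqP/cell_pos_inj-> /eqP].
  by move=> /val_inj->.
by rewrite card_prod !card_ord /tdim sum_nat_const card_ord card_cell_ix.
Qed.

Lemma mxblock_enc (K : fieldType) k l (B : 'I_(size (cells w k)) -> 'I_(size (cells w l)) -> 'M[K]_3) x y :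
  (\mxblock_(i, j) B i j : 'M[_]_(tdim w k, tdim w l)) (enc x) (enc y) =
  B (cell_pos x.1) (cell_pos y.1) x.2 y.2.
Proof.
have := mxblockK (p_ := fun=> 3%N) (q_ := fun=> 3%N) B (cell_pos x.1) (cell_pos y.1).
by move/matrixP/(_ x.2 y.2); rewrite mxE.
Qed.

Definition edges_of (i : nat) : seq nat :=
  let: (a, b, g) := level_edges w i in [:: a; b; g].

(** The bounds ensure that gluing lands in 1..N. The alternative between edges already created at
    level [i] and bottom edges later makes the Ptolemy block triangular. *)
Lemma level_edges_range i u : (i <= N)%N -> u \in edges_of i ->
  (0 < u <= N.+3)%N /\ ((u <= i) || (N < u))%N.
Proof.
rewrite /edges_of; elim: i u => [|i IH] u iN /=.
  by rewrite !inE => /or3P[] /eqP->; split; lia.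
have {}IH := IH _ (ltnW iN); move: IH => /=.
case: (level_edges w i) => [[a b] g] IH.
have Ha := IH a; have Hb := IH b; have Hg := IH g.
rewrite !inE !eqxx ?orbT /= in Ha Hb Hg.
have {Ha}[A1 A2] := Ha isT; have {Hb}[B1 B2] := Hb isT; have {Hg}[G1 G2] := Hg isT.
by case: (phi w i); rewrite !inE => /or3P[] /eqP->; split; lia.
Qed.

(* The top of the stack contains none of the bottom edges *)
Hypothesis top_le : all (fun u => u <= N)%N (edges_of N).

Lemma glue_range u : (0 < u <= N.+3)%N -> (0 < glue_edge w u <= N)%N.
Proof.
move=> Hu; have := @level_edges_range N _ (leqnn _); rewrite /glue_edge; move: top_le.
rewrite /edges_of; case: (level_edges w N) => [[a b] g] /= /and4P[a1 b1 g1 _] H.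
have Ha := H a; have Hb := H b; have Hg := H g.
rewrite !inE !eqxx ?orbT /= in Ha Hb Hg.
have {Ha}[A1 A2] := Ha isT; have {Hb}[B1 B2] := Hb isT; have {Hg}[G1 G2] := Hg isT.
by do 3?[case: eqP => ?]; lia.
Qed.

Lemma tri_edge_in i T x y : tri_edge w i T x y \in edges_of i.
Proof.
rewrite /tri_edge /edges_of; case: (level_edges w i) => [[a b] g].
by case: (minn x y) (maxn x y) => [|[|m]] [|[|[|n]]]; case: T; rewrite !inE ?eqxx ?orbT.
Qed.

Lemma tet_edge_in i x y : tet_edge w i x y \in i :: edges_of i.-1.
Proof.
rewrite /tet_edge /edges_of; case: (level_edges w i.-1) => [[a b] g].
by case: (minn x y) (maxn x y) => [|[|[|m]]] [|[|[|[|n]]]]; case: (phi w i.-1);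
  rewrite !inE ?eqxx ?orbT.
Qed.

Section Good.
Variables (C : numFieldType) (c : nat -> C).
Hypothesis c_neq0 : forall e, (1 <= e <= N)%N -> c e != 0.

Lemma glue_neq0 u : (0 < u <= N.+3)%N -> c (glue_edge w u) != 0.
Proof. by move=> /glue_range /c_neq0. Qed.

Lemma edges_neq0 i u : (i <= N)%N -> u \in edges_of i -> c (glue_edge w u) != 0.
Proof. by move=> iN /level_edges_range[//|/glue_neq0]. Qed.

Lemma good_tet_long i x y : (0 < i <= N)%N -> good c [:: tet_long w i x y].
Proof.
move=> /andP[i0 iN]; rewrite /good /= andbT; have := tet_edge_in i x y.
rewrite inE => /orP[/eqP->|/edges_neq0]; first by rewrite glue_neq0 //; lia.
by apply; lia.
Qed.

Lemma good_tet_short i x y z : good c [:: tet_short w i x y z].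
Proof. by rewrite /tet_short; case: (tet_face w i _). Qed.

Lemma good_tet_path i j k : (0 < i <= N)%N -> good c (tet_path w i j k).
Proof.
move=> iN; rewrite /tet_path.
have T x y z : good c (if x == z then [::] else [:: tet_short w i x y z]).
  by case: eqP => // _; exact: good_tet_short.
by case: eqP => _; rewrite ?T // good_cat T -cat1s good_cat T good_tet_long.
Qed.

Lemma good_loop_faces q p x : good c q -> good c p -> x \in loop_faces q p -> good c x.1.2.
Proof.
elim: p q => [|y p IH] q gq //; rewrite -cat1s good_cat => /andP[gy gp] /=.
have gqy : good c (rcons q y) by rewrite -cats1 good_cat gq.
by rewrite inE => /orP[/eqP->|/IH]; [case: ifP|apply].
Qed.

Lemma good_cell1 e : e \in cells w 1 -> good c [:: (false, e)].
Proof.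
move=> /cellsP[[i ->|[[i T] y] ->]]; rewrite /good //= andbT c_neq0 //.
by case: i.
Qed.

Lemma good_faces k s x : s \in cells w k -> x \in faces w s -> good c x.1.2.
Proof.
move=> /[dup] sc /cellsP[y Es]; case: k => [|[|[|[|k]]]] in sc y Es *; last by case: y Es.
- by rewrite Es.
- have gs := good_cell1 sc.
  by move: gs; rewrite Es; case: y {Es} => [i|[[i T] y]] gs; rewrite /= !inE => /orP[] /eqP->.
- rewrite Es; case: y {Es sc} => [[i T]|[i k]]; apply: good_loop_faces => //.
    have iN : (i.+1 <= N)%N by [].
    have L a b : c (glue_edge w (tri_edge w i.+1 T a b)) != 0.
      by apply: edges_neq0 iN _; exact: tri_edge_in.
    by rewrite /good /= !L.
  by rewrite -cat1s good_cat good_tet_short -cat1s good_cat !good_tet_short.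
- rewrite Es /faces mem_cat.
  by case/orP => /mapP[m _ ->] /=; apply: good_tet_path; exact: ltn_ord.
Qed.

Lemma good_is_path x p y : is_path w x p y -> good c p.
Proof.
elim: p x => [//|e p IH] x /= /and3P[e1 _ /IH gp].
by have := good_cell1 e1; rewrite /good /= andbT => ->.
Qed.

End Good.
End Cells.

Lemma eq_big_seq_cond (V : nmodType) (I : eqType) (r : seq I) (P : pred I) (F G : I -> V) :
  (forall i, i \in r -> P i -> F i = G i) ->
  \sum_(i <- r | P i) F i = \sum_(i <- r | P i) G i.
Proof.
by move=> FG; rewrite big_seq_cond [RHS]big_seq_cond; apply: eq_bigr => i /andP[/FG]; apply.
Qed.

Lemma det_mxdiag (R : comNzRingType) n p (B : 'I_n -> 'M[R]_p) :
  \det (mxdiag (p_ := fun=> p) B) = \prod_i \det (B i).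
Proof.
pose h (x : 'I_n * 'I_p) : 'I_(\sum_(i < n) p) := tagnat.Rank x.1 x.2.
have hb : bijective h.
  apply: inj_card_bij.
    move=> [x i] [y j] /(congr1 val) /eqP; rewrite /= tagnat.eq_Rank.
    by move=> /andP[/eqP-> /eqP /val_inj->].
  by rewrite card_prod !card_ord sum_nat_const card_ord.
have E a i b j : mxdiag (p_ := fun=> p) B (h (a, i)) (h (b, j)) = (a == b)%:R * B a i j.
  have := mxblockK (p_ := fun=> p) (q_ := fun=> p)
    (fun a b => if a == b then conform_mx 0 (B a) else 0) a b.
  move/matrixP/(_ i j); rewrite mxE => ->.
  by case: eqP => [->|_]; rewrite ?conform_mx_id ?mul1r // mxE mul0r.
move: (mxdiag _) E => M E; rewrite (_ : M = \matrix_(i, j) M i j); last first.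
  by apply/matrixP => i j; rewrite mxE.
rewrite -fdet_ord (fdet_bij _ hb); transitivity (\prod_i fdet (fun k l => B i k l)).
  by rewrite -fdet_fibers; apply: eq_fdet => -[a i] [b j] /=; rewrite E.
by apply: eq_bigr => a _; rewrite fdet_ord; congr (\det _); apply/matrixP => i j; rewrite mxE.
Qed.

(** * Duality, and removal of the lifts by a change of basis *)

Section Gauge.
Variables (w : seq letter) (C : numFieldType) (c : nat -> C) (lift : cell -> path_).
Local Notation N := (size w).
Local Notation K := (ratfun C).
Local Notation t := (tvar C).
Hypothesis top_le : all (fun u => u <= N)%N (edges_of w N).
Hypothesis c_neq0 : forall e, (1 <= e <= N)%N -> c e != 0.
Hypothesis lift_ok : is_lifting w lift.

Lemma good_lift k s : s \in cells w k -> good c (lift s).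
Proof. by move=> /lift_ok; apply: good_is_path. Qed.

Lemma in_nth_cell k (a : 'I_(size (cells w k))) : nth_cell a \in cells w k.
Proof. exact: mem_nth. Qed.

Lemma twist_face_loop k l s f q : s \in cells w k -> f \in cells w l -> good c q ->
  twist w c (rev_path (face_loop lift s q f)) =
  twist w c (lift f) *m twist w c (rev_path q) *m invmx (twist w c (lift s)).
Proof.
move=> /good_lift gs /good_lift gf gq; rewrite /face_loop !rev_path_cat rev_pathK.
by rewrite !twist_cat ?good_cat ?good_rev ?gs ?gq ?gf // (twist_revV _ gs).
Qed.

(** By invariance of the trace form, the boundary is the transpose of the coboundary up to
    [theta]. *)
Lemma killing_boundary_block k l s f : s \in cells w k -> f \in cells w l ->
  killing K *m boundary_block w c lift f s =
  (map_mx (@theta C) (coboundary_block w c lift s f))^T *m killing K.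
Proof.
move=> sk fl; rewrite /boundary_block /coboundary_block mulmx_sumr.
rewrite raddf_sum linear_sum /= mulmx_suml.
apply: eq_big_seq_cond => x xs _; have trZ a (M : 'M[K]_3) : (a *: M)^T = a *: M^T by apply/matrixP => i j; rewrite !mxE.
rewrite -scalemxAr map_mxZ trZ -scalemxAl.
rewrite theta_twist ?rmorphXn ?rmorphN1 //.
by rewrite /face_loop !good_cat good_rev (good_lift sk) (good_lift fl) (good_faces top_le c_neq0 sk xs).
Qed.

(** Triviality of the cohomology contains that consecutive coboundaries compose to zero; duality
    transports this to the boundary maps. *)
Lemma boundary_sqr0 : cohomology_trivial (coboundary w c lift) ->
  forall k, boundary w c lift k *m boundary w c lift k.+1 = 0.
Proof.
move=> [_ triv] k.
have cob0 : coboundary w c lift k.+1 *m coboundary w c lift k = 0.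
  apply/matrixP => i j; have := memv_img (mxlin (coboundary w c lift k)) (memvf (delta_mx j 0)).
  rewrite -triv memv_ker !mxlinE mulmxA -colE => /eqP /matrixP /(_ i 0).
  by rewrite !mxE.
rewrite /boundary mul_mxblock -[RHS]mxblock0; apply/eq_mxblockP => a b.
apply: (can_inj (mulKmx (killing_unit C))); rewrite mulmx0 mulmx_sumr.
under eq_bigr => d _ do
  rewrite mulmxA (killing_boundary_block (in_nth_cell d) (in_nth_cell a)) -mulmxA
    (killing_boundary_block (in_nth_cell b) (in_nth_cell d)) mulmxA -trmx_mul -map_mxM.
rewrite -mulmx_suml -raddf_sum /= -(raddf_sum (@map_mx _ _ (@theta C) 3 3)) /=.
have := cob0; rewrite /coboundary mul_mxblock -[RHS]mxblock0 => /eq_mxblockP /(_ b a) ->.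
by rewrite map_mx0 trmx0 mul0mx.
Qed.

Variable g : cell -> int.

(** Transport along the lift, with a shift by the sheet [g], to a basis in which the boundary
    involves only paths inside the cells. *)
Definition gauge_block (s : cell) : 'M[K]_3 := t ^ (- g s) *: twist w c (lift s).

Definition gauge k : 'M[K]_(tdim w k) :=
  \mxdiag_(a < size (cells w k)) gauge_block (nth_cell a).

Definition based_block (f s : cell) : 'M[K]_3 :=
  \sum_(x <- faces w s | x.2 == f)
    ((-1) ^+ x.1.1 * t ^ (g f - g s)) *: twist w c (rev_path x.1.2).

Definition based_boundary k : 'M[K]_(tdim w k, tdim w k.+1) :=
  \mxblock_(a < size (cells w k), b < size (cells w k.+1))
    based_block (nth_cell a) (nth_cell b).

(** The adjoint action has determinant 1, so the lifts contribute to the torsion only through a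
    power of t. *)
Lemma det_gauge k : exists m : int, \det (gauge k) = t ^ m.
Proof.
rewrite /gauge (det_mxdiag (fun a => gauge_block (nth_cell a))).
elim/big_rec: _ => [|a x _ [m ->]]; first by exists 0; rewrite expr0z.
rewrite /gauge_block detZ det_twist ?(good_lift (in_nth_cell a)) //.
by rewrite exprnP exprz_exp -!expfzDr ?tvar_neq0 //; eexists.
Qed.

Lemma gauge_unit k : gauge k \in unitmx.
Proof. by have [m E] := det_gauge k; rewrite unitmxE E unitfE expfz_neq0 ?tvar_neq0. Qed.

(** The transport along a face loop factors through the lifts of the cell and of the face; these two
    factors are absorbed by the changes of basis. *)
Lemma boundary_gauge k :
  boundary w c lift k = gauge k *m based_boundary k *m invmx (gauge k.+1).
Proof.
apply: (can_inj (mulmxK (gauge_unit k.+1))); rewrite mulmxKV ?gauge_unit //.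
rewrite /boundary /gauge /based_boundary mul_mxblock_mxdiag mul_mxdiag_mxblock.
apply/eq_mxblockP => a b; have af := in_nth_cell a; have bs := in_nth_cell b.
move: (nth_cell a) (nth_cell b) af bs => f s fk sk.
rewrite /boundary_block mulmx_suml.
rewrite /based_block [RHS]mulmx_sumr.
apply: eq_big_seq_cond => x xs _.
rewrite (twist_face_loop sk fk (good_faces top_le c_neq0 sk xs)) /gauge_block.
have := twist_unit w (good_lift sk).
move: (twist w c (lift f)) (twist w c (rev_path x.1.2)) (twist w c (lift s)) => X Y Z uZ.
rewrite -!scalemxAl -!scalemxAr !scalerA mulmxKV //.
congr (_ *: _).
rewrite mulrCA -expfzDr ?tvar_neq0 //.
by rewrite addrA addNr add0r.
Qed.

End Gauge.

(** * The entries of the boundary matrices *)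

Section Entries.
Variables (w : seq letter) (C : numFieldType) (c : nat -> C).
Local Notation N := (size w).
Local Notation K := (ratfun C).
Local Notation t := (tvar C).
Hypothesis top_le : all (fun u => u <= N)%N (edges_of w N).
Hypothesis c_neq0 : forall e, (1 <= e <= N)%N -> c e != 0.

Lemma tri_edgeC i T x y : tri_edge w i T x y = tri_edge w i T y x.
Proof. by rewrite /tri_edge minnC maxnC. Qed.

Lemma tet_edgeC i x y : tet_edge w i x y = tet_edge w i y x.
Proof. by rewrite /tet_edge minnC maxnC. Qed.

(* The sheet of the base vertex of a cell, in the stack over which [sheet] is
   defined. *)
Definition base_sheet (s : cell) : int :=
  match s with
  | Short i T y => sheet w (tri_edge w i T y (bump y 0))
  | Hex i T => sheet w (tri_edge w i T 0 1)
  | Cap i k => sheet w (tet_edge w i k (bump k 0))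
  | Tet i => sheet w (tet_edge w i 0 1)
  | _ => 0
  end.

(** The boundary transports along the reversed path, whence the adjugate and the minus sign in front
    of [alpha]. *)
Definition face_coef (s : cell) (x : face) (i j : 'I_3) : K :=
  (-1) ^+ x.1.1 * t ^ (base_sheet x.2 - base_sheet s - alpha w x.1.2)
  * ratconst (ad2 (\adj (rho w c x.1.2)) i j).

Lemma based_blockE k f s i j : s \in cells w k ->
  based_block w c base_sheet f s i j =
  \sum_(x <- faces w s) (x.2 == f)%:R * face_coef s x i j.
Proof.
move=> sk; rewrite /based_block summxE big_mkcond /=.
apply: eq_big_seq => x xs; case: eqP => [<-|_]; last by rewrite mul0r.
have gx := good_faces top_le c_neq0 sk xs.
rewrite mul1r twistE ?good_rev // rho_rev // alpha_rev /face_coef mxE mxE mxE.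
by rewrite [t ^ (_ - alpha _ _)]expfzDr ?tvar_neq0 // !mulrA.
Qed.

Definition edge_val (u : nat) : C := c (glue_edge w u).
Definition tri_val i T x y : C := edge_val (tri_edge w i T x y).
(** A sign encoding the cocycle: [sigma] takes the value [- eps T] at the vertex 1 of the triangle
    [T], and 1 at its other vertices. *)
Definition eps (T : bool) : C := (-1) ^+ T.

Lemma eps_sqr T : eps T * eps T = 1.
Proof. by rewrite -expr2 sqrr_sign. Qed.

Lemma tri_val_neq0 i T x y : (i <= N)%N -> tri_val i T x y != 0.
Proof. by move=> iN; apply: (edges_neq0 top_le c_neq0 iN); exact: tri_edge_in. Qed.

Lemma mx22M p q r s p' q' r' s' :
  mx22 p q r s *m mx22 p' q' r' s' =
  mx22 (p * p' + q * r') (p * q' + q * s') (r * p' + s * r') (r * q' + s * s') :> 'M[C]_2.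
Proof. by apply: matrix2P; rewrite !(mxE, big_ord2) /=. Qed.

Lemma adj_mx22 p q r s : \adj (mx22 p q r s) = mx22 s (- q) (- r) p :> 'M[C]_2.
Proof. by have [a b d e] := adj2E (mx22 p q r s); apply: matrix2P; rewrite ?a ?b ?d ?e !mxE. Qed.

Lemma invmx_mx22 p q r s : p * s - q * r = 1 ->
  invmx (mx22 p q r s) = mx22 s (- q) (- r) p :> 'M[C]_2.
Proof. by move=> d; rewrite invmx_adj ?adj_mx22 // det_mx22. Qed.

Lemma eq_mx22 (p q r s p' q' r' s' : C) :
  p = p' -> q = q' -> r = r' -> s = s' -> mx22 p q r s = mx22 p' q' r' s'.
Proof. by move=> -> -> -> ->. Qed.

Section Level.
Variables (i : nat) (T : bool).
Hypothesis iN : (i <= N)%N.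
Local Notation A := (tri_val i T 0 1).
Local Notation B := (tri_val i T 1 2).
Local Notation G := (tri_val i T 0 2).
Let A0 : A != 0. Proof. exact: tri_val_neq0. Qed.
Let B0 : B != 0. Proof. exact: tri_val_neq0. Qed.
Let G0 : G != 0. Proof. exact: tri_val_neq0. Qed.

Lemma rho_short0 : rho_pos w c (Short i T 0) = mx22 1 (eps T * B / (A * G)) 0 1.
Proof.
rewrite /rho_pos /short_ends /= /oval /sigma /=.
rewrite -!/(edge_val _) -!/(tri_val _ _ _ _) /tri_val (tri_edgeC i T 2) (tri_edgeC i T 1 0).
rewrite -!/(tri_val _ _ _ _) /eps; case: T A0 B0 G0 => H1 H2 H3 /=; apply: eq_mx22 => //;
  by field; rewrite ?H1 ?H2 ?H3.
Qed.

Lemma rho_short1 : rho_pos w c (Short i T 1) = mx22 (- eps T) (G / (A * B)) 0 (- eps T).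
Proof.
rewrite /rho_pos /short_ends /= /oval /sigma /=.
rewrite -!/(edge_val _) -!/(tri_val _ _ _ _) /tri_val (tri_edgeC i T 2 0).
rewrite -!/(tri_val _ _ _ _) /eps; case: T A0 B0 G0 => H1 H2 H3 /=; apply: eq_mx22 => //;
  by field; rewrite ?H1 ?H2 ?H3.
Qed.

Lemma rho_short2 : rho_pos w c (Short i T 2) = mx22 1 (eps T * A / (B * G)) 0 1.
Proof.
rewrite /rho_pos /short_ends /= /oval /sigma /=.
rewrite -!/(edge_val _) -!/(tri_val _ _ _ _) /tri_val (tri_edgeC i T 2 1) (tri_edgeC i T 1 0).
rewrite -!/(tri_val _ _ _ _) /eps; case: T A0 B0 G0 => H1 H2 H3 /=; apply: eq_mx22 => //;
  by field; rewrite ?H1 ?H2 ?H3.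
Qed.

End Level.

(** This weight is t on a bottom edge and 1 on an edge created inside the stack. *)
Definition sheet_wt (u : nat) : K := t ^ (- sheet w u).

(** * The faces of a hexagon *)

Section Hexagon.
Variables (i : nat) (T : bool).
Hypothesis iN : (i.+1 <= N)%N.
Local Notation A := (tri_val i.+1 T 0 1).
Local Notation B := (tri_val i.+1 T 1 2).
Local Notation G := (tri_val i.+1 T 0 2).
Let A0 : A != 0. Proof. exact: tri_val_neq0. Qed.
Let B0 : B != 0. Proof. exact: tri_val_neq0. Qed.
Let G0 : G != 0. Proof. exact: tri_val_neq0. Qed.

Let l01 := tri_long w i.+1 T 0 1.
Let s012 := tri_short w i.+1 T 0 1 2.
Let l12 := tri_long w i.+1 T 1 2.
Let s120 := tri_short w i.+1 T 1 2 0.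
Let l20 := tri_long w i.+1 T 2 0.
Let s201 := tri_short w i.+1 T 2 0 1.

Let rho_l01 : rho_edge w c l01 = mx22 0 (- A^-1) A 0.
Proof. by []. Qed.

Let rho_l12 : rho_edge w c l12 = mx22 0 (- B^-1) B 0.
Proof. by []. Qed.

Let rho_l20 : rho_edge w c l20 = mx22 0 (G^-1) (- G) 0.
Proof.
rewrite /rho_edge /= (tri_edgeC _ _ 2 0) -/(edge_val _) -/(tri_val _ _ _ _).
by rewrite invmx_mx22 ?opprK // mul0r sub0r mulNr opprK mulVf.
Qed.

Let rho_s012 : rho_edge w c s012 = mx22 (- eps T) (G / (A * B)) 0 (- eps T).
Proof. exact: rho_short1. Qed.

Let rho_s120 : rho_edge w c s120 = mx22 1 (- (eps T * A / (B * G))) 0 1.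
Proof.
by rewrite -[LHS]/(invmx (rho_pos w c (Short i.+1 T 2))) rho_short2 // invmx_mx22 ?mulr1 ?mulr0 ?subr0 ?oppr0.
Qed.

Let rho_s201 : rho_edge w c s201 = mx22 1 (- (eps T * B / (A * G))) 0 1.
Proof.
by rewrite -[LHS]/(invmx (rho_pos w c (Short i.+1 T 0))) rho_short0 // invmx_mx22 ?mulr1 ?mulr0 ?subr0 ?oppr0.
Qed.

(** Next come the products along the initial segments of the boundary of the hexagon, which
    transport the base vertex to the successive faces. That [rhoE6] is the identity is the cocycle
    condition. *)
Let rhoE1 : rho w c [:: l01] = mx22 0 (- A^-1) A 0.
Proof. by rewrite rho1 rho_l01. Qed.

Let rhoE2 : rho w c [:: l01; s012] = mx22 0 (eps T / A) (- (eps T * A)) (G / B).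
Proof.
rewrite rho_cons rho1 rho_l01 rho_s012 mx22M.
by apply: eq_mx22; field; rewrite ?A0 ?B0.
Qed.

Let rhoE3 : rho w c [:: l01; s012; l12] = mx22 (eps T * B / A) 0 G (eps T * A / B).
Proof.
rewrite -[_ :: _]/([:: l01; s012] ++ [:: l12]) rho_cat rhoE2 rho1 rho_l12 mx22M.
by apply: eq_mx22; field; rewrite ?A0 ?B0.
Qed.

Let rhoE4 : rho w c [:: l01; s012; l12; s120] = mx22 (eps T * B / A) (- G^-1) G 0.
Proof.
rewrite -[_ :: _]/([:: l01; s012; l12] ++ [:: s120]) rho_cat rhoE3 rho1 rho_s120 mx22M.
have e2 := eps_sqr T.
apply: eq_mx22; [by field; rewrite ?A0 ?B0| |by field|by field; rewrite ?B0 ?G0].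
transitivity (- (eps T * eps T) / G); first by field; rewrite ?A0 ?B0 ?G0.
by rewrite e2 mulN1r.
Qed.

Let rhoE5 : rho w c [:: l01; s012; l12; s120; l20] = mx22 1 (eps T * B / (A * G)) 0 1.
Proof.
rewrite -[_ :: _]/([:: l01; s012; l12; s120] ++ [:: l20]) rho_cat rhoE4 rho1 rho_l20 mx22M.
by apply: eq_mx22; field; rewrite ?A0 ?B0 ?G0.
Qed.

Let rhoE6 : rho w c [:: l01; s012; l12; s120; l20; s201] = mx22 1 0 0 1.
Proof.
rewrite -[_ :: _]/([:: l01; s012; l12; s120; l20] ++ [:: s201]) rho_cat rhoE5 rho1 rho_s201 mx22M.
by apply: eq_mx22; field; rewrite ?A0 ?B0 ?G0.
Qed.

Local Notation e01 := (tri_edge w i.+1 T 0 1).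
Local Notation e12 := (tri_edge w i.+1 T 1 2).
Local Notation e02 := (tri_edge w i.+1 T 0 2).

Let alpha_s012 : alpha_edge w s012 = sheet w e12 - sheet w e01.
Proof. by rewrite /= expr0 mul1r (tri_edgeC _ _ 1 0). Qed.

Let alpha_s120 : alpha_edge w s120 = sheet w e02 - sheet w e12.
Proof. by rewrite /= expr1 mulN1r opprB (tri_edgeC _ _ 2 0) (tri_edgeC _ _ 2 1). Qed.

Let alpha_s201 : alpha_edge w s201 = sheet w e01 - sheet w e02.
Proof. by rewrite /= expr1 mulN1r opprB. Qed.

Let alphaE := (alpha_s012, alpha_s120, alpha_s201).

Definition adj_row (M : 'M[C]_2) (r j : 'I_3) : K := ratconst (ad2 (\adj M) r j).

(** The faces are paired with an arbitrary function [psi]: the indicator function of a cell yields a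
    matrix entry, and faces that coincide after gluing are added without case distinction. *)
Lemma hexE (psi : cell -> K) (r j : 'I_3) :
  \sum_(x <- faces w (Hex i.+1 T)) psi x.2 * face_coef (Hex i.+1 T) x r j =
  psi (Long (glue_edge w e01)) * (sheet_wt e01 * adj_row (mx22 1 0 0 1) r j)
  + psi (Short i.+1 T 1) * adj_row (mx22 0 (- A^-1) A 0) r j
  + psi (Long (glue_edge w e12)) *
      (sheet_wt e12 * adj_row (mx22 0 (eps T / A) (- (eps T * A)) (G / B)) r j)
  - psi (Short i.+1 T 2) * adj_row (mx22 (eps T * B / A) (- G^-1) G 0) r j
  - psi (Long (glue_edge w e02)) *
      (sheet_wt e02 * adj_row (mx22 1 (eps T * B / (A * G)) 0 1) r j)
  - psi (Short i.+1 T 0) * adj_row (mx22 1 0 0 1) r j.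
Proof.
have a1 : alpha w [:: l01] = 0 by rewrite /alpha big_seq1.
have a2 : alpha w [:: l01; s012] = sheet w e12 - sheet w e01.
  by rewrite /alpha !big_cons big_nil alphaE /= add0r addr0.
have a4 : alpha w [:: l01; s012; l12; s120] = sheet w e02 - sheet w e01.
  by rewrite /alpha !big_cons big_nil !alphaE /=; lia.
have a5 : alpha w [:: l01; s012; l12; s120; l20] = sheet w e02 - sheet w e01.
  by rewrite /alpha !big_cons big_nil !alphaE /=; lia.
have a6 : alpha w [:: l01; s012; l12; s120; l20; s201] = 0.
  by rewrite /alpha !big_cons big_nil !alphaE /=; lia.
have a0 : alpha w [::] = 0 by rewrite /alpha big_nil.
rewrite /faces -!/(l01) -/s012 -/l12 -/s120 -/l20 -/s201.
rewrite [loop_faces _ _]/= !big_cons big_nil addr0 /face_coef.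
cbn [fst snd rcons nat_of_bool].
rewrite rho0 rhoE1 rhoE2 rhoE4 rhoE5 rhoE6 a0 a1 a2 a4 a5 a6.
rewrite (_ : 1%:M = mx22 1 0 0 1 :> 'M[C]_2); last by apply: matrix2P; rewrite !mxE.
rewrite /base_sheet /= expr0 expr1 /adj_row /sheet_wt.
rewrite (tri_edgeC _ _ 1 0) (tri_edgeC _ _ 2 0).
rewrite [glue_level w i.+1]/=.
have W (x y : int) : x = y -> t ^ x = t ^ y by move->.
rewrite (W (0 - sheet w e01 - 0) (- sheet w e01)); last by lia.
rewrite (W (sheet w e01 - sheet w e01 - 0) 0); last by lia.
rewrite (W (0 - sheet w e01 - (sheet w e12 - sheet w e01)) (- sheet w e12)); last by lia.
rewrite (W (sheet w e02 - sheet w e01 - (sheet w e02 - sheet w e01)) 0); last by lia.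
rewrite (W (0 - sheet w e01 - (sheet w e02 - sheet w e01)) (- sheet w e02)); last by lia.
rewrite expr0z; move: (t ^ _) (t ^ _) (t ^ _) (ratconst _) (ratconst _) (ratconst _).
move: (ratconst _) (ratconst _) (psi _) (psi _) (psi _) (psi _) (psi _) (psi _).
move=> *; ring.
Qed.
End Hexagon.
End Entries.

(** * Long edges, short-edges and caps *)

Section Entries.
Variables (w : seq letter) (C : numFieldType) (c : nat -> C).
Local Notation N := (size w).
Local Notation K := (ratfun C).
Local Notation t := (tvar C).
Hypothesis top_le : all (fun u => u <= N)%N (edges_of w N).
Hypothesis c_neq0 : forall e, (1 <= e <= N)%N -> c e != 0.

Lemma longE (psi : cell -> K) e (r j : 'I_3) :
  \sum_(x <- faces w (Long e)) psi x.2 * face_coef w c (Long e) x r j =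
  psi (Vert e true) * adj_row (mx22 0 (- (c e)^-1) (c e) 0) r j
  - psi (Vert e false) * adj_row (mx22 1 0 0 1) r j.
Proof.
rewrite /faces !big_cons big_nil addr0 /face_coef; cbn [fst snd nat_of_bool].
rewrite rho0 rho1 (_ : 1%:M = mx22 1 0 0 1 :> 'M[C]_2); last by apply: matrix2P; rewrite !mxE.
rewrite /alpha big_nil big_seq1 /= expr0z expr0 expr1 -!/(adj_row _ _ _).
by ring.
Qed.

Definition short_path (p : path_) : bool := all (fun x : ocell => if x.2 is Short _ _ _ then true else false) p.

Definition unitri (M : 'M[C]_2) : Prop := [/\ M 1 0 = 0, M 0 0 * M 0 0 = 1 & M 1 1 = M 0 0].

Lemma unitri_short n T y : unitri (rho_pos w c (Short n T y)).
Proof.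
have [s ss [x ->]] : exists2 s : C, s * s = 1 & exists x, rho_pos w c (Short n T y) = mx22 s x 0 s.
  rewrite /rho_pos; case: (short_ends y) => i k.
  set s := sigma C _; exists s.
    by rewrite /s /sigma; case: (tri_short _ _ _ _ _) => b /= [e b'|e|i' [] [|[|z]]|i' T'|i' k'|i'];
      rewrite ?mulrNN mulr1.
  have e : s^-1 = s; last by rewrite e; eexists.
  by rewrite /s /sigma; case: (tri_short _ _ _ _ _) => b /= [e b'|e|i' [] [|[|z]]|i' T'|i' k'|i'];
      rewrite ?invrN invr1.
by split; rewrite !mxE.
Qed.

Lemma unitriM M M' : unitri M -> unitri M' -> unitri (M *m M').
Proof.
move=> [a b e] [a' b' e']; split; rewrite !mxE !big_ord2 ?a ?a' ?e ?e' ?mul0r ?mulr0 ?addr0 ?add0r //.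
by rewrite mulrACA b b' mulr1.
Qed.

Lemma unitri_path p : short_path p -> unitri (rho w c p).
Proof.
elim: p => [_|[b x] p IH /andP[sx /IH up]]; first by rewrite rho0; split; rewrite !mxE /= ?mulr1.
rewrite rho_cons; apply: unitriM => //; move: sx => /=; case: x => // n T y _.
rewrite /rho_edge /=; case: b; last exact: unitri_short.
have [a b e] := unitri_short n T y.
have d : \det (rho_pos w c (Short n T y)) = 1 by rewrite det2E a e mulr0 subr0.
rewrite invmx_adj //; have [a' b' e' f'] := adj2E (rho_pos w c (Short n T y)).
by split; rewrite ?e' ?a' ?f' ?a ?oppr0 ?e.
Qed.

(** A matrix that is unipotent up to sign acts on E, H, F by an upper unitriangular matrix. On and
    below the diagonal the values of the upper-right entries thus do not matter, which makes the
    blocks of short-edges and caps triangular. *)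
Lemma adj_row_unitri M (r j : 'I_3) : unitri M -> (j <= r)%N -> adj_row M r j = (r == j)%:R.
Proof.
move=> [a b e]; have [a' b' e' f'] := adj2E M.
rewrite /adj_row -(rmorph_nat (@ratconst C)) => jr; congr (ratconst _).
rewrite /ad2 mxE a' b' e' f' a e oppr0.
case: (ord3P r) jr => ->; case: (ord3P j) => -> //= _;
  rewrite ?mulr0 ?mul0r ?oppr0 ?addr0 ?expr0n ?oppr0 //= ?expr2 ?b //.
Qed.

Lemma short_term (psi : cell -> K) s (x : face) (r j : 'I_3) (v : int) :
  short_path x.1.2 -> (j <= r)%N ->
  base_sheet w x.2 - base_sheet w s - alpha w x.1.2 = v ->
  psi x.2 * face_coef w c s x r j = (r == j)%:R * ((-1) ^+ x.1.1 * t ^ v * psi x.2).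
Proof.
move=> sp jr <-; rewrite /face_coef -/(adj_row _ _ _) adj_row_unitri //; last exact: unitri_path.
by rewrite mulrC mulrAC [RHS]mulrC.
Qed.

Lemma shortE (psi : cell -> K) i T y (r j : 'I_3) : (j <= r)%N ->
  \sum_(x <- faces w (Short i.+1 T y)) psi x.2 * face_coef w c (Short i.+1 T y) x r j =
  (r == j)%:R *
   (sheet_wt w C (tri_edge w i.+1 T y (bump y 1)) * psi (tri_vert w i.+1 T y (bump y 1))
   - sheet_wt w C (tri_edge w i.+1 T y (bump y 0)) * psi (tri_vert w i.+1 T y (bump y 0))).
Proof.
move=> jr; rewrite /faces !big_cons big_nil addr0.
rewrite (@short_term _ _ _ _ _ (- sheet w (tri_edge w i.+1 T y (bump y 1)))) //; last first.
  rewrite /alpha big_seq1 /= /short_ends /=; lia.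
rewrite (@short_term _ _ _ _ _ (- sheet w (tri_edge w i.+1 T y (bump y 0)))) //; last first.
  rewrite /alpha big_nil /=; lia.
by rewrite -mulrDr /= expr0 expr1 !mulN1r mul1r mulNr.
Qed.

(** The weight t appears when a cell of the bottom level tau_0 is read as the cell of tau_N glued to
    it. *)
Definition level_wt (i : nat) : K := if i == 0%N then t else 1.

Definition is_L (i : nat) : bool := if phi w i is letterL then true else false.

Lemma sheet_top T x y : sheet w (tri_edge w N T x y) = 0.
Proof.
have := tri_edge_in w N T x y => /(allP top_le); rewrite /sheet leqNgt.
by case: ltnP.
Qed.

Lemma level_wtE i : t ^ ((i == 0%N)%:Z) = level_wt i.
Proof. by case: i => [|i]; rewrite /level_wt /= ?expr1z ?expr0z. Qed.

(** The signed sum over the sides of the cap [k] of Delta_(i+1). For [T = is_L i], the bottom faces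
    opposite to the vertices 3 and 0 are the triangles [T] and [~~ T] of tau_i, and the top faces
    opposite to 2 and 1 those of tau_(i+1). *)
Definition cap_sum (psi : cell -> K) i (k : nat) : K :=
  let T := is_L i in
  match k with
  | 0 => level_wt i * psi (Short (glue_level w i) T 0) + psi (Short i.+1 (~~ T) 0)
         - psi (Short i.+1 T 0)
  | 1 => level_wt i * psi (Short (glue_level w i) T 1)
         + level_wt i * psi (Short (glue_level w i) (~~ T) 0) - psi (Short i.+1 T 1)
  | 2 => level_wt i * psi (Short (glue_level w i) T 2)
         + level_wt i * psi (Short (glue_level w i) (~~ T) 1) - psi (Short i.+1 (~~ T) 1)
  | _ => psi (Short i.+1 T 2) + level_wt i * psi (Short (glue_level w i) (~~ T) 2)
         - psi (Short i.+1 (~~ T) 2)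
  end.

Lemma sheet_glue i T x y :
  sheet w (tri_edge w (glue_level w i) T x y) = sheet w (tri_edge w i T x y) + ((i == 0)%N)%:Z.
Proof.
case: i => [|i]; last by rewrite addr0.
rewrite /glue_level /= sheet_top /tri_edge /=.
by case: (minn x y) (maxn x y) => [|[|m]] [|[|[|n]]]; case: T; rewrite /sheet; case: ltnP => //; lia.
Qed.

Lemma bumpE : (bump 0 0 = 1%N) * (bump 0 1 = 2%N) * (bump 1 0 = 0%N) * (bump 1 1 = 2%N)
  * (bump 2 0 = 0%N) * (bump 2 1 = 1%N) * (bump 3 0 = 0%N).
Proof. by []. Qed.

Lemma alpha_tri_short i T x y z : [&& x < 3, y < 3 & z < 3]%N -> uniq [:: x; y; z] ->
  alpha_edge w (tri_short w i T x y z) =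
  sheet w (tri_edge w i T y z) - sheet w (tri_edge w i T y x).
Proof.
case: x => [|[|[|//]]]; case: y => [|[|[|//]]]; case: z => [|[|[|//]]] //= _ _;
  rewrite ?expr0 ?expr1 ?mul1r ?mulN1r ?opprB !sheet_glue ?bumpE; lia.
Qed.

Lemma big3 (f : face -> K) x y z : \sum_(u <- [:: x; y; z]) f u = f x + f y + f z.
Proof. by rewrite !big_cons big_nil addr0 addrA. Qed.

Lemma cap_faces i k : (k < 4)%N -> let T := is_L i in
  faces w (Cap i.+1 k) = loop_faces [::] (match k with
  | 0 => [:: tri_short w i T 1 0 2; tri_short w i.+1 (~~ T) 1 0 2; tri_short w i.+1 T 2 0 1]
  | 1 => [:: tri_short w i T 0 1 2; tri_short w i (~~ T) 1 0 2; tri_short w i.+1 T 2 1 0]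
  | 2 => [:: tri_short w i T 0 2 1; tri_short w i (~~ T) 0 1 2; tri_short w i.+1 (~~ T) 2 1 0]
  | _ => [:: tri_short w i.+1 T 0 2 1; tri_short w i (~~ T) 0 2 1; tri_short w i.+1 (~~ T) 1 2 0]
  end).
Proof.
by case: k => [|[|[|[|//]]]] _; rewrite /is_L /faces /tet_short /tet_face; case: (phi w i).
Qed.

Lemma capE (psi : cell -> K) i (k : nat) (r j : 'I_3) : (i < N)%N -> (k < 4)%N -> (j <= r)%N ->
  \sum_(x <- faces w (Cap i.+1 k)) psi x.2 * face_coef w c (Cap i.+1 k) x r j =
  (r == j)%:R * cap_sum psi i k.
Proof.
move=> iN k4 jr; rewrite cap_faces //.
have top : sheet w i.+1 = 0 by rewrite /sheet ltnNge iN.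
have t0 : level_wt i = t ^ ((i == 0%N)%:Z) by rewrite level_wtE.
have lvl : level_edges w i.+1 = let: (a, b, g) := level_edges w i in
  if is_L i then (g, b, i.+1) else (a, g, i.+1).
  by rewrite /is_L /=; case: (level_edges w i) => [[a b] g]; case: (phi w i).
have tet x y : tet_edge w i.+1 x y = let: (a, b, g) := level_edges w i in
   match minn x y, maxn x y with
  | 0, 3 => i.+1
  | 1, 2 => if is_L i then a else b
  | 0, 1 | 2, 3 => if is_L i then b else a
  | _, _ => g
  end.
  by rewrite /tet_edge /is_L /=; case: (level_edges w i) => [[a b] g]; case: (phi w i).
(* Sides at level [i] contribute the exponent [z], which is 1 only at the bottom level, and sides at
   level [i.+1] contribute 0. *)
pose z : int := (i == 0)%N%:Z.
have S (v : int) (x : face) : short_path x.1.2 ->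
    base_sheet w x.2 - base_sheet w (Cap i.+1 k) - alpha w x.1.2 = v ->
    psi x.2 * face_coef w c (Cap i.+1 k) x r j = (r == j)%:R * ((-1) ^+ x.1.1 * t ^ v * psi x.2).
  by move=> sx; apply: short_term.
case: k k4 S => [|[|[|[|//]]]] _ S; rewrite /cap_sum t0 [loop_faces _ _]/= big3;
  [rewrite (S z) // ?(S 0) //|rewrite (S z) // 1?(S z) // ?(S 0) //
  |rewrite (S z) // 1?(S z) // ?(S 0) //|rewrite (S 0) // 1?(S z) // ?(S 0) //].
all: rewrite ?expr0z; try by rewrite /=; ring.
all: cbn [fst snd base_sheet]; rewrite ?bumpE /alpha ?big_cons big_nil ?alpha_tri_short // ?sheet_glue.
all: rewrite ?tet /tri_edge ?lvl /z; case: (level_edges w i) => [[a b] g]; case: (is_L i) => /=.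
all: by rewrite ?top ?addr0; lia.
Qed.
End Entries.

(** * The blocks of hexagons and tetrahedra *)

Section Entries.
Variables (w : seq letter) (C : numFieldType) (c : nat -> C).
Local Notation N := (size w).
Local Notation K := (ratfun C).
Local Notation t := (tvar C).
Hypothesis top_le : all (fun u => u <= N)%N (edges_of w N).
Hypothesis c_neq0 : forall e, (1 <= e <= N)%N -> c e != 0.
Local Notation tri_val := (tri_val w c).

Lemma fdet3 (L : comNzRingType) (f : 'I_3 -> 'I_3 -> L) : fdet f =
  f 0 0 * (f 1 1 * f 2 2 - f 1 2 * f 2 1) - f 0 1 * (f 1 0 * f 2 2 - f 1 2 * f 2 0)
  + f 0 2 * (f 1 0 * f 2 1 - f 1 1 * f 2 0).
Proof. by rewrite fdet_ord det3E !mxE. Qed.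

Lemma ad2_adj_F (p q r s : C) (j : 'I_3) :
  ad2 (\adj (mx22 p q r s)) 2 j = [:: - r ^+ 2; - (2 * r * p); p ^+ 2]`_j.
Proof.
by rewrite adj_mx22 /ad2 !mxE /=; case: (ord3P j) => -> /=; ring.
Qed.

Lemma ad2_adj_H (p q r s : C) (j : 'I_3) :
  ad2 (\adj (mx22 p q r s)) 1 j = [:: s * r; s * p + q * r; - (q * p)]`_j.
Proof.
by rewrite adj_mx22 /ad2 !mxE /=; case: (ord3P j) => -> /=; ring.
Qed.

Lemma edge_val_top u : (u <= N)%N -> glue_edge w u = u.
Proof.
by move=> uN; rewrite /glue_edge; case: (level_edges w N) => [[a b] g]; do 3?[case: eqP => ?]; lia.
Qed.

Lemma tri_val_glue i T x y : tri_val (glue_level w i) T x y = tri_val i T x y.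
Proof.
case: i => [|//]; rewrite /tri_val /edge_val /glue_level /=.
have := tri_edge_in w N T x y => /(allP top_le) le.
rewrite (edge_val_top le) /tri_edge /glue_edge /=; case: (level_edges w N) => [[a b] g].
by case: (minn x y) (maxn x y) => [|[|m]] [|[|[|n]]]; case: T {le};
  rewrite ?eqxx //; do 3?[case: eqP => ?] => //; lia.
Qed.

(* The F-coordinates of the six faces of an hexagon which are short edges, and
   the H-coordinates of those which are long. *)
Definition hexS (e A B G : C) (y j : 'I_3) : C :=
  nth 0 (nth [::] [:: [:: 0; 0; -1]; [:: - A ^+ 2; 0; 0];
     [:: G ^+ 2; 2 * G * (e * B / A); - (e * B / A) ^+ 2]] y) j.

Definition hexL (e A B G : C) (u j : 'I_3) : C :=
  nth 0 (nth [::] [:: [:: 0; 1; 0]; [:: - (e * A * G / B); -1; 0];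
     [:: 0; -1; e * B / (A * G)]] u) j.

(** Up to the factor -1/2, the derivative, in the logarithm of the value of the side [u], of the
    upper-right entry of the short-edge matrix at [y], normalized to have diagonal 1. *)
Definition kappa (e A B G : C) (y u : 'I_3) : C :=
  nth 0 (nth [::] [:: [:: B / (A * G); - (B / (A * G)); B / (A * G)];
     [:: - (G / (A * B)); - (G / (A * B)); G / (A * B)];
     [:: - (A / (B * G)); A / (B * G); A / (B * G)]] y) u * (e / 2).

Lemma det_hexS e A B G : e * e = 1 -> A != 0 ->
  fdet (hexS e A B G) = 2 * e * A * B * G.
Proof. by move=> ee A0; rewrite fdet3 /hexS /=; field. Qed.

(** The relation around a hexagon holds for all nonzero values of its sides; this is its
    linearization when one value varies. *)
Lemma kappaP e A B G u j : e * e = 1 -> A != 0 -> B != 0 -> G != 0 ->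
  hexL e A B G u j + \sum_y kappa e A B G y u * hexS e A B G y j = 0.
Proof.
move=> ee A0 B0 G0; rewrite big_ord3 /hexL /kappa /hexS.
have two : (2 : C) != 0 by rewrite pnatr_eq0.
have e1 : e ^+ 2 = 1 by rewrite expr2.
have e3 : e ^+ 3 = e by rewrite exprS e1 mulr1.
by case: (ord3P u) => ->; case: (ord3P j) => -> /=; field: e1 e3; rewrite ?A0 ?B0 ?G0.
Qed.

Definition tri_side i T (u : 'I_3) : nat :=
  nth 0%N [:: tri_edge w i T 0 1; tri_edge w i T 1 2; tri_edge w i T 0 2] u.

Local Notation hexS_ i T := (hexS (eps C T) (tri_val i T 0 1) (tri_val i T 1 2) (tri_val i T 0 2)).
Local Notation hexL_ i T := (hexL (eps C T) (tri_val i T 0 1) (tri_val i T 1 2) (tri_val i T 0 2)).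

Lemma hex_rowF (psi : cell -> K) i T j : (i < N)%N -> (forall e, psi (Long e) = 0) ->
  \sum_(x <- faces w (Hex i.+1 T)) psi x.2 * face_coef w c (Hex i.+1 T) x 2 j =
  \sum_(y < 3) psi (Short i.+1 T y) * ratconst (hexS_ i.+1 T y j).
Proof.
move=> iN psi0; rewrite hexE // !psi0 !mul0r add0r subr0 addr0 big_ord3 /adj_row !ad2_adj_F /=.
rewrite -![in LHS]mulrN -!rmorphN; move: (psi _) (psi _) (psi _) => p1 p2 p0.
rewrite addrC addrA; congr (_ * ratconst _ + _ * ratconst _ + _ * ratconst _); rewrite /hexS /=;
  by case: (ord3P j) => -> /=; ring.
Qed.

Lemma hex_rowH (psi : cell -> K) i T j : (i < N)%N -> (forall n T y, psi (Short n T y) = 0) ->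
  \sum_(x <- faces w (Hex i.+1 T)) psi x.2 * face_coef w c (Hex i.+1 T) x 1 j =
  \sum_(u < 3) psi (Long (glue_edge w (tri_side i.+1 T u))) *
     (sheet_wt w C (tri_side i.+1 T u) * ratconst (hexL_ i.+1 T u j)).
Proof.
move=> iN psi0; rewrite hexE // !psi0 !mul0r !subr0 addr0 big_ord3 /adj_row !ad2_adj_H /tri_side /=.
have iN' : (i.+1 <= N)%N by [].
have A0 := tri_val_neq0 top_le c_neq0 T 0 1 iN'.
have B0 := tri_val_neq0 top_le c_neq0 T 1 2 iN'.
have G0 := tri_val_neq0 top_le c_neq0 T 0 2 iN'.
have ee := eps_sqr C T; have ei : (eps C T) ^+ 2 = 1 by rewrite expr2.
rewrite -[X in _ + X = _]mulrN -[X in _ + _ * X = _]mulrN -[X in _ + _ * (_ * X) = _]rmorphN.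
congr (_ * (_ * ratconst _) + _ * (_ * ratconst _) + _ * (_ * ratconst _)); rewrite /hexL;
  by case: (ord3P j) => -> /=; field: ei; rewrite ?A0 ?B0 ?G0.
Qed.

(** The paths from the base vertex of the tetrahedron to its caps 0, 1 and 2 run along the bottom
    face with vertices 0, 1, 2, so the block is the one of the hexagon on that face. *)
Lemma tet_rowF i i' (k j : 'I_3) : (i < N)%N ->
  \sum_(x <- faces w (Tet i.+1)) (x.2 == Cap i'.+1 k)%:R * face_coef w c (Tet i.+1) x 2 j =
  (i' == i)%:R * ratconst (hexS_ i (is_L w i) k j).
Proof.
move=> iN; set T := is_L w i.
have capeq m m' l l' : (Cap m l == Cap m' l') = (m' == m) && (l == l').
  by apply/eqP/andP=> [[-> ->]|[/eqP-> /eqP->]]; rewrite ?eqxx.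
have e01 : tet_edge w i.+1 0 1 = tri_edge w i T 0 1.
  by rewrite /tet_edge /tri_edge /T /is_L /=; case: (level_edges w i) => [[a b] g]; case: (phi w i).
have e02 : tet_edge w i.+1 0 2 = tri_edge w i T 0 2.
  by rewrite /tet_edge /tri_edge /T /is_L /=; case: (level_edges w i) => [[a b] g]; case: (phi w i).
have s102 : tet_short w i.+1 1 0 2 = tri_short w i T 1 0 2.
  by rewrite /tet_short /tet_face /T /is_L; case: (phi w i).
have p1 : tet_path w i.+1 1 0 = [:: tet_long w i.+1 0 1] by [].
have p2 : tet_path w i.+1 2 0 = [:: tet_short w i.+1 1 0 2; tet_long w i.+1 0 2] by [].
have gN : (glue_level w i <= N)%N by rewrite /glue_level; case: ifP => // _; exact: ltnW.
have iN' : (i <= N)%N by exact: ltnW.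
have A0 := tri_val_neq0 top_le c_neq0 T 0 1 iN'.
have B0 := tri_val_neq0 top_le c_neq0 T 1 2 iN'.
have G0 := tri_val_neq0 top_le c_neq0 T 0 2 iN'.
have r1 : rho w c (tet_path w i.+1 1 0) = mx22 0 (- (tri_val i T 0 1)^-1) (tri_val i T 0 1) 0.
  by rewrite p1 rho1 /tet_long e01.
have r2 : rho w c (tet_path w i.+1 2 0) =
  mx22 (eps C T * tri_val i T 1 2 / tri_val i T 0 1) (- (tri_val i T 0 2)^-1) (tri_val i T 0 2) 0.
  rewrite p2 rho_cons rho1 s102 /tet_long e02.
  rewrite -[rho_edge w c (tri_short _ _ _ _ _ _)]/(rho_pos w c (Short (glue_level w i) T 0)).
  rewrite rho_short0 // !tri_val_glue -[rho_edge _ _ _]/(mx22 0 (- (tri_val i T 0 2)^-1) (tri_val i T 0 2) 0).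
  by rewrite mx22M; apply: eq_mx22; field; rewrite ?A0 ?G0.
have al1 : alpha w (tet_path w i.+1 1 0) = 0 by rewrite p1 /alpha big_seq1.
have al2 : alpha w (tet_path w i.+1 2 0) =
    sheet w (tri_edge w i T 0 2) - sheet w (tri_edge w i T 0 1).
  rewrite p2 /alpha !big_cons big_nil s102 alpha_tri_short // (tri_edgeC _ _ _ 0 1).
  by rewrite [alpha_edge _ _]/=; lia.
have V0 : face_coef w c (Tet i.+1) (true, tet_path w i.+1 0 (bump 0 0), Cap i.+1 0) 2 j =
    ratconst (hexS_ i T 0 j).
  have -> : tet_path w i.+1 0 (bump 0 0) = [::] by [].
  rewrite /face_coef; cbn [fst snd base_sheet].
  rewrite !bumpE subrr sub0r /alpha big_nil oppr0 expr0z expr1 mulr1 mulN1r rho0 -rmorphN.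
  rewrite (_ : 1%:M = mx22 1 0 0 1 :> 'M[C]_2); last by apply: matrix2P; rewrite !mxE.
  by congr ratconst; rewrite ad2_adj_F /hexS; case: (ord3P j) => -> /=; ring.
have V1 : face_coef w c (Tet i.+1) (false, tet_path w i.+1 1 (bump 1 0), Cap i.+1 1) 2 j =
    ratconst (hexS_ i T 1 j).
  rewrite bumpE /face_coef; cbn [fst snd base_sheet].
  rewrite !bumpE (tet_edgeC _ _ 1 0) subrr sub0r al1 oppr0 expr0z expr0 !mul1r r1.
  by congr ratconst; rewrite ad2_adj_F /hexS; case: (ord3P j) => -> /=; ring.
have V2 : face_coef w c (Tet i.+1) (true, tet_path w i.+1 2 (bump 2 0), Cap i.+1 2) 2 j =
    ratconst (hexS_ i T 2 j).
  rewrite bumpE /face_coef; cbn [fst snd base_sheet].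
  rewrite !bumpE (tet_edgeC _ _ 2 0) e01 e02 al2 subrr expr0z expr1 mulr1 mulN1r r2 -rmorphN.
  by congr ratconst; rewrite ad2_adj_F /hexS; case: (ord3P j) => -> /=; ring.
rewrite /faces big_cat /= !big_cons !big_nil.
move: V0 V1 V2; do 4?[move: (face_coef _ _ _ (_, _, Hex _ _) _ _) => ?].
set f0 := face_coef _ _ _ (_, _, Cap _ 0) _ _.
set f1 := face_coef _ _ _ (_, _, Cap _ 1) _ _.
set f2 := face_coef _ _ _ (_, _, Cap _ 2) _ _.
move: (face_coef _ _ _ (_, _, Cap _ 3) _ _) => f3.
move: f0 f1 f2 => f0 f1 f2 -> -> ->; rewrite !capeq eqSS.
case: (i' == i); rewrite /= ?mul1r ?mul0r ?add0r ?addr0 //.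
by case: (ord3P k) => ->; rewrite /= ?mul0r ?mul1r ?add0r ?addr0.
Qed.

End Entries.

(** * The three minors *)

Section Matching.
Variable w : seq letter.
Local Notation N := (size w).
Local Notation is_L := (is_L w).

(** The coordinates in degree [k] used as columns; [row_of] matches each of them with a coordinate
    in degree [k - 1]. The nesting of the sums records the order in which the blocks become
    triangular. *)
Definition col_ix (k : nat) : finType :=
  match k with
  | 1 => ('I_N * bool + ('I_N * bool + 'I_N * bool))%type
  | 2 => (('I_N * bool * 'I_3 + 'I_N)
          + ((('I_N * bool) + ('I_N * bool)) + (('I_N * bool) + ('I_N * bool))))%type
  | 3 => ('I_N * 'I_3)%type
  | _ => void
  end.

(** For fixed [b], the spokes join the ends [b] of consecutive edges e_i and e_(i+1), cyclically.
    The short-edge [outer i b] sits at the vertex of the same number in the other triangle. *)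
Definition spoke (i : 'I_N) (b : bool) : cell_ix w 1 :=
  inr (i, is_L i (+) ~~ b, if b then 2 else 0).
Definition outer (i : 'I_N) (b : bool) : cell_ix w 1 :=
  inr (i, is_L i (+) b, if b then 2 else 0).
Definition middle (i : 'I_N) (T : bool) : cell_ix w 1 := inr (i, T, 1).

(** The cap of Delta_(i+1) whose boundary contains the middle short-edges of the triangles [T] of
    both the lower and the upper level. *)
Definition middle_cap (i : 'I_N) (T : bool) : cell_ix w 2 :=
  inr (i, if T == is_L i then 1 else 2).
Definition outer_cap (i : 'I_N) (b : bool) : cell_ix w 2 := inr (i, if b then 3 else 0).

Definition col_of (k : nat) : col_ix k -> cell_ix w k * 'I_3 :=
  match k with
  | 1 => fun x => match x with
         | inl (i, b) => (inl i, if b then 0 else 2)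
         | inr (inl (i, b)) => (spoke i b, 1)
         | inr (inr (i, b)) => (spoke i b, 0)
         end
  | 2 => fun x => match x with
         | inl (inl (i, T, j)) => (inl (i, T), j)
         | inl (inr i) => (inr (i, 3), 2)
         | inr (inl (inl (i, T))) => (middle_cap i T, 1)
         | inr (inl (inr (i, b))) => (outer_cap i b, 1)
         | inr (inr (inl (i, T))) => (middle_cap i T, 0)
         | inr (inr (inr (i, b))) => (outer_cap i b, 0)
         end
  | 3 => fun x => x
  | _ => fun x => match x with end
  end.

Definition row_of (k : nat) : col_ix k.+1 -> cell_ix w k * 'I_3 :=
  match k with
  | 0 => fun x => match x with
         | inl (i, b) => ((i, b), 2)
         | inr (inl (i, b)) => ((i, b), 1)
         | inr (inr (i, b)) => ((i, b), 0)
         end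
  | 1 => fun x => match x with
         | inl (inl (i, T, y)) => (inr (i, T, y), 2)
         | inl (inr i) => (inl i, 1)
         | inr (inl (inl (i, T))) => (middle i T, 1)
         | inr (inl (inr (i, b))) => (outer i b, 1)
         | inr (inr (inl (i, T))) => (middle i T, 0)
         | inr (inr (inr (i, b))) => (outer i b, 0)
         end
  | 2 => fun x => (inr (x.1, widen_ord (leqnSn 3) x.2), 2)
  | _ => fun x => match x with end
  end.

Lemma matching_inj k : injective (sum_fun (@row_of k) (@col_of k)).
Proof.
case: k => [|[|[|[|k]]]].
{ by case=> [[[i b]|[[i b]|[i b]]]|[]]; case=> [[[j b']|[[j b']|[j b']]]|[]] //= [-> ->]. }
{ case=> [[[[[i b] y]|i]|[[[i b]|[i b]]|[[i b]|[i b]]]]|[[i b]|[[i b]|[i b]]]];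
  case=> [[[[[j b'] y']|j]|[[[j b']|[j b']]|[[j b']|[j b']]]]|[[j b']|[[j b']|[j b']]]] //=;
  try by case; do ?[move=> -> || move=> /val_inj-> ].
  all: try by case: b' => /(congr1 (fun x : cell_ix w 1 * 'I_3 => val x.2)).
  all: try by case: b => /(congr1 (fun x : cell_ix w 1 * 'I_3 => val x.2)).
  all: by case: b; case: b' => -[] // -> //; case: (is_L _). }
{ case=> [[i k]|[[[[i b] y]|i]|[[[i b]|[i b]]|[[i b]|[i b]]]]];
  case=> [[j l]|[[[[j b'] y']|j]|[[[j b']|[j b']]|[[j b']|[j b']]]]] //=;
  try by case; do ?[move=> -> || move=> /val_inj-> ].
  { by move=> /(congr1 (fun x : cell_ix w 2 * 'I_3 => if x.1 is inr y then val y.2 else 0%N)) /= E; have := ltn_ord k; rewrite E. }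
  { by move=> /(congr1 (fun x : cell_ix w 2 * 'I_3 => if x.1 is inr y then val y.2 else 0%N)) /= E; have := ltn_ord l; rewrite -E. }
  all: move=> /[dup] /(congr1 (fun x : cell_ix w 2 * 'I_3 => if x.1 is inr y then y.1 else i)) /= ->.
  all: move=> /(congr1 (fun x : cell_ix w 2 * 'I_3 => if x.1 is inr y then val y.2 else 0%N)).
  all: by case: b; case: b' => //=; case: (is_L _). }
{ by case=> [[]|x]; case=> [[]|y] //= ->. }
by case=> -[].
Qed.

Lemma matching_bij k : bijective (sum_fun (@row_of k) (@col_of k)).
Proof.
apply: inj_card_bij (@matching_inj k) _.
case: k => [|[|[|[|k]]]] /=; rewrite !(card_sum, card_prod, card_ord, card_bool, card_void); lia.
Qed.

Lemma enc_matching_bij k :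
  bijective (sum_fun (@enc w k \o @row_of k) (@enc w k \o @col_of k)).
Proof.
by have B := bij_comp (@enc_bij w k) (matching_bij k); apply: (eq_bij B); case.
Qed.

End Matching.

(** * The minors in degrees 0 and 2 *)

Section Minors.
Variables (w : seq letter) (C : numFieldType) (c : nat -> C).
Local Notation N := (size w).
Local Notation K := (ratfun C).
Local Notation t := (tvar C).
Local Notation is_L := (is_L w).
Hypothesis top_le : all (fun u => u <= N)%N (edges_of w N).
Hypothesis c_neq0 : forall e, (1 <= e <= N)%N -> c e != 0.
Local Notation tri_val := (tri_val w c).

Definition based_entry k (x : cell_ix w k * 'I_3) (y : cell_ix w k.+1 * 'I_3) : K :=
  \sum_(u <- faces w (cell_of y.1)) (u.2 == cell_of x.1)%:R * face_coef w c (cell_of y.1) u x.2 y.2.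

Lemma based_boundaryE k (x : cell_ix w k * 'I_3) (y : cell_ix w k.+1 * 'I_3) :
  based_boundary w c (base_sheet w) k (enc x) (enc y) = based_entry x y.
Proof.
by rewrite /based_boundary mxblock_enc !nth_cell_pos (based_blockE _ c_neq0 _ _ _ (cell_of_in y.1)).
Qed.

Definition tri_prod i T : C := eps C T * (tri_val i T 0 1 * tri_val i T 1 2 * tri_val i T 0 2).

Lemma minor2E :
  fdet (fun x y : col_ix w 3 => based_entry (row_of x) (col_of y)) =
  \prod_(i < N) ratconst (2 * tri_prod i (is_L i)).
Proof.
pose B (i : 'I_N) (k j : 'I_3) : K := ratconst (hexS (eps C (is_L i))
  (tri_val i (is_L i) 0 1) (tri_val i (is_L i) 1 2) (tri_val i (is_L i) 0 2) k j).
transitivity (fdet (fun x y : 'I_N * 'I_3 => (x.1 == y.1)%:R * B x.1 x.2 y.2)).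
  apply: eq_fdet => -[i k] [i' j]; rewrite /based_entry /B /=.
  rewrite (tet_rowF top_le c_neq0 i k j (ltn_ord i')) (inj_eq val_inj).
  by case: eqP => [->|]; rewrite ?mul0r.
rewrite fdet_fiber; apply: eq_bigr => i _; rewrite /B.
have iN : (i <= N)%N by exact: ltnW.
rewrite -(_ : ratconst (fdet (hexS (eps C (is_L i)) (tri_val i (is_L i) 0 1)
   (tri_val i (is_L i) 1 2) (tri_val i (is_L i) 0 2))) = fdet _).
  by rewrite det_hexS ?eps_sqr ?tri_val_neq0 // /tri_prod !mulrA.
by rewrite /fdet -det_map_mx; congr (\det _); apply/matrixP => k j; rewrite !mxE.
Qed.

Lemma tri_edge_new i T : tri_edge w i.+1 T 0 2 = i.+1.
Proof. by rewrite /tri_edge /=; case: (level_edges w i) => [[a b] g]; case: (phi w i). Qed.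

Lemma tri_edge_old i :
  (tri_edge w i.+1 (~~ is_L i) 0 1 = tri_edge w i true 0 2) *
  (tri_edge w i.+1 (is_L i) 2 1 = tri_edge w i true 0 2).
Proof.
by rewrite /tri_edge /is_L /=; case: (level_edges w i) => [[a b] g]; case: (phi w i).
Qed.

Definition cyc_pred (i : nat) : nat := if i == 0%N then N.-1 else i.-1.

Lemma glue_diag (i : 'I_N) T : glue_edge w (tri_edge w i T 0 2) = (cyc_pred i).+1.
Proof.
rewrite /cyc_pred; case: i => [[|i] iN] /=; last by rewrite tri_edge_new edge_val_top // ltnW.
rewrite prednK //; have := tri_edge_new N.-1 T; rewrite prednK // /tri_edge /glue_edge /=.
by case: (level_edges w N) => [[a b] g] /= ->; do 3?[case: eqP => ?] => //; lia.
Qed.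

Lemma sheet_diag (i : 'I_N) T : sheet_wt w C (tri_edge w i T 0 2) = level_wt C i.
Proof.
rewrite /sheet_wt /level_wt; case: i => [[|i] iN] /=.
  by rewrite /sheet /tri_edge /=; case: ltnP; [rewrite opprK expr1z|lia].
by rewrite tri_edge_new /sheet ltnNge (ltnW iN) /= oppr0 expr0z.
Qed.

Lemma vert_eq e b e' b' : (Vert e b == Vert e' b') = (e == e') && (b == b').
Proof. by apply/eqP/andP => [[-> ->]|[/eqP-> /eqP->]]; rewrite ?eqxx. Qed.

Lemma short_eq i T y i' T' y' :
  (Short i T y == Short i' T' y') = [&& i == i', T == T' & y == y'].
Proof. by apply/eqP/and3P => [[-> -> ->]|[/eqP-> /eqP-> /eqP->]]; rewrite ?eqxx. Qed.

Definition cycle_entry (s : K) (b : 'I_N -> K) (i j : 'I_N) : K :=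
  s * ((i == j)%:R - b j * (i == cyc_pred j :> nat)%:R).

Lemma det_cycle_entry s b : (0 < N)%N -> fdet (cycle_entry s b) = s ^+ N * (1 - \prod_i b i).
Proof. exact: det_cycle. Qed.

Lemma spoke_entry i b (i' : 'I_N) b' (r : 'I_3) :
  based_entry (k := 0) ((i', b'), r) (spoke i b, r) =
  (b' == b)%:R * cycle_entry ((-1) ^+ b) (fun j : 'I_N => level_wt C j) i' i.
Proof.
rewrite [LHS](shortE c top_le (fun s => (s == Vert i'.+1 b')%:R) i _ _ (leqnn r)).
rewrite eqxx mul1r /cycle_entry.
have s1 T : sheet_wt w C (tri_edge w i.+1 T 0 2) = 1.
  by rewrite tri_edge_new /sheet_wt /sheet ltnNge (ltn_ord i) oppr0 expr0z.
have iN : (i.+1 <= N)%N by [].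
have ii : (i' == i) = (i == i' :> nat) by rewrite eq_sym.
have pp : (i' == cyc_pred i :> nat) = (cyc_pred i == i') by rewrite eq_sym.
case: b => /=; rewrite !bumpE /tri_vert ?addbT ?addbF ?negbK /=.
  rewrite (tri_edgeC _ _ _ 2 0) s1 (tri_edge_old i).2 tri_edge_new (edge_val_top top_le iN).
  rewrite glue_diag sheet_diag !vert_eq !eqSS ii pp.
  rewrite (_ : (1 < _)%N = true) // (_ : (0 < _)%N = true) //.
  by case: b'; rewrite /= ?andbF ?andbT ?(mulr0n, mul0r, mulr0, subr0) //; ring.
rewrite s1 (tri_edge_old i).1 tri_edge_new (edge_val_top top_le iN).
rewrite glue_diag sheet_diag !vert_eq !eqSS ii pp.
by case: b'; rewrite /= ?andbF ?andbT ?(mulr0n, mul0r, mulr0, subr0) //; ring.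
Qed.

Lemma prod_level_wt : (0 < N)%N -> \prod_(i < N) level_wt C i = t.
Proof.
case: N => // n _; rewrite big_ord_recl big1 ?mulr1 //.
Qed.

Lemma det_spoke (r : 'I_3) : (0 < N)%N ->
  fdet (fun x y : 'I_N * bool => based_entry (k := 0) (x, r) (spoke y.1 y.2, r)) =
  (-1) ^+ N * (1 - t) ^+ 2.
Proof.
move=> N0; transitivity (fdet (fun x y : 'I_N * bool =>
    (x.2 == y.2)%:R * cycle_entry ((-1) ^+ x.2) (fun j : 'I_N => level_wt C j) x.1 y.1)).
  apply: eq_fdet => -[i b] [i' b'] /=; rewrite spoke_entry.
  by case: eqP => [->|_]; rewrite ?mul0r.
rewrite (fdet_fiberr (fun b : bool => cycle_entry ((-1) ^+ b) (fun j : 'I_N => level_wt C j))).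
rewrite (bigD1 true) // (bigD1 false) //= big1 => [|[]] //.
by rewrite !det_cycle_entry // prod_level_wt // expr1 expr0 expr1n; ring.
Qed.

Lemma short_entry0 x (r : 'I_3) i T (y j : 'I_3) : (j < r)%N ->
  based_entry (k := 0) (x, r) (inr (i, T, y), j) = 0.
Proof.
move=> jr; rewrite [LHS](shortE c top_le (fun s => (s == cell_of (k := 0) x)%:R) i _ _ (ltnW jr)).
by rewrite -(inj_eq val_inj) (gtn_eqF jr) mul0r.
Qed.

Lemma minor0E : (0 < N)%N ->
  fdet (fun x y : col_ix w 1 => based_entry (row_of x) (col_of y)) ^+ 2 =
  ((\prod_(i < N) ratconst (c i.+1) ^+ 2) * (1 - t) ^+ 4) ^+ 2.
Proof.
move=> N0; rewrite fdet_lsum; last by move=> [i b] [[i' b']|[i' b']]; exact: short_entry0.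
rewrite fdet_lsum; last by move=> [i b] [i' b']; exact: short_entry0.
rewrite [X in _ * (X * _)](_ : _ = (-1) ^+ N * (1 - t) ^+ 2);
  last by rewrite -(det_spoke 1 N0); apply: eq_fdet => -[i b] [i' b'].
rewrite [X in _ * (_ * X)](_ : _ = (-1) ^+ N * (1 - t) ^+ 2);
  last by rewrite -(det_spoke 0 N0); apply: eq_fdet => -[i b] [i' b'].
(* In the F-rows, the E-column of a long edge meets only its end, with the entry - c^2, and its
   F-column only its start, with the entry -1. *)
rewrite [X in X * _](_ : _ = \prod_(x : 'I_N * bool)
    (if x.2 then - ratconst (c x.1.+1) ^+ 2 else -1)); last first.
  rewrite -fdet_diag; apply: eq_fdet => -[i b] [i' b'].
  rewrite [LHS](longE w c (fun s => (s == Vert i.+1 b)%:R) i'.+1).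
  rewrite !vert_eq !eqSS /adj_row !ad2_adj_F -[(i, b) == _]/((i == i') && (b == b')).
  rewrite [i' == i :> nat]eq_sym [(i == i' :> nat)](inj_eq val_inj).
  case: (i == i'); last by rewrite /= !mul0r subr0.
  by case: b b' => [] [] /=; rewrite ?rmorph0 ?rmorph1 ?rmorphN ?rmorphXn /= ; ring.
rewrite -(pair_bigA _ (fun (i : 'I_N) b => if b then - ratconst (c i.+1) ^+ 2 else -1)) /=.
rewrite (eq_bigr (fun i : 'I_N => ratconst (c i.+1) ^+ 2)) => [|i _]; last first.
  by rewrite (bigD1 true) // (bigD1 false) //= big1 => [|[]] //; ring.
move: (\prod_(i < N) _) => P; have s : ((-1) ^+ N * (-1) ^+ N) = 1 :> K.
  by rewrite -expr2 sqrr_sign.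
have -> : P * ((-1) ^+ N * (1 - t) ^+ 2 * ((-1) ^+ N * (1 - t) ^+ 2)) =
   P * (1 - t) ^+ 4 * ((-1) ^+ N * (-1) ^+ N) by ring.
by rewrite s mulr1.
Qed.

End Minors.

(** * The minor in degree 1 *)

Section Minors.
Variables (w : seq letter) (C : numFieldType) (c : nat -> C).
Local Notation N := (size w).
Local Notation K := (ratfun C).
Local Notation t := (tvar C).
Local Notation is_L := (is_L w).
Hypothesis top_le : all (fun u => u <= N)%N (edges_of w N).
Hypothesis c_neq0 : forall e, (1 <= e <= N)%N -> c e != 0.
Local Notation tri_val := (tri_val w c).
Local Notation entry := (@based_entry w C c 1).

Lemma glue_level_prev (i : 'I_N) : glue_level w i = (cyc_pred w i).+1.
Proof.
by rewrite /glue_level /cyc_pred; case: i => [[|i] iN] /=; rewrite ?prednK.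
Qed.

Lemma cap_entry (x : cell_ix w 1) (r j : 'I_3) i k : (j <= r)%N ->
  entry (x, r) (inr (i, k) : cell_ix w 2, j) =
  (r == j)%:R * cap_sum w (fun s => (s == cell_of x)%:R : K) i k.
Proof.
by move=> jr; exact: (capE c top_le (fun s => (s == cell_of x)%:R) (ltn_ord i) (ltn_ord k) jr).
Qed.

Lemma cap_entry0 (x : cell_ix w 1) (r j : 'I_3) i k : (j < r)%N ->
  entry (x, r) (inr (i, k) : cell_ix w 2, j) = 0.
Proof.
by move=> jr; rewrite cap_entry 1?ltnW // -(inj_eq val_inj) (gtn_eqF jr) mul0r.
Qed.

Lemma middle_entry i' T' i T r :
  entry (middle i' T', r) (middle_cap i T, r) =
  (T' == T)%:R * cycle_entry (-1) (fun j : 'I_N => level_wt C j) i' i.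
Proof.
rewrite cap_entry // eqxx mul1r /cycle_entry.
have ii : (i' == i) = (i == i' :> nat) by rewrite eq_sym.
have pp : (i' == cyc_pred w i :> nat) = (cyc_pred w i == i') by rewrite eq_sym.
rewrite ii pp; case: (eqVneq T (is_L i)) => [->|TL].
  rewrite /cap_sum /= !short_eq !eqSS glue_level_prev !eqSS !andbT !andbF.
  by rewrite [is_L i == _]eq_sym; case: (T' == is_L i); rewrite ?andbF ?andbT /=; ring.
have -> : T = ~~ is_L i by case: T TL; case: (is_L i).
rewrite /cap_sum /= !short_eq !eqSS glue_level_prev !eqSS !andbT !andbF.
by rewrite [~~ is_L i == _]eq_sym; case: (T' == ~~ is_L i); rewrite ?andbF ?andbT /=; ring.
Qed.

Lemma det_middle (r : 'I_3) : (0 < N)%N ->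
  fdet (fun x y : 'I_N * bool => entry (middle x.1 x.2, r) (middle_cap y.1 y.2, r)) =
  (1 - t) ^+ 2.
Proof.
move=> N0; transitivity (fdet (fun x y : 'I_N * bool =>
    (x.2 == y.2)%:R * cycle_entry (-1) (fun j : 'I_N => level_wt C j) x.1 y.1)).
  by apply: eq_fdet => -[i b] [i' b'] /=; rewrite middle_entry.
rewrite (fdet_fiberr (fun b : bool => cycle_entry (-1) (fun j : 'I_N => level_wt C j))).
rewrite (bigD1 true) // (bigD1 false) //= big1 => [|[]] //.
rewrite !det_cycle_entry // prod_level_wt // mulr1 mulrACA -expr2 sqrr_sign mul1r.
by rewrite -expr2.
Qed.

(** The outer cap has one outer-corner side at the lower level. That side is an [outer] short-edge
    exactly when the letter does not change; otherwise it is a spoke, which is absent from these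
    rows. *)
Definition same_letter (i : nat) : K := (is_L i == is_L (cyc_pred w i))%:R.

Lemma outer_entry i' b' i b r :
  entry (outer i' b', r) (outer_cap i b, r) =
  (b' == b)%:R * cycle_entry (-1) (fun j : 'I_N => level_wt C j * same_letter j) i' i.
Proof.
rewrite cap_entry // eqxx mul1r /cycle_entry /same_letter.
have ii : (i' == i) = (i == i' :> nat) by rewrite eq_sym.
have pp : (i' == cyc_pred w i :> nat) = (cyc_pred w i == i') by rewrite eq_sym.
rewrite ii pp /cap_sum; case: b => /=; rewrite !short_eq !eqSS glue_level_prev !eqSS.
  case: b'; rewrite /= ?andbF ?andbT ?addbT ?addbF ?mulr0n; last by ring.
  case: (eqVneq (cyc_pred w i) i') => [->|_]; case: (eqVneq (i : nat) i') => [->|_];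
    rewrite /= ?eqb_negLR ?negbK; case: (is_L i') => //=; case: (is_L i) => //=; ring.
case: b'; rewrite /= ?andbF ?andbT ?addbT ?addbF ?mulr0n; first by ring.
case: (eqVneq (cyc_pred w i) i') => [->|_]; case: (eqVneq (i : nat) i') => [->|_];
  case: (is_L i') => //=; case: (is_L i) => //=; ring.
Qed.

(** A change of letter makes a factor of the cyclic product vanish. Each of the two cycles then has
    determinant (-1)^N, and the signs cancel. *)
Lemma det_outer (r : 'I_3) : (0 < N)%N -> (exists i : 'I_N, is_L i != is_L (cyc_pred w i)) ->
  fdet (fun x y : 'I_N * bool => entry (outer x.1 x.2, r) (outer_cap y.1 y.2, r)) = 1.
Proof.
move=> N0 [i0 Hi0]; transitivity (fdet (fun x y : 'I_N * bool =>
    (x.2 == y.2)%:R * cycle_entry (-1) (fun j : 'I_N => level_wt C j * same_letter j) x.1 y.1)).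
  by apply: eq_fdet => -[i b] [i' b'] /=; rewrite outer_entry.
rewrite (fdet_fiberr (fun b : bool =>
  cycle_entry (-1) (fun j : 'I_N => level_wt C j * same_letter j))).
rewrite (bigD1 true) // (bigD1 false) //= big1 => [|[]] //.
rewrite !det_cycle_entry // (bigD1 i0) //= /same_letter (negPf Hi0) mulr0 mul0r subr0 !mulr1.
by rewrite -expr2 sqrr_sign.
Qed.

Lemma middle_outer0 (x : 'I_N * bool) (r : 'I_3) i b : entry (middle x.1 x.2, r) (outer_cap i b, r) = 0.
Proof.
rewrite cap_entry // eqxx mul1r /cap_sum; case: b => /=; rewrite !short_eq /= ?andbF ?mulr0n; ring.
Qed.

(* The row of the Ptolemy deformation of the edge e: the variation of the
   upper-right entries of the short-edges under a variation of log c(e). *)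
Definition deform (e : nat) (s : cell) : K :=
  if s is Short i T y then
    \sum_(u < 3) (glue_edge w (tri_side w i T u) == e)%:R * (sheet_wt w C (tri_side w i T u)
      * ratconst (kappa (eps C T) (tri_val i T 0 1) (tri_val i T 1 2) (tri_val i T 0 2) (inord y) u))
  else 0.

(** The entry left in the row of the long edge e and the column of the fourth cap, after the row
    operation given by [deform]. *)
Definition ptolemy_entry (e i : 'I_N) : K := cap_sum w (deform e.+1) i 3.

Lemma sum_short_delta (psi : cell -> K) a T b : (0 < a <= N)%N -> (b < 3)%N ->
  \sum_(x : 'I_N * bool * 'I_3)
    psi (Short x.1.1.+1 x.1.2 x.2) * (Short a T b == Short x.1.1.+1 x.1.2 x.2)%:R
  = psi (Short a T b).
Proof.
case: a => // a aN b3; pose x0 : 'I_N * bool * 'I_3 := (Ordinal aN, T, Ordinal b3).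
rewrite (bigD1 x0) //= eqxx mulr1 big1 ?addr0 // => -[[i T'] y] xx0.
rewrite short_eq; case: and3P => [[/eqP[E1] /eqP E2 /eqP E3]|_]; last by rewrite mulr0.
case/eqP: xx0; rewrite /x0 E2; congr (_, _, _); exact/val_inj/esym.
Qed.

Lemma hex_entry i' T' y i T j :
  entry (inr (i', T', y) : cell_ix w 1, 2) (inl (i, T) : cell_ix w 2, j) =
  ((i', T') == (i, T))%:R * ratconst (hexS (eps C T) (tri_val i.+1 T 0 1) (tri_val i.+1 T 1 2)
     (tri_val i.+1 T 0 2) y j).
Proof.
rewrite [LHS](hex_rowF top_le c_neq0 (psi := fun s => (s == Short i'.+1 T' y)%:R)) //.
rewrite -[(i', T') == _]/((i' == i) && (T' == T)).
rewrite (bigD1 y) //= big1 ?addr0 => [|z zy]; last first.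
  by rewrite short_eq [z == y :> nat](inj_eq val_inj) (negPf zy) !andbF mul0r.
by rewrite short_eq eqxx andbT eqSS [i == i' :> nat]eq_sym (inj_eq val_inj) [T == _]eq_sym.
Qed.

(** The linearized hexagon relation [kappaP], applied side by side, clears the columns of the
    hexagons from the row of a long edge. *)
Lemma deform_hex (e : 'I_N) i T j :
  \sum_(x : 'I_N * bool * 'I_3) deform e.+1 (Short x.1.1.+1 x.1.2 x.2) *
     entry (inr x : cell_ix w 1, 2) (inl (i, T) : cell_ix w 2, j)
  + entry (inl e : cell_ix w 1, 1) (inl (i, T) : cell_ix w 2, j) = 0.
Proof.
have -> : \sum_(x : 'I_N * bool * 'I_3) deform e.+1 (Short x.1.1.+1 x.1.2 x.2) *
     entry (inr x : cell_ix w 1, 2) (inl (i, T) : cell_ix w 2, j) =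
   \sum_(y < 3) deform e.+1 (Short i.+1 T y) * ratconst (hexS (eps C T) (tri_val i.+1 T 0 1)
     (tri_val i.+1 T 1 2) (tri_val i.+1 T 0 2) y j).
  transitivity (\sum_(p : 'I_N * bool) \sum_(y < 3) deform e.+1 (Short p.1.+1 p.2 y) *
     entry (inr (p, y) : cell_ix w 1, 2) (inl (i, T) : cell_ix w 2, j)).
    by rewrite pair_bigA; apply: eq_bigr => -[[]].
  rewrite (bigD1 (i, T)) //= [X in _ + X]big1 ?addr0 => [|p pn]; last first.
    by rewrite big1 // => y _; case: p pn => i' T' pn; rewrite hex_entry (negPf pn) mul0r mulr0.
  by apply: eq_bigr => y _; rewrite hex_entry eqxx mul1r.
rewrite [X in _ + X](hex_rowH top_le c_neq0 (psi := fun s => (s == Long e.+1)%:R)) //.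
rewrite /deform; under eq_bigr do rewrite mulr_suml.
rewrite exchange_big -big_split /= big1 // => u _.
have -> : (Long (glue_edge w (tri_side w i.+1 T u)) == Long e.+1) =
          (glue_edge w (tri_side w i.+1 T u) == e.+1).
  by apply/eqP/eqP => [[->]|->].
under eq_bigr => y _ do rewrite inord_val -mulrA -mulrA -rmorphM.
rewrite -mulr_sumr -mulr_sumr -rmorph_sum /= -mulrDr -mulrDr -rmorphD /= addrC.
have iN : (i.+1 <= N)%N by [].
by rewrite kappaP ?eps_sqr ?tri_val_neq0 // rmorph0 !mulr0.
Qed.

Lemma deform_cap (e i : 'I_N) :
  \sum_(x : 'I_N * bool * 'I_3) deform e.+1 (Short x.1.1.+1 x.1.2 x.2) *
     entry (inr x : cell_ix w 1, 2) (inr (i, 3) : cell_ix w 2, 2)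
  = ptolemy_entry e i.
Proof.
have iN : (0 < i.+1 <= N)%N by exact: ltn_ord.
have lN : (0 < glue_level w i <= N)%N by rewrite glue_level_prev /cyc_pred; case: eqP; lia.
rewrite /ptolemy_entry /cap_sum -(sum_short_delta (deform e.+1) (is_L i) iN (isT : 2 < 3)%N).
rewrite -(sum_short_delta (deform e.+1) (~~ is_L i) iN (isT : 2 < 3)%N).
rewrite -(sum_short_delta (deform e.+1) (~~ is_L i) lN (isT : 2 < 3)%N).
rewrite mulr_sumr -big_split -sumrB /=; apply: eq_bigr => x _.
by case: x => [[i' T'] y]; rewrite cap_entry // eqxx mul1r /cap_sum /=; ring.
Qed.

Lemma cap_long0 (e : 'I_N) (r : 'I_3) i k j :
  entry (inl e : cell_ix w 1, r) (inr (i, k) : cell_ix w 2, j) = 0.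
Proof.
rewrite /based_entry [X in \sum_(_ <- X) _](cap_faces _ _ (ltn_ord k)).
by case: k => [[|[|[|[|//]]]] k4]; rewrite [loop_faces _ _]/= big3 /= !mul0r !addr0.
Qed.

Lemma ptolemy_block :
  fdet (fun x y => entry (row_of (inl x : col_ix w 2)) (col_of (inl y : col_ix w 2))) =
  (\prod_(x : 'I_N * bool) ratconst (2 * tri_prod w c x.1.+1 x.2)) * fdet ptolemy_entry.
Proof.
pose L0 (x y : 'I_N * bool * 'I_3 + 'I_N) : K :=
  entry (row_of (inl x : col_ix w 2)) (col_of (inl y : col_ix w 2)).
(* Left multiplication by this unitriangular matrix adds to the H-row of each long edge the
   combination of F-rows of short-edges prescribed by [deform]. *)
pose U (x y : 'I_N * bool * 'I_3 + 'I_N) : K :=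
  match x, y with
  | inl a, inl b => (a == b)%:R * 1
  | inr a, inr b => (a == b)%:R * 1
  | inr e, inl x => deform e.+1 (Short x.1.1.+1 x.1.2 x.2)
  | _, _ => 0
  end.
have U1 : fdet U = 1 by rewrite fdet_lsum // !fdet_diag !big1 ?mulr1.
rewrite -[LHS]/(fdet L0) -[LHS]mul1r -[X in X * _ = _]U1 -fdet_mul fdet_usum; last first.
  move=> e [[i T] j]; rewrite big_sumType /= (bigD1 e) //= eqxx !mul1r.
  rewrite [X in _ + (_ + X)]big1 ?addr0 => [|e' ee'].
    rewrite -[RHS](deform_hex e i T j); congr (_ + _); apply: eq_bigr => -[[i' T'] y] _.
    by [].
  by rewrite eq_sym (negPf ee') !mul0r.
congr (_ * _).
  pose B (x : 'I_N * bool) (y j : 'I_3) : K := ratconst (hexS (eps C x.2) (tri_val x.1.+1 x.2 0 1)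
     (tri_val x.1.+1 x.2 1 2) (tri_val x.1.+1 x.2 0 2) y j).
  transitivity (fdet (fun x y : ('I_N * bool) * 'I_3 => (x.1 == y.1)%:R * B x.1 x.2 y.2)).
    apply: eq_fdet => x [[i T] j]; rewrite big_sumType /= [X in _ + X]big1 ?addr0; last first.
      by move=> e _; rewrite mul0r.
    rewrite (bigD1 x) //= eqxx !mul1r big1 ?addr0 => [|x' xx']; last first.
      by rewrite eq_sym (negPf xx') !mul0r.
    case: x => [[i' T'] y]; rewrite [LHS]hex_entry /B /=.
    by case: eqP => [[-> ->]|]; rewrite ?mul0r.
  rewrite fdet_fiber; apply: eq_bigr => -[i T] _; rewrite /B /=.
  have iN : (i.+1 <= N)%N by [].
  rewrite -(_ : ratconst (fdet (hexS (eps C T) (tri_val i.+1 T 0 1)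
   (tri_val i.+1 T 1 2) (tri_val i.+1 T 0 2))) = fdet _).
    by rewrite det_hexS ?eps_sqr ?tri_val_neq0 // /tri_prod !mulrA.
  by rewrite /fdet -det_map_mx; congr (\det _); apply/matrixP => k j; rewrite !mxE.
apply: eq_fdet => e i; rewrite big_sumType /= (bigD1 e) //= eqxx !mul1r.
rewrite [X in _ + (_ + X)]big1 ?addr0 => [|e' ee']; last by rewrite eq_sym (negPf ee') !mul0r.
rewrite -deform_cap; set s := \sum_(_ <- _) _.
have -> : L0 (inr e) (inr i) = 0.
  exact: cap_long0.
by rewrite addr0; apply: eq_bigr => -[[i' T'] y] _.
Qed.

Lemma minor1E : (0 < N)%N -> (exists i : 'I_N, is_L i != is_L (cyc_pred w i)) ->
  fdet (fun x y : col_ix w 2 => entry (row_of x) (col_of y)) =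
  (\prod_(x : 'I_N * bool) ratconst (2 * tri_prod w c x.1.+1 x.2)) * fdet ptolemy_entry
  * (1 - t) ^+ 4.
Proof.
move=> N0 switch; rewrite fdet_lsum; last first.
  by move=> [[[i T] y]|e] [[[i' T']|[i' b']]|[[i' T']|[i' b']]];
    first [exact: cap_long0|exact: cap_entry0].
rewrite ptolemy_block; congr (_ * _).
rewrite fdet_lsum; last first.
  by move=> [[i T]|[i b]] [[i' T']|[i' b']]; exact: cap_entry0.
rewrite (fdet_lsum (A := fun x y => entry (row_of (inr (inl x) : col_ix w 2)) _)); last first.
  by move=> [i T] [i' b']; exact: (middle_outer0 (i, T)).
rewrite (fdet_lsum (A := fun x y => entry (row_of (inr (inr x) : col_ix w 2)) _)); last first.
  by move=> [i T] [i' b']; exact: (middle_outer0 (i, T)).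
rewrite [X in X * _ * _](_ : _ = (1 - t) ^+ 2); last first.
  by rewrite -(det_middle 1 N0); apply: eq_fdet => -[i b] [i' b'].
rewrite [X in _ * X * _](_ : _ = 1); last first.
  by rewrite -[RHS](det_outer 1 N0 switch); apply: eq_fdet => -[i b] [i' b'].
rewrite [X in _ * (X * _)](_ : _ = (1 - t) ^+ 2); last first.
  by rewrite -(det_middle 0 N0); apply: eq_fdet => -[i b] [i' b'].
rewrite [X in _ * (_ * X)](_ : _ = 1); last first.
  by rewrite -[RHS](det_outer 0 N0 switch); apply: eq_fdet => -[i b] [i' b'].
by rewrite !mulr1 -exprD.
Qed.

End Minors.

(** * The Ptolemy block and the return map *)

Section Ptolemy.
Variables (w : seq letter) (C : numFieldType) (c : nat -> C).
Local Notation N := (size w).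
Local Notation K := (ratfun C).
Local Notation t := (tvar C).
Local Notation is_L := (is_L w).
Hypothesis top_le : all (fun u => u <= N)%N (edges_of w N).
Hypothesis c_ptolemy : ptolemy w c.
Let c_neq0 : forall e, (1 <= e <= N)%N -> c e != 0.
Proof. by case: c_ptolemy. Qed.
Local Notation val := (edge_val w c).

(** In the passage to the next level, the dropped edge is replaced by e_(i+1), the diagonal takes
    over its direction, and the kept edge retains its own. *)
Definition kept i := tri_edge w i (is_L i) 0 1.
Definition dropped i := tri_edge w i (is_L i) 1 2.
Definition diagonal i := tri_edge w i (is_L i) 0 2.

Lemma ptolemy_rel i : (i < N)%N ->
  val i.+1 * val (dropped i) = val (kept i) ^+ 2 + val (diagonal i) ^+ 2.
Proof.
move=> iN; have := c_ptolemy.2 i.+1 iN.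
have E x y : tet_c w c i.+1 x y = (-1) ^+ (y < x)%N * val (tet_edge w i.+1 x y) by [].
rewrite !E /tet_sigma /tet_short /tet_face /tet_edge /kept /dropped /diagonal /is_L /tri_edge /=.
case: (level_edges w i) => [[a b] g]; case: (phi w i) => H;
  apply/eqP; rewrite -subr_eq0; apply/eqP; rewrite -[RHS]oppr0 -H /sigma /=; by field.
Qed.

Lemma edge_val_glue u : val (glue_edge w u) = val u.
Proof.
rewrite /edge_val; case: (leqP u N) => [uN|Nu]; first by rewrite !(edge_val_top top_le uN).
case: (leqP u N.+3) => uN3.
  rewrite (edge_val_top top_le) //; have := @glue_range w top_le u.
  by move=> H; have /andP[] := H (introT andP (conj (leq_ltn_trans (leq0n _) Nu) uN3)).
have e : glue_edge w u = u; last by rewrite e e.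
by rewrite /glue_edge; case: (level_edges w N) => [[x y] z]; do 3?[case: eqP => ?]; lia.
Qed.

Lemma edge_val_neq0 u : (0 < u <= N.+3)%N -> val u != 0.
Proof. by move=> uN; apply: glue_neq0 uN. Qed.

Lemma tri_edge_range i T x y : (i <= N)%N ->
  (0 < tri_edge w i T x y <= N.+3)%N /\ ((tri_edge w i T x y <= i) || (N < tri_edge w i T x y))%N.
Proof. by move=> iN; apply: level_edges_range => //; exact: tri_edge_in. Qed.

(* The linearization of the Ptolemy relation of the tetrahedron i.+1 in the
   logarithms of the four edges, each with its coefficient. *)
Definition log_ptolemy (i : nat) : seq (nat * C) :=
  let: (A, B, G, D) := (val (kept i), val (dropped i), val (diagonal i), val i.+1) in
  [:: (i.+1, eps C (is_L i) / 2 * (B / (A * G)));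
      (dropped i, eps C (is_L i) / 2 * (B / (A * G)));
      (kept i, - eps C (is_L i) * (A / (G * D)));
      (diagonal i, - eps C (is_L i) * (G / (A * D)))].

Lemma level_sides i :
  (tri_edge w i.+1 (is_L i) 0 1 = kept i) * (tri_edge w i.+1 (is_L i) 1 2 = diagonal i) *
  (tri_edge w i.+1 (is_L i) 0 2 = i.+1) * (tri_edge w i.+1 (~~ is_L i) 0 1 = diagonal i) *
  (tri_edge w i.+1 (~~ is_L i) 1 2 = kept i) * (tri_edge w i.+1 (~~ is_L i) 0 2 = i.+1) *
  (tri_edge w i (~~ is_L i) 0 1 = dropped i) * (tri_edge w i (~~ is_L i) 1 2 = kept i) *
  (tri_edge w i (~~ is_L i) 0 2 = diagonal i).
Proof.
rewrite /kept /dropped /diagonal /is_L /tri_edge /=.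
by case: (level_edges w i) => [[a b] g]; case: (phi w i).
Qed.

Lemma sheet_wt_top u : (u <= N)%N -> sheet_wt w C u = 1.
Proof. by move=> uN; rewrite /sheet_wt /sheet ltnNge uN oppr0 expr0z. Qed.

Lemma sheet_wt_bottom u : (N < u)%N -> sheet_wt w C u = t.
Proof. by move=> uN; rewrite /sheet_wt /sheet uN opprK expr1z. Qed.

(** The sides of tau_0 and of tau_N are glued to the same edges; the level weight t becomes the
    sheet weight of the bottom edges. *)
Lemma deform_glue e i T y : (i <= N)%N ->
  level_wt C i * deform w c e (Short (glue_level w i) T y) =
  \sum_(u < 3) (glue_edge w (tri_side w i T u) == e)%:R * (sheet_wt w C (tri_side w i T u)
    * ratconst (kappa (eps C T) (tri_val w c i T 0 1) (tri_val w c i T 1 2)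
                 (tri_val w c i T 0 2) (inord y) u)).
Proof.
move=> iN; rewrite /deform !(tri_val_glue c top_le).
case: i iN => [_|i iN]; last by rewrite /level_wt /= mul1r.
rewrite mulr_sumr; apply: eq_bigr => u _; rewrite mulrCA; congr (_ * _).
  have := edge_val_glue; rewrite /glue_level /=.
  have topN := tri_edge_in w N T; have g0 x y' : glue_edge w (tri_edge w N T x y') =
     glue_edge w (tri_edge w 0 T x y').
    rewrite (edge_val_top top_le); last exact: (allP top_le).
    rewrite /tri_edge /glue_edge /=; case: (level_edges w N) => [[a b] g].
    by case: (minn x y') (maxn x y') => [|[|m]] [|[|[|n]]]; case: T {topN};
      rewrite ?eqxx //; do 3?[case: eqP => ?] => //; lia.
  by rewrite /tri_side; case: (ord3P u) => -> /=; rewrite !g0.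
have b x y' : sheet_wt w C (tri_edge w 0 T x y') = t.
  rewrite sheet_wt_bottom // /tri_edge /=.
  by case: (minn x y') (maxn x y') => [|[|m]] [|[|[|n]]]; case: T; lia.
have tp x y' : sheet_wt w C (tri_edge w N T x y') = 1.
  by rewrite sheet_wt_top //; apply: (allP top_le); exact: tri_edge_in.
by rewrite /tri_side /glue_level /level_wt; case: (ord3P u) => -> /=; rewrite tp b mul1r.
Qed.

(** With B replaced by (A^2 + G^2) / D, the contributions of the three sides of the fourth cap
    combine, edge by edge, into the linearized Ptolemy relation scaled by eps B / (2 A G). *)
Lemma ptolemy_entryE (e i : 'I_N) : ptolemy_entry c e i =
  \sum_(x <- log_ptolemy i)
    (glue_edge w x.1 == e.+1)%:R * (sheet_wt w C x.1 * ratconst x.2).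
Proof.
have iN : (i <= N)%N by exact: ltnW.
rewrite /ptolemy_entry /cap_sum deform_glue // /deform !big_ord3 /tri_side /=.
rewrite /tri_val !level_sides /log_ptolemy !big_cons big_nil /=.
have i2 : inord 2 = 2 :> 'I_3 by apply: val_inj; rewrite /= inordK.
rewrite !i2 /kappa /=.
have D0 : val i.+1 != 0 by rewrite edge_val_neq0 //; have := ltn_ord i; lia.
have A0 : val (kept i) != 0 by apply/edge_val_neq0/(tri_edge_range _ _ _ iN).1.
have B0 : val (dropped i) != 0 by apply/edge_val_neq0/(tri_edge_range _ _ _ iN).1.
have G0 : val (diagonal i) != 0 by apply/edge_val_neq0/(tri_edge_range _ _ _ iN).1.
have rel := ptolemy_rel (ltn_ord i).
have two : (2 : C) != 0 by rewrite pnatr_eq0.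
have eN : eps C (~~ is_L i) = - eps C (is_L i).
  by rewrite /eps; case: (is_L i); rewrite /= ?expr1 ?expr0 ?opprK.
rewrite eN addr0; set A := val (kept i) in A0 rel *; set B := val (dropped i) in B0 rel *.
set G := val (diagonal i) in G0 rel *; set D := val i.+1 in D0 rel *.
set ep := eps C (is_L i).
have BE : B = (A ^+ 2 + G ^+ 2) / D by rewrite -rel mulrC mulKf.
have rD : ratconst (ep / 2 * (B / (A * G))) = ratconst (A / (G * D) * (ep / 2))
    - ratconst (G / (A * D) * (- ep / 2)).
  by rewrite -rmorphB BE; congr ratconst; field; rewrite A0 G0 D0.
have rB : ratconst (- (B / (A * G)) * (- ep / 2)) = ratconst (ep / 2 * (B / (A * G))).
  by congr ratconst; field; rewrite A0 G0.
have rA : ratconst (- ep * (A / (G * D))) = ratconst (- (A / (G * D)) * (ep / 2))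
    + ratconst (B / (A * G) * (- ep / 2)) - ratconst (G / (A * D) * (- ep / 2)).
  by rewrite -rmorphD -rmorphB BE; congr ratconst; field; rewrite A0 G0 D0.
have rG : ratconst (- ep * (G / (A * D))) = ratconst (A / (G * D) * (ep / 2))
    + ratconst (B / (A * G) * (- ep / 2)) - ratconst (- (G / (A * D)) * (- ep / 2)).
  by rewrite -rmorphD -rmorphB BE; congr ratconst; field; rewrite A0 G0 D0.
rewrite rB rA rG -/ep rD.
move: (sheet_wt _ _ _) (sheet_wt _ _ _) (sheet_wt _ _ _) (sheet_wt _ _ _) => w1 w2 w3 w4.
do 7?[move: (ratconst _) => ?]; do 4?[move: (_ == _)%:R => ?]; ring.
Qed.

End Ptolemy.

(** * Gradients of the edge values and the return map *)

Section Ptolemy.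
Variables (w : seq letter) (C : numFieldType) (c : nat -> C).
Local Notation N := (size w).
Local Notation K := (ratfun C).
Local Notation t := (tvar C).
Local Notation is_L := (is_L w).
Hypothesis top_le : all (fun u => u <= N)%N (edges_of w N).
Hypothesis c_ptolemy : ptolemy w c.
Let c_neq0 : forall e, (1 <= e <= N)%N -> c e != 0.
Proof. by case: c_ptolemy. Qed.
Local Notation val := (edge_val w c).

(* The gradients of the values at (h_i, v_i, d_i) as functions of the values at
   the three bottom edges. *)
Fixpoint level_grad (i : nat) : 'rV[C]_3 * 'rV[C]_3 * 'rV[C]_3 :=
  if i is j.+1 then
    let: (da, db, dg) := level_grad j in
    let: (a, b, g) := level_edges w j in
    match phi w j with
    | letterR => (da, dg,
        (val b)^-1 *: ((2 * val a) *: da + (2 * val g) *: dg - val j.+1 *: db))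
    | letterL => (dg, db,
        (val a)^-1 *: ((2 * val b) *: db + (2 * val g) *: dg - val j.+1 *: da))
    end
  else (delta_mx 0 0, delta_mx 0 1, delta_mx 0 2).

Definition edge_grad (u : nat) : 'rV[C]_3 :=
  if (u <= N)%N then (level_grad u).2 else delta_mx 0 (inord (u - N.+1)).

Lemma edge_grad_bottom k : edge_grad (N.+1 + k) = delta_mx 0 (inord k).
Proof. by rewrite /edge_grad addSn leqNgt ltnS leq_addr subSS addKn. Qed.

Lemma level_gradE i : (i <= N)%N ->
  level_grad i = let: (a, b, g) := level_edges w i in (edge_grad a, edge_grad b, edge_grad g).
Proof.
elim: i => [_|i IH iN].
  have := (edge_grad_bottom 0, edge_grad_bottom 1, edge_grad_bottom 2).
  rewrite addn0 addn1 addn2 /= => -[[-> ->] ->].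
  congr (delta_mx _ _, delta_mx _ _, delta_mx _ _); by apply: val_inj; rewrite /= inordK.
have IHi := IH (ltnW iN); have E : edge_grad i.+1 = (level_grad i.+1).2 by rewrite /edge_grad iN.
move: E; rewrite /= IHi; case: (level_edges w i) => [[a b] g].
by case: (phi w i) => /= ->.
Qed.

Lemma edge_grad_rel i : (i < N)%N -> val (dropped w i) *: edge_grad i.+1 =
  (2 * val (kept w i)) *: edge_grad (kept w i) + (2 * val (diagonal w i)) *: edge_grad (diagonal w i)
  - val i.+1 *: edge_grad (dropped w i).
Proof.
move=> iN; have iN' : (i <= N)%N by exact: ltnW.
have B0 : val (dropped w i) != 0.
  by apply/(edge_val_neq0 top_le c_ptolemy)/(tri_edge_range _ _ _ iN').1.
have -> : edge_grad i.+1 = (level_grad i.+1).2 by rewrite /edge_grad iN.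
move: B0; rewrite /= (level_gradE iN') /kept /dropped /diagonal /is_L /tri_edge.
by case: (level_edges w i) => [[a b] g]; case: (phi w i) => /= B0; rewrite scalerKV.
Qed.

(** The recursion differentiated with respect to the bottom values; the variation of log c is that
    of c divided by c. *)
Lemma log_ptolemy_grad i : (i < N)%N ->
  \sum_(x <- log_ptolemy w c i) (x.2 / val x.1) *: edge_grad x.1 = 0.
Proof.
move=> iN; have iN' : (i <= N)%N by exact: ltnW.
have D0 : val i.+1 != 0 by rewrite edge_val_neq0 //; lia.
have A0 : val (kept w i) != 0.
  by apply/(edge_val_neq0 top_le c_ptolemy)/(tri_edge_range _ _ _ iN').1.
have B0 : val (dropped w i) != 0.
  by apply/(edge_val_neq0 top_le c_ptolemy)/(tri_edge_range _ _ _ iN').1.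
have G0 : val (diagonal w i) != 0.
  by apply/(edge_val_neq0 top_le c_ptolemy)/(tri_edge_range _ _ _ iN').1.
have rel := edge_grad_rel iN; rewrite /log_ptolemy !big_cons big_nil /= addr0.
apply/matrixP => r j; have /matrixP/(_ r j) := rel; rewrite !mxE.
set d := edge_grad _ r j; set dA := edge_grad _ r j; set dG := edge_grad _ r j.
set dB := edge_grad _ r j => E.
have dE : d = (2 * val (kept w i) * dA + 2 * val (diagonal w i) * dG - val i.+1 * dB) / val (dropped w i).
  by rewrite -E mulrAC divff // mul1r.
have two : (2 : C) != 0 by rewrite pnatr_eq0.
rewrite dE; field; by rewrite A0 B0 G0 D0.
Qed.

Definition bottom_val (j : 'I_3) : C := val (N.+1 + j).

(** The transposed Jacobian matrix: the column [k] is the gradient of the top edge glued to the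
    bottom edge number [k]. *)
Definition return_grad : 'M[C]_3 :=
  \matrix_(j, k) edge_grad (glue_edge w (N.+1 + k)) 0 j.

Lemma bottom_val_neq0 j : bottom_val j != 0.
Proof. by apply: edge_val_neq0 => //; have := ltn_ord j; lia. Qed.

Lemma det_ptolemy :
  fdet (@ptolemy_entry w C c) =
  (\prod_(i < N) ratconst (eps C (is_L i) / 2 * (val (dropped w i) / (val (kept w i) * val (diagonal w i)))))
  * \det (1%:M - t *: map_mx (@ratconst C) return_grad).
Proof.
(* [T] collects the edges of the stack and [U] the three bottom edges; [G] adds t times the row of a
   bottom edge to the row of the top edge glued to it. [Z] is minus the matrix of derivatives of log
   c(e) in the logarithms of the bottom values. *)
pose T : 'M[K]_N := \matrix_(e, i)
  \sum_(x <- log_ptolemy w c i) (x.1 == e.+1)%:R * ratconst x.2.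
pose U : 'M[K]_(3, N) := \matrix_(j, i)
  \sum_(x <- log_ptolemy w c i) (x.1 == N.+1 + j)%N%:R * ratconst x.2.
pose G : 'M[K]_(N, 3) := \matrix_(e, j) (t * (glue_edge w (N.+1 + j) == e.+1)%:R).
pose Z : 'M[K]_(3, N) := \matrix_(j, e)
  ratconst (- bottom_val j * (edge_grad e.+1 0 j / val e.+1)).
have log_range (i : 'I_N) x : x \in log_ptolemy w c i ->
    (0 < x.1 <= N.+3)%N /\ ((x.1 <= i.+1) || (N < x.1))%N.
  have iN : (i <= N)%N by exact: ltnW.
  have R u v := tri_edge_range (is_L i) u v iN.
  rewrite !inE => /or4P[] /eqP-> /=; first by have := ltn_ord i; lia.
  - by have := R 1%N 2%N; rewrite /dropped; lia.
  - by have := R 0%N 1%N; rewrite /kept; lia.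
  - by have := R 0%N 2%N; rewrite /diagonal; lia.
rewrite fdet_ord (_ : \matrix_(e, i) _ = T + G *m U); last first.
  apply/matrixP => e i; rewrite !mxE ptolemy_entryE //.
  under [X in _ = _ + X]eq_bigr => j _ do rewrite !mxE mulr_sumr.
  rewrite exchange_big -big_split /=; apply: eq_big_seq => x /log_range[xr _].
  case: (leqP x.1 N) => xN.
    rewrite (edge_val_top top_le xN) sheet_wt_top // mul1r big1 ?addr0 // => j _.
    by rewrite (_ : (x.1 == _)%N = false) ?mul0r ?mulr0 //; lia.
  rewrite sheet_wt_bottom // (_ : (x.1 == e.+1) = false) ?mul0r ?add0r; last first.
    by have := ltn_ord e; lia.
  have jx : (x.1 - N.+1 < 3)%N by lia.
  rewrite (bigD1 (Ordinal jx)) //= big1 ?addr0 => [|j jn]; last first.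
    rewrite (_ : (x.1 == _)%N = false) ?mul0r ?mulr0 //; apply/eqP => E.
    by case/eqP: jn; apply: val_inj; rewrite /= E addKn.
  by rewrite subnKC // eqxx mul1r mulrCA mulrA.
(* The gradients satisfy each linearized relation; moving the terms of the bottom edges to the other
   side gives this equation. *)
have ZT : Z *m T = U.
  apply/matrixP => j i; rewrite !mxE.
  under eq_bigr => e _ do rewrite !mxE mulr_sumr.
  rewrite exchange_big /=.
  have /matrixP/(_ 0 j)/(congr1 (fun a => ratconst (bottom_val j * a))) :=
    log_ptolemy_grad (ltn_ord i).
  rewrite summxE mxE mulr0 rmorph0 mulr_sumr rmorph_sum /= => L0.
  apply/eqP; rewrite -subr_eq0 -sumrB -oppr_eq0 -[X in _ == X]L0 -sumrN; apply/eqP.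
  apply: eq_big_seq => x /log_range[xr _]; rewrite mxE.
  case: (leqP x.1 N) => xN.
    rewrite (_ : (x.1 == N.+1 + j)%N = false) ?mul0r ?subr0; last by lia.
    have ex : (x.1.-1 < N)%N by lia.
    have ex1 : x.1.-1.+1 = x.1 by lia.
    rewrite (bigD1 (Ordinal ex)) //= ex1 eqxx mul1r big1 ?addr0 => [|e en]; last first.
      rewrite (_ : (x.1 == e.+1) = false) ?mul0r ?mulr0 //; apply/eqP => E.
      by case/eqP: en; apply: val_inj; rewrite /= E.
    by rewrite -rmorphM -rmorphN; congr ratconst; ring.
  rewrite big1 ?sub0r ?opprK => [|e _]; last first.
    by rewrite (_ : (x.1 == e.+1) = false) ?mul0r ?mulr0 //; have := ltn_ord e; lia.
  have x3 : (x.1 - N.+1 < 3)%N by lia.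
  have xE : x.1 = (N.+1 + (x.1 - N.+1))%N by rewrite subnKC.
  rewrite {2 3}xE edge_grad_bottom mxE eqxx /=.
  have -> : (j == inord (x.1 - N.+1)) = (x.1 == N.+1 + j)%N.
    rewrite -(inj_eq val_inj) /= inordK //; clear -xN; move: (x.1) (nat_of_ord j) xN => u v; lia.
  case: eqP => [E|_]; last by rewrite mul0r !mulr0 rmorph0.
  rewrite mul1r; congr ratconst; rewrite E addKn -/(bottom_val j) mulr1 mulrC.
  by rewrite divfK // bottom_val_neq0.
rewrite (det_cut _ ZT); congr (_ * _).
  (* The relation of Delta_(i+1) involves, among the edges of the stack, only e_(i+1) and earlier
     ones. So [T] is triangular, with the coefficients of the e_(i+1) on its diagonal. *)
  rewrite -det_tr det_trig; last first.
    apply/is_trig_mxP => i e ie; rewrite !mxE big1_seq // => x /andP[_ /log_range[xr xo]].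
    by rewrite (_ : (x.1 == _) = false) ?mul0r //; have := ltn_ord e; lia.
  apply: eq_bigr => i _; rewrite !mxE /log_ptolemy !big_cons big_nil /= eqxx mul1r.
  have iN : (i <= N)%N by exact: ltnW.
  have R u v := tri_edge_range (is_L i) u v iN.
  have iN' := ltn_ord i.
  rewrite (_ : (dropped w i == i.+1) = false); last by have := R 1%N 2%N; rewrite /dropped; lia.
  rewrite (_ : (kept w i == i.+1) = false); last by have := R 0%N 1%N; rewrite /kept; lia.
  rewrite (_ : (diagonal w i == i.+1) = false); last by have := R 0%N 2%N; rewrite /diagonal; lia.
  by rewrite !mul0r !addr0.
(* Conjugation by the bottom values passes from logarithmic derivatives to ordinary ones. *)
pose P : 'M[K]_3 := diag_mx (\row_j ratconst (bottom_val j)).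
have P0 : \det P != 0.
  rewrite det_diag; apply/prodf_neq0 => j _; rewrite mxE fmorph_eq0; exact: bottom_val_neq0.
apply: (mulIf P0); rewrite -det_mulmx [RHS]mulrC -det_mulmx; congr (\det _).
rewrite mulmxDl mulmxBr mul1mx mulmx1; congr (_ + _).
apply/matrixP => j k; rewrite mul_mx_diag mul_diag_mx !mxE.
have kN : (0 < N.+1 + k <= N.+3)%N by have := ltn_ord k; lia.
have := glue_range top_le kN; case E: (glue_edge w (N.+1 + k)) => [|e] // eN.
rewrite (bigD1 (Ordinal eN)) //= big1 ?addr0 => [|e' en]; last first.
  rewrite !mxE E (_ : (e.+1 == e'.+1) = false) ?mulr0 //; apply/eqP => -[E'].
  by case/eqP: en; apply: val_inj; rewrite /= E'.
rewrite !mxE E eqxx mulr1 mulrAC -rmorphM.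
have -> : val e.+1 = bottom_val k by rewrite -E edge_val_glue.
rewrite mulNr mulrA mulNr divfK ?bottom_val_neq0 // rmorphN rmorphM mulNr; congr (- _).
by rewrite mulrC mulrCA.
Qed.

End Ptolemy.

Lemma det_reciprocal (L : fieldType) (M : 'M[L]_3) (v : 'rV[L]_3) (x : L) :
  \det M = 1 -> v != 0 -> v *m M = v ->
  \det (1%:M - x *: M) = - \det (x%:M - M).
Proof.
move=> dM v0 vM; have d1 : \det (1%:M - M) = 0.
  by apply/eqP/det0P; exists v => //; rewrite mulmxBr mulmx1 vM subrr.
(* A polynomial identity in [x] and the entries of [M], which exhibits the sum as a combination of
   det(1 - M) and 1 - det M, both zero here. *)
have H : \det (1%:M - x *: M) + \det (x%:M - M) =
    \det (1%:M - M) * (x * (x + 1)) + (1 - \det M) * (1 - x ^+ 2 + x ^+ 3 - x).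
  rewrite !det3E !mxE /= ?mulr1n ?mulr0n; ring.
by apply/eqP; rewrite -addr_eq0 H d1 dM subrr !mul0r addr0.
Qed.

(** * Determinant and fixed vector of the return map *)

Section Return.
Variables (w : seq letter) (C : numFieldType) (c : nat -> C).
Local Notation N := (size w).
Hypothesis top_le : all (fun u => u <= N)%N (edges_of w N).
Hypothesis c_ptolemy : ptolemy w c.
Local Notation val := (edge_val w c).

Let val_neq0 i u : (i <= N)%N -> u \in edges_of w i -> val u != 0.
Proof. by move=> iN /(level_edges_range iN)[uN _]; exact: edge_val_neq0. Qed.

Lemma ptolemy_level i a b g : (i < N)%N -> level_edges w i = (a, b, g) ->
  if phi w i is letterR then val i.+1 * val b = val a ^+ 2 + val g ^+ 2
  else val i.+1 * val a = val b ^+ 2 + val g ^+ 2.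
Proof.
move=> iN E; have := ptolemy_rel c_ptolemy iN.
by rewrite /kept /dropped /diagonal /is_L /tri_edge E; case: (phi w i).
Qed.

Definition grad_mx i : 'M[C]_3 :=
  let: (da, db, dg) := level_grad w c i in
  \matrix_(r, j) (nth 0 [:: da; db; dg] r) 0 j.

Definition level_prod i : C :=
  let: (a, b, g) := level_edges w i in val a * val b * val g.

(** With B the dropped and D the new value, each tetrahedron turns the row of the dropped edge into
    -D/B times itself plus multiples of the other rows, and exchanges it with the diagonal. The
    determinant and the product of the values are thus both multiplied by D/B. The second part is
    Euler's identity in degree 1. *)
Lemma grad_mxP i : (i <= N)%N ->
  \det (grad_mx i) * level_prod 0 = level_prod i /\
  let: (a, b, g) := level_edges w i in
  grad_mx i *m (\col_j bottom_val w c j) = \col_r (nth 0 [:: val a; val b; val g] r).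
Proof.
elim: i => [_|i IH iN].
  have -> : grad_mx 0 = 1%:M.
    apply/matrixP => r j; rewrite !mxE.
    by case: (ord3P r) => ->; case: (ord3P j) => -> /=; rewrite !mxE.
  rewrite det1 mul1r mul1mx; split=> //=; apply/matrixP => r j; rewrite !mxE /bottom_val.
  by case: (ord3P r) => -> /=; rewrite ?addn0 ?addn1 ?addn2.
have [] := IH (ltnW iN); have := @ptolemy_level i; have := @val_neq0 i.
have D0 : val i.+1 != 0 by rewrite edge_val_neq0 //; lia.
rewrite /grad_mx /level_prod /edges_of /=.
case E: (level_edges w i) => [[a b] g] nz /(_ _ _ _ iN erefl).
case: (level_grad w c i) => [[da db] dg] rel dP eP.
have a0 : val a != 0 by apply: (nz _ (ltnW iN)); rewrite !inE eqxx.
have b0 : val b != 0 by apply: (nz _ (ltnW iN)); rewrite !inE eqxx orbT.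
have g0 : val g != 0 by apply: (nz _ (ltnW iN)); rewrite !inE eqxx !orbT.
move/matrixP: eP => eP; have := (eP 0 0, eP 1 0, eP 2 0).
rewrite !mxE !big_ord3 !mxE /= => -[[ea eb] eg].
move: dP; rewrite det3E !mxE /=; set Q := _ * val N.+3 => dP.
case: (phi w i) rel => rel /=; split.
- rewrite det3E !mxE /=; apply: (mulfI b0).
  rewrite (_ : val b * (val a * _ * _) = (val a * val b * val g) * val i.+1); last by ring.
  by rewrite -dP; field.
- apply/matrixP => r j; rewrite !mxE big_ord3 !mxE.
  case: (ord3P r) => -> //=; rewrite !mxE; apply: (mulfI b0).
  rewrite [RHS]mulrC rel (_ : val a ^+ 2 + _ = 2 * val a * val a + 2 * val g * val g - val i.+1 * val b);
    last by rewrite rel; ring.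
  by rewrite -[X in _ = 2 * val a * X + _ - _]ea -[X in _ = _ + 2 * val g * X - _]eg
    -[X in _ = _ - val i.+1 * X]eb; field.
- rewrite det3E !mxE /=; apply: (mulfI a0).
  rewrite (_ : val a * (val g * _ * _) = (val a * val b * val g) * val i.+1); last by ring.
  by rewrite -dP; field.
- apply/matrixP => r j; rewrite !mxE big_ord3 !mxE.
  case: (ord3P r) => -> //=; rewrite !mxE; apply: (mulfI a0).
  rewrite [RHS]mulrC rel (_ : val b ^+ 2 + _ = 2 * val b * val b + 2 * val g * val g - val i.+1 * val a);
    last by rewrite rel; ring.
  by rewrite -[X in _ = 2 * val b * X + _ - _]eb -[X in _ = _ + 2 * val g * X - _]eg
    -[X in _ = _ - val i.+1 * X]ea; field.
Qed.
End Return.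

Section Return.
Variables (w : seq letter) (C : numFieldType) (c : nat -> C).
Local Notation N := (size w).
Hypothesis top_le : all (fun u => u <= N)%N (edges_of w N).
Hypothesis c_ptolemy : ptolemy w c.
Local Notation val := (edge_val w c).
Local Notation return_grad := (return_grad w c).

Lemma glue_bottom (k : 'I_3) : glue_edge w (N.+1 + k) = nth 0%N (edges_of w N) k.
Proof.
rewrite /glue_edge /edges_of; case: (level_edges w N) => [[a b] g].
by case: (ord3P k) => -> /=; rewrite ?addn0 ?addn1 ?addn2 ?eqxx //;
  do ?[case: eqP => //]; lia.
Qed.

Lemma return_gradE : return_grad = (grad_mx w c N)^T.
Proof.
apply/matrixP => j k; rewrite !mxE /grad_mx level_gradE // glue_bottom /edges_of.
case: (level_edges w N) => [[a b] g]; rewrite mxE.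
by case: (ord3P k) => ->.
Qed.

Lemma nth_top_val (k : 'I_3) : val (nth 0%N (edges_of w N) k) = bottom_val w c k.
Proof. by rewrite -glue_bottom edge_val_glue. Qed.

Lemma det_return_grad : \det return_grad = 1.
Proof.
have [dP _] := grad_mxP top_le c_ptolemy (leqnn N).
have E : level_prod w c N = level_prod w c 0.
  have := (nth_top_val 0, nth_top_val 1, nth_top_val 2).
  rewrite /level_prod /edges_of /bottom_val /=; case: (level_edges w N) => [[a b] g] /=.
  by rewrite addn0 addn1 addn2 => -[[-> ->] ->].
rewrite return_gradE det_tr; apply: (@mulIf _ (level_prod w c 0)); last by rewrite dP mul1r.
by rewrite /level_prod /= !mulf_neq0 // edge_val_neq0 //; lia.
Qed.

Lemma return_grad_euler :
  (\row_j bottom_val w c j) *m return_grad = \row_j bottom_val w c j.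
Proof.
have [_] := grad_mxP top_le c_ptolemy (leqnn N).
have := nth_top_val; rewrite /edges_of.
case: (level_edges w N) => [[a b] g] /= nE H.
apply: trmx_inj; rewrite trmx_mul return_gradE trmxK.
have -> : (\row_j bottom_val w c j)^T = \col_j bottom_val w c j.
  by apply/matrixP => j k; rewrite !mxE.
rewrite H; apply/matrixP => j k; rewrite !mxE -nE.
by case: (ord3P j) => ->.
Qed.

Lemma det_return :
  \det (1%:M - tvar C *: map_mx (@ratconst C) return_grad) =
  - \det ((tvar C)%:M - map_mx (@ratconst C) return_grad^T).
Proof.
rewrite (@det_reciprocal _ _ (map_mx (@ratconst C) (\row_j bottom_val w c j))).
- by rewrite -[in RHS]det_tr linearB /= tr_scalar_mx map_trmx trmxK.
- by rewrite det_map_mx det_return_grad rmorph1.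
- apply/eqP => /matrixP/(_ 0 0)/eqP; rewrite !mxE fmorph_eq0.
  by apply/negP; exact: bottom_val_neq0.
- by rewrite -map_mxM return_grad_euler.
Qed.

End Return.

(** * The torsion *)

Section Torsion.
Variables (w : seq letter) (C : numFieldType) (c : nat -> C) (lift : cell -> path_).
Local Notation N := (size w).
Local Notation K := (ratfun C).
Local Notation t := (tvar C).
Local Notation is_L := (is_L w).
Hypothesis top_le : all (fun u => u <= N)%N (edges_of w N).
Hypothesis c_ptolemy : ptolemy w c.
Let c_neq0 : forall e, (1 <= e <= N)%N -> c e != 0.
Proof. by case: c_ptolemy. Qed.
Local Notation val := (edge_val w c).
Local Notation tri_prod := (tri_prod w c).
Local Notation entry k := (fun x y : col_ix w k.+1 => based_entry c (row_of x) (col_of y)).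
Local Notation return_det := (\det (t%:M - map_mx (@ratconst C) (return_grad w c)^T)).

(** This is a characteristic polynomial in t, hence monic. It ensures that the minor in degree 1
    does not vanish. *)
Lemma det_charpoly_neq0 (M : 'M[C]_3) : \det (t%:M - map_mx (@ratconst C) M) != 0.
Proof.
have -> : t%:M - map_mx (@ratconst C) M = map_mx (@tofrac _) (char_poly_mx M).
  apply/matrixP => i j; rewrite !mxE rmorphB /=.
  by case: eqP => _; rewrite ?mulr1n ?mulr0n ?rmorph0.
by rewrite det_map_mx tofrac_eq0 monic_neq0 // char_poly_monic.
Qed.

(** The cancellation of monomials, tetrahedron by tetrahedron: the two hexagons above it and its
    diagonal entry in the Ptolemy block balance the long edge e_(i+1) and its first three caps, up
    to sign. *)
Lemma tri_prod_ladder i : (i < N)%N ->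
  (2 * tri_prod i.+1 false) * (2 * tri_prod i.+1 true)
  * (eps C (is_L i) / 2 * (val (dropped w i) / (val (kept w i) * val (diagonal w i))))
  = - (c i.+1 ^+ 2 * (2 * tri_prod i (is_L i))).
Proof.
move=> iN; have iN' : (i <= N)%N by exact: ltnW.
have A0 : val (kept w i) != 0.
  by apply/(edge_val_neq0 top_le c_ptolemy)/(tri_edge_range _ _ _ iN').1.
have G0 : val (diagonal w i) != 0.
  by apply/(edge_val_neq0 top_le c_ptolemy)/(tri_edge_range _ _ _ iN').1.
have D : val i.+1 = c i.+1 by rewrite /edge_val (edge_val_top top_le).
rewrite /tri_prod /tri_val -!/(kept w i) -!/(dropped w i) -!/(diagonal w i) /=.
have two : (2 : C) != 0 by rewrite pnatr_eq0.
have := level_sides w i; case: (is_L i) => /= S; rewrite !S D /eps /=; field; by rewrite A0 G0.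
Qed.

Lemma one_sub_t_neq0 : 1 - t != 0 :> K.
Proof.
rewrite /tvar -[1](rmorph1 (@tofrac _)) -rmorphB tofrac_eq0 -opprB oppr_eq0 subr_eq0.
by apply/eqP => /(congr1 (fun p : {poly C} => size p)); rewrite size_polyX size_poly1.
Qed.

Lemma minor2_neq0 : fdet (entry 2) != 0.
Proof.
rewrite (minor2E top_le c_neq0); apply/prodf_neq0 => i _; rewrite fmorph_eq0.
have iN' : (i <= N)%N by exact: ltnW.
have V x y := edge_val_neq0 top_le c_ptolemy (tri_edge_range (is_L i) x y iN').1.
have two : (2 : C) != 0 by rewrite pnatr_eq0.
by rewrite /tri_prod /tri_val !mulf_neq0 // /eps signr_eq0.
Qed.

Lemma minor1_sqr : (0 < N)%N -> (exists i : 'I_N, is_L i != is_L (cyc_pred w i)) ->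
  fdet (entry 1) ^+ 2 = (fdet (entry 0) * fdet (entry 2) * return_det) ^+ 2.
Proof.
move=> N0 switch; rewrite minor1E // (det_ptolemy top_le c_ptolemy) (det_return top_le c_ptolemy).
rewrite !exprMn minor0E // minor2E // sqrrN !exprMn.
have E : (\prod_(x : 'I_N * bool) ratconst (2 * tri_prod x.1.+1 x.2)) *
    (\prod_(i < N) ratconst (eps C (is_L i) / 2 *
       (val (dropped w i) / (val (kept w i) * val (diagonal w i))))) =
    (-1) ^+ N * ((\prod_(i < N) ratconst (c i.+1) ^+ 2) *
       \prod_(i < N) ratconst (2 * tri_prod i (is_L i))).
  rewrite -(pair_bigA _ (fun (i : 'I_N) T => ratconst (2 * tri_prod i.+1 T))) /=.
  rewrite -!big_split -[X in (-1) ^+ X](card_ord N) -prodr_const -big_split /=.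
  apply: eq_bigr => i _; rewrite big_bool /= -!rmorphM -rmorphXn -rmorphM mulN1r -rmorphN.
  by congr ratconst; rewrite -tri_prod_ladder //; congr (_ * _); exact: mulrC.
move/(congr1 (fun x => x ^+ 2)): E; rewrite !exprMn sqrr_sign mul1r => E.
by rewrite [X in X * _ = _]mulrA E; ring.
Qed.

Lemma minor0_neq0 : (0 < N)%N -> fdet (entry 0) != 0.
Proof.
move=> N0; suff H : fdet (entry 0) ^+ 2 != 0 by move: H; rewrite sqrf_eq0.
rewrite minor0E // sqrf_eq0; apply: mulf_neq0; last first.
  exact: expf_neq0 one_sub_t_neq0.
apply/prodf_neq0 => i _; rewrite expf_neq0 // fmorph_eq0 c_neq0 //=; exact: ltn_ord.
Qed.

Lemma torsion_sqr b : (0 < N)%N -> (exists i : 'I_N, is_L i != is_L (cyc_pred w i)) ->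
  is_lifting w lift -> cohomology_trivial (coboundary w c lift) ->
  lifted_bases (boundary w c lift) b ->
  exists k : int, torsion (boundary w c lift) b ^+ 2 = (t ^ k * return_det) ^+ 2.
Proof.
move=> N0 switch lift_ok triv lb.
pose D k := based_boundary w c (base_sheet w) k.
pose G k := gauge w c lift (base_sheet w) k.
have minorE k : minor D (fun k => @enc w k \o @col_of w k) (fun k => @enc w k \o @row_of w k) k
    = fdet (entry k).
  apply: eq_fdet => x y; rewrite /D /=; exact: (based_boundaryE top_le c_neq0).
have sq := minor1_sqr N0 switch.
have m0 := minor0_neq0 N0; have m2 := minor2_neq0.
have m1 : fdet (entry 1) != 0.
  suff H : fdet (entry 1) ^+ 2 != 0 by move: H; rewrite sqrf_eq0.
  rewrite sq sqrf_eq0; exact: mulf_neq0 (mulf_neq0 m0 m2) (det_charpoly_neq0 _).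
have mn k : minor D (fun k => @enc w k \o @col_of w k) (fun k => @enc w k \o @row_of w k) k != 0.
  rewrite minorE; case: k => [|[|[|k]]]; [exact: m0|exact: m1|exact: m2|].
  by rewrite (fdet0 _ card_void) oner_eq0.
have Gu k : G k \in unitmx by exact: gauge_unit.
rewrite (torsion_minors (D := D) (G := G) Gu _ _ (@enc_matching_bij w) _ _ mn lb); first last.
- exact: card_void.
- exact: card_void.
- exact: boundary_sqr0.
- by move=> k; exact: boundary_gauge.
have dG k : exists m : int, \det (G k) = t ^ m by exact: det_gauge.
have [k0 ->] := dG 0; have [k1 ->] := dG 1; have [k2 ->] := dG 2; have [k3 ->] := dG 3.
(* The changes of basis enter with the alternating exponents of the torsion. *)
exists (k1 + k3 - (k0 + k2)); rewrite !minorE.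
rewrite !(expfzDr _ _ (tvar_neq0 C)) -invr_expz expfzDr ?tvar_neq0 //.
rewrite [in RHS]exprMn; congr (_ * _).
rewrite expr_div_n sq [X in X / _]exprMn mulrAC divff; first exact: mul1r.
by rewrite sqrf_eq0; exact: mulf_neq0 m0 m2.
Qed.
End Torsion.

(** * The word *)

Section Words.
Local Open Scope nat_scope.

Lemma word_split n s t : (0 < n)%N -> (0 < s n)%N -> (1 < t n)%N ->
  exists u, word n s t = u ++ letterR :: nseq (t n) letterL.
Proof.
case: n => // n _ s0 _; exists (word n s t ++ nseq (s n.+1).-1 letterR).
rewrite /word -[n.+1]addn1 iotaD map_cat flatten_cat /= cats0 !add1n addn1.
rewrite -!catA; congr (_ ++ _); rewrite -[in LHS](prednK s0) -addn1 nseqD -catA //.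
Qed.

Lemma level_edgesS w i : level_edges w i.+1 =
  let: (a, b, g) := level_edges w i in
  if phi w i is letterR then (a, g, i.+1) else (g, b, i.+1).
Proof. by rewrite /=; case: (level_edges w i) => [[a b] g]; case: (phi w i). Qed.

Section Tail.
Variables (u : seq letter) (m : nat).
Let w := u ++ letterR :: nseq m letterL.

Lemma phi_tail j : (j < m)%N -> phi w (size u).+1 = letterR /\ phi w ((size u).+2 + j) = letterL.
Proof.
move=> jm; rewrite /phi /w addSn !nth_cat ltnn subnn; split=> //.
rewrite (_ : ((size u).+1 + j < size u)%N = false); last by lia.
by rewrite (_ : ((size u).+1 + j - size u = j.+1)%N) /= ?nth_nseq ?if_same //; lia.
Qed.

(** The final [letterR] makes the edge numbered [(size u).+1] vertical. Each later [letterL] leaves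
    it in place and turns the former diagonal into the horizontal edge. *)
Lemma level_edges_tail j : (j < m)%N ->
  exists a, level_edges w ((size u).+2 + j) =
    (if j is j'.+1 then (size u).+2 + j' else a, (size u).+1, (size u).+2 + j)%N.
Proof.
elim: j => [|j IH] jm.
  have [R _] := phi_tail jm; rewrite addn0 level_edgesS R level_edgesS.
  by case: (level_edges w (size u)) => [[a b] g]; case: (phi w (size u)); eexists.
have [a E] := IH (ltnW jm); have [_ L] := phi_tail (ltnW jm).
by rewrite addnS level_edgesS E L; exists a.
Qed.
End Tail.

Section Word.
Variables (n : nat) (s t : nat -> nat).
Hypotheses (n_gt0 : (0 < n)%N) (sn_gt0 : (0 < s n)%N) (tn_gt1 : (1 < t n)%N).
Local Notation w := (word n s t).
Local Notation N := (size w).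

Lemma word_size_gt : (t n < N)%N.
Proof.
have [u ->] := word_split n_gt0 sn_gt0 tn_gt1.
by rewrite size_cat /= size_nseq addnS ltnS leq_addl.
Qed.

Lemma level_edges_top : level_edges w N = (N - 1, N - t n, N)%N.
Proof.
have [u ->] := word_split n_gt0 sn_gt0 tn_gt1.
rewrite [in LHS]size_cat [size (_ :: _)]/= size_nseq.
(* The letter phi_i acts between tau_i and tau_(i+1), so below tau_N only [(t n).-1] letters of the
   last run have acted; the remaining one acts at the bottom as phi_0. *)
have [a E] := @level_edges_tail u (t n) (t n).-1 ltac:(lia).
have -> : (size u + (t n).+1 = (size u).+2 + (t n).-1)%N by lia.
rewrite E size_cat /= size_nseq.
by case: (t n) tn_gt1 => [|[|m]] //= _; congr (_, _, _); lia.
Qed.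

Lemma word_top_le : all (fun u => u <= N)%N (edges_of w N).
Proof. by rewrite /edges_of level_edges_top /= !leq_subr leqnn. Qed.

Lemma letter_switch : exists i : 'I_N, is_L w i != is_L w (cyc_pred w i).
Proof.
have tN := word_size_gt.
(* The last R is the letter number N - t_n, so the next index is a change of letter; it is below N
   because t_n is at least 2. *)
have iN : (N - t n + 1 < N)%N by lia.
exists (Ordinal iN); rewrite /cyc_pred /= addn1 /=.
have [u E] := word_split n_gt0 sn_gt0 tn_gt1.
have Nu : (N - t n = (size u).+1)%N by rewrite E size_cat /= size_nseq; lia.
rewrite Nu /is_L E; have [R L] := @phi_tail u (t n) 0 ltac:(lia).
by rewrite -[X in phi _ X]addn0 L R.
Qed.
End Word.

End Words.

(** * The Jacobian matrix *)

Section Gradient.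
Variables (C : numFieldType) (m : nat).
Implicit Types (f g h : 'rV[C]_m.+1 -> C) (d : 'rV[C]_m.+1) (p : 'rV[C]_m.+1).

Definition pairing d (v : 'rV[C]_m.+1) : C := (v *m d^T) 0 0.

Lemma pairingD d1 d2 v : pairing (d1 + d2) v = pairing d1 v + pairing d2 v.
Proof. by rewrite /pairing linearD mulmxDr mxE. Qed.

Lemma pairingZ a d v : pairing (a *: d) v = a * pairing d v.
Proof. by rewrite /pairing linearZ -scalemxAr mxE. Qed.

(** The differential at [p] is the pairing with the row vector [d]; [C^o] is the field as a normed
    module over itself. *)
Definition has_grad p f d : Prop := is_diff p (f : 'rV[C]_m.+1 -> C^o) (pairing d : _ -> C^o).

Lemma has_grad_coord p j : has_grad p (fun x => x 0 j) (delta_mx 0 j).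
Proof.
have E : pairing (delta_mx 0 j) = (fun x => x 0 j).
  by apply: funext => v; rewrite /pairing trmx_delta -colE !mxE.
apply: DiffDef; first exact: differentiable_coord.
rewrite E; have fl : linear (fun N : 'rV[C]_m.+1 => N 0 j : C^o).
  by move=> a u v; rewrite !mxE.
pose F : {linear 'rV[C]_m.+1 -> C^o} := HB.pack (fun N : 'rV[C]_m.+1 => N 0 j : C^o)
  (GRing.isLinear.Build _ _ _ _ _ fl).
by have := @diff_lin _ _ _ F p (@coord_continuous _ _ _ 0 j).
Qed.

(** One step of the Ptolemy recursion, with the gradient written in the form used by
    [level_grad]. *)
Lemma has_grad_quot p f g h df dg dh : has_grad p f df -> has_grad p g dg ->
  has_grad p h dh -> h p != 0 ->
  has_grad p (fun x => (f x ^+ 2 + g x ^+ 2) / h x)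
    ((h p)^-1 *: ((2 * f p) *: df + (2 * g p) *: dg
                  - ((f p ^+ 2 + g p ^+ 2) / h p) *: dh)).
Proof.
move=> Hf Hg Hh h0.
have inv : is_diff (h p) (GRing.inv : C^o -> C^o) (fun k => - (h p) ^- 2 *: k).
  by apply: DiffDef; [exact: differentiable_Rinv | exact: diff_Rinv].
have Hi := is_diff_comp Hh inv.
have := is_diffM (is_diffD (is_diffX 1 Hf) (is_diffX 1 Hg)) Hi.
move=> H; apply: (is_diff_eq (f := (fun x => (f x ^+ 2 + g x ^+ 2) / h x) : _ -> C^o) H).
apply: funext => v; rewrite -scaleNr !(pairingZ, pairingD) !fctE /= /GRing.scale /= !expr1.
by field.
Qed.

Lemma has_grad_row3 p (f : 'I_3 -> 'rV[C]_m.+1 -> C) (d : 'I_3 -> 'rV[C]_m.+1) :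
  (forall i, has_grad p (f i) (d i)) ->
  jacobian_matrix (fun x => row3 (f 0 x) (f 1 x) (f 2 x)) p = \matrix_(i, j) d i 0 j.
Proof.
move=> H; pose inj i (y : C^o) : 'rV[C]_3 := y *: delta_mx 0 i.
(* The row-valued map is a sum of scalar functions times basis vectors, to which the sum and
   composition rules apply. *)
pose F : 'rV[C]_m.+1 -> 'rV[C]_3 := (inj 0 \o f 0) + (inj 1 \o f 1) + (inj 2 \o f 2).
have row3E (y : 'I_3 -> C) : row3 (y 0) (y 1) (y 2) = inj 0 (y 0) + inj 1 (y 1) + inj 2 (y 2).
  apply/matrixP => r j; rewrite !mxE (ord1 r) eqxx.
  by case: (ord3P j) => -> /=; rewrite ?(mulr1, mulr0, add0r, addr0).
have FE : (fun x => row3 (f 0 x) (f 1 x) (f 2 x)) = F.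
  by apply: funext => x; rewrite (row3E (f^~ x)).
have dF : is_diff p F ((inj 0 \o pairing (d 0)) + (inj 1 \o pairing (d 1)) + (inj 2 \o pairing (d 2))).
  have S i := is_diff_comp (H i) (is_diff_scalel (f i p) (delta_mx 0 i : 'rV[C]_3)).
  exact: is_diffD (is_diffD (S 0) (S 1)) (S 2).
rewrite /jacobian_matrix /jacobian FE; apply/matrixP => i j.
rewrite [LHS]mxE [LHS]mxE (@diff_val _ _ _ _ _ _ _ dF) !fctE /=.
rewrite -(row3E (fun k => pairing (d k) _)) /pairing -!rowE !mxE.
by case: (ord3P i) => -> /=.
Qed.
End Gradient.

(** * Differentiation of the recursion at the given assignment *)

Section Return.
Variables (w : seq letter) (C : numFieldType) (c : nat -> C).
Local Notation N := (size w).
Hypothesis top_le : all (fun u => u <= N)%N (edges_of w N).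
Hypothesis c_ptolemy : ptolemy w c.
Local Notation val := (edge_val w c).
Local Notation p := (row3 (val N.+1) (val N.+2) (val N.+3)).

(** At the given assignment each denominator is an edge value, hence nonzero, and the Ptolemy
    relations reproduce the recursion. *)
Lemma level_fun_val i : (i <= N)%N ->
  level_fun w p i = let: (a, b, g) := level_edges w i in (val a, val b, val g).
Proof.
elim: i => [_|i IH iN] /=; first by rewrite !mxE.
have := @ptolemy_level w C c c_ptolemy i.
have := @level_edges_range w i.
rewrite (IH (ltnW iN)) /edges_of; case: (level_edges w i) => [[a b] g].
move=> R /(_ _ _ _ iN erefl).
have nz u : u \in [:: a; b; g] -> val u != 0.
  by move=> /(R _ (ltnW iN)) [uN _]; exact: edge_val_neq0.
have a0 := nz a; have b0 := nz b; rewrite !inE !eqxx !orbT in a0 b0.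
by case: (phi w i) => rel /=; rewrite -rel mulfK ?a0 ?b0.
Qed.

Lemma level_fun_grad i : (i <= N)%N ->
  let: (da, db, dg) := level_grad w c i in
  [/\ has_grad p (fun x => (level_fun w x i).1.1) da,
      has_grad p (fun x => (level_fun w x i).1.2) db &
      has_grad p (fun x => (level_fun w x i).2) dg].
Proof.
elim: i => [_|i IH iN]; first by split; apply: has_grad_coord.
have := IH (ltnW iN); have := level_fun_val (ltnW iN).
have := @ptolemy_level w C c c_ptolemy i.
have := @level_edges_range w i; rewrite /edges_of /=.
case: (level_edges w i) => [[a b] g] R /(_ _ _ _ iN erefl) rel vE.
have nz u : u \in [:: a; b; g] -> val u != 0.
  by move=> /(R _ (ltnW iN)) [uN _]; exact: edge_val_neq0.
have a0 := nz a; have b0 := nz b; rewrite !inE !eqxx !orbT in a0 b0.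
case: (level_grad w c i) => [[da db] dg] [Ha Hb Hg].
have ext f f' d : f =1 f' -> has_grad p f d -> has_grad p f' d by move=> /funext ->.
have {}a0 : val a != 0 by exact: a0.
have {}b0 : val b != 0 by exact: b0.
case: (phi w i) rel => rel; split => /=.
- by apply: ext Ha => x; case: (level_fun w x i) => [[]].
- by apply: ext Hg => x; case: (level_fun w x i) => [[]].
- have := has_grad_quot Ha Hg Hb; rewrite vE /= -rel mulfK // => /(_ b0).
  by apply: ext => x; case: (level_fun w x i) => [[]].
- by apply: ext Hg => x; case: (level_fun w x i) => [[]].
- by apply: ext Hb => x; case: (level_fun w x i) => [[]].
- have := has_grad_quot Hb Hg Ha; rewrite vE /= -rel mulfK // => /(_ a0).
  by apply: ext => x; case: (level_fun w x i) => [[]].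
Qed.

Lemma edge_fun_grad i : (i <= N)%N ->
  has_grad p (edge_fun w i) (level_grad w c i).2.
Proof. by move=> /level_fun_grad; case: (level_grad w c i) => [[da db] dg] []. Qed.

Lemma jacobian_return a b g : (0 < a)%N -> (0 < b)%N -> level_edges w N = (a, b, g) ->
  jacobian_matrix (fun x => row3 (edge_fun w a x) (edge_fun w b x) (edge_fun w g x))
    (row3 (c (glue_edge w N.+1)) (c (glue_edge w N.+2)) (c (glue_edge w N.+3)))
  = (return_grad w c)^T.
Proof.
move=> a0 b0 E; have := top_le; rewrite /edges_of E => /and4P[aN bN gN _].
pose e := nth 0%N [:: a; b; g].
rewrite (@has_grad_row3 _ _ _ (fun i => edge_fun w (e i)) (fun i => edge_grad w c (e i))).
  apply/matrixP => i j; by rewrite !mxE (glue_bottom top_le) /edges_of E.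
move=> i; rewrite /edge_grad.
have ei : (e i <= N)%N by case: (ord3P i) => ->.
by rewrite ei; exact: edge_fun_grad.
Qed.
End Return.

Theorem theorem4p11 (R : realType) (n : nat) (s t : nat -> nat)
    (n_gt0 : (0 < n)%N)
    (st_gt0 : forall i, (1 <= i <= n)%N -> (0 < s i)%N /\ (0 < t i)%N)
    (tn_gt1 : (1 < t n)%N)
    (c : nat -> R[i]) (lift : cell -> path_) :
  let w := word n s t in
  let N := size w in
  ptolemy w c ->
  is_lifting w lift ->
  cohomology_trivial (coboundary w c lift) ->
  fiber_irreducible w c ->
  let jac := jacobian_matrix
    (fun x => row3 (edge_fun w (N - 1) x) (edge_fun w (N - t n) x) (edge_fun w N x))
    (row3 (c (glue_edge w N.+1)) (c (glue_edge w N.+2)) (c (glue_edge w N.+3))) in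
  forall b, lifted_bases (boundary w c lift) b ->
  exists (e : bool) (k : int),
    torsion (boundary w c lift) b =
    (-1) ^+ e * tvar _ ^ k * \det ((tvar _)%:M - map_mx (@ratconst _) jac).
Proof.
move=> w N pt lift_ok triv _ jac b lb.
have [sn_gt0 _] := st_gt0 n ltac:(by rewrite n_gt0 leqnn).
have tN := word_size_gt n_gt0 sn_gt0 tn_gt1.
have top_le := word_top_le n_gt0 sn_gt0 tn_gt1.
have switch := letter_switch n_gt0 sn_gt0 tn_gt1.
have jacE : jac = (return_grad w c)^T.
  apply: jacobian_return => //; last exact: level_edges_top.
  - by rewrite subn_gt0; apply: leq_trans tN; apply: leq_trans tn_gt1 _.
  - by rewrite subn_gt0.
have N0 : (0 < size w)%N by apply: leq_ltn_trans tN.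
have [k] := torsion_sqr top_le pt N0 switch lift_ok triv lb.
(* Equality of the squares leaves exactly the sign ambiguity of the torsion. *)
rewrite -jacE => /eqP; rewrite eqf_sqr => /orP[] /eqP->.
- by exists false, k; rewrite expr0 mul1r.
- by exists true, k; rewrite expr1 !mulNr mul1r.
Qed.
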